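(* Let $n\ge1$ and $0<\gamma<\frac n2$, and let $(S^n,g_c)$ be the standard sphere. Then, as operators on $C^\infty(S^n)$, $$\sum_{j=1}^{n+1}x_j\left[P_{2\gamma}^{g_c},x_j\right]=\gamma(n+2\gamma-2)\,P_{2(\gamma-1)}^{g_c},$$ where $x_1,\dots,x_{n+1}$ are the standard coordinates on $\mathbb R^{n+1}$ restricted to $S^n$ (acting by multiplication), $[P,x_j](u)=P(x_ju)-x_jP(u)$, and $P_{2(\gamma-1)}^{g_c}$ is regarded as $\left(P_{2(1-\gamma)}^{g_c}\right)^{-1}$ when $0<\gamma<1$.
   Context: $(S^n,g_c)$ is the unit sphere in $\mathbb R^{n+1}$ with its canonical metric. The intertwining operator of order $2\gamma$ is $$P_{2\gamma}^{g_c}=\frac{\Gamma\left(B+\frac12+\gamma\right)}{\Gamma\left(B+\frac12-\gamma\right)},\qquad B=\sqrt{-\Delta_{S^n}+\left(\tfrac{n-1}{2}\right)^2},$$ defined by spectral calculus, where $\Delta_{S^n}$ is the Laplace–Beltrami operator: on spherical harmonics of degree $h$ (restrictions to $S^n$ of homogeneous harmonic polynomials of degree $h$ on $\mathbb R^{n+1}$), $P_{2\gamma}^{g_c}$ acts as multiplication by $\Gamma(h+\frac n2+\gamma)/\Gamma(h+\frac n2-\gamma)$. The same formula is used for other values of the order; in particular $P_{2(\gamma-1)}^{g_c}$ acts on degree-$h$ spherical harmonics as multiplication by $\Gamma(h+\frac n2+\gamma-1)/\Gamma(h+\frac n2-\gamma+1)$ (so $P_0^{g_c}$ is the identity). *)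

(* Defs.v *)
From HB Require Import structures.
From mathcomp Require Import all_boot all_order all_algebra.
From mathcomp Require Import archimedean.
From mathcomp Require Import all_classical all_reals all_analysis.
(* Without the notations, which clash with those of mathcomp-analysis. *)
From mathcomp.multinomials Require mpoly.
Import -(notations) mpoly.

Set Implicit Arguments.
Unset Strict Implicit.
Unset Printing Implicit Defensive.

Import Order.TTheory GRing.Theory Num.Theory.
Import numFieldNormedType.Exports.
Local Open Scope classical_set_scope.
Local Open Scope ring_scope.

Notation mpolyType R n := (mpoly n R).

Section GammaFunction.
Variable R : realType.
Implicit Type x : R.

Definition Gamma_int x : R :=
  \int[lebesgue_measure]_(t in `]0%R, +oo[) (t `^ (x - 1) * expR (- t)).

(* Euler's integral for x > 0, extended to x <= 0 by the functional equation
   Gamma(x) = Gamma(x + k) / (x (x + 1) ... (x + k - 1)), with k the least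
   integer such that x + k > 0; at the poles 0, -1, -2, ... the value is 0. *)
Definition Gamma x : R :=
  let k := if 0 < x then 0%N else (Num.truncn (- x)).+1 in
  Gamma_int (x + k%:R) / \prod_(i < k) (x + i%:R).

End GammaFunction.

Section Sphere.
Variable R : realType.

(* The norm of 'rV[R]_n.+1 in the library is the sup norm, hence the
   explicit sum of squares. *)
Definition sphere n := {x : 'rV[R]_n.+1 | \sum_i x 0 i ^+ 2 == 1}.

Definition xcoord n (j : 'I_n.+1) (x : sphere n) : R := val x 0 j.

(* Values outside the sphere are irrelevant. *)
Definition ext0 n (u : sphere n -> R) (x : 'rV[R]_n.+1) : R :=
  oapp u 0 (insub x).

Fixpoint Ck n (k : nat) (U : set 'rV[R]_n.+1) (F : 'rV[R]_n.+1 -> R) : Prop :=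
  (forall x, U x -> {for x, continuous F}) /\
  if k is k'.+1 then
    forall i, (forall x, U x -> derivable F x (delta_mx 0 i)) /\
              Ck k' U ('D_(delta_mx 0 i) F)
  else True.

(* Smoothness on the embedded submanifold S^n: restriction of a smooth function
   on some open neighbourhood in R^{n+1}. *)
Definition Cinfty n : set (sphere n -> R) :=
  [set u | exists (U : set 'rV[R]_n.+1) (F : 'rV[R]_n.+1 -> R),
    [/\ open U,
        forall x : sphere n, U (val x),
        forall k, Ck k U F &
        forall x : sphere n, u x = F (val x)]].

(* Integration against the Riemannian measure of g_c, in polar coordinates
   (cos t, sin t * y), t in [0, pi], y in S^n, in which the metric of S^{n+1}
   is dt^2 + sin^2 t g_{S^n}; on S^0 = {1, -1} it is the counting measure. *)
Fixpoint sphere_integral (n : nat) : ('rV[R]_n.+1 -> R) -> R :=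
  match n with
  | 0 => fun f => f (const_mx 1) + f (const_mx (- 1))
  | m.+1 => fun f =>
      \int[lebesgue_measure]_(t in `[0%R, pi])
        (sin t ^+ m *
         sphere_integral
           (fun y => f (row_mx ((cos t)%:M : 'rV[R]_1) (sin t *: y))))
  end.

Definition l2dot n (u v : sphere n -> R) : R :=
  sphere_integral (ext0 (fun x => u x * v x)).

Definition harmonic_homog n (h : nat) : set (mpolyType R n.+1) :=
  [set p | p \is ishomog1 h mdeg /\
           \sum_(i < n.+1) mderiv i (mderiv i p) = 0].

Definition restr n (p : mpolyType R n.+1) (x : sphere n) : R :=
  meval (fun i => val x 0 i) p.

Arguments restr {n}.

(* The L^2(S^n)-orthogonal projection of u onto the spherical harmonics of
   degree h, represented by its unique homogeneous harmonic polynomial. *)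
Definition harmonic_proj n (h : nat) (u : sphere n -> R) : mpolyType R n.+1 :=
  xget 0 [set p | harmonic_homog h p /\
    forall q, harmonic_homog h q -> l2dot (u \- restr p) (restr q) = 0].

(* Spectral calculus along the decomposition of L^2(S^n) into spherical
   harmonics: the operator acting as the scalar m h in degree h.  On C^oo(S^n),
   for m of polynomial growth, the series converges uniformly. *)
Definition spectral_op n (m : nat -> R) (u : sphere n -> R) : sphere n -> R :=
  fun x => limn (series (fun h => m h * restr (harmonic_proj h u) x)).

(* P_{2 gamma} = Gamma(B + 1/2 + gamma) / Gamma(B + 1/2 - gamma), where
   B = sqrt(-Delta + ((n - 1) / 2)^2) is the scalar h + (n - 1) / 2 in degree h,
   since -Delta is h (h + n - 1) there. *)
Definition intertwining n (gamma : R) : (sphere n -> R) -> sphere n -> R :=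
  spectral_op (fun h =>
    Gamma (h%:R + n%:R / 2 + gamma) / Gamma (h%:R + n%:R / 2 - gamma)).

Definition commutator_mul n (P : (sphere n -> R) -> sphere n -> R)
    (f u : sphere n -> R) : sphere n -> R :=
  P (f \* u) \- f \* P u.

Definition inverse_on (T : Type) (A : set T) (P Q : T -> T) : Prop :=
  [/\ (forall u, A u -> A (P u)), (forall u, A u -> A (Q u)),
      (forall u, A u -> Q (P u) = u) & (forall u, A u -> P (Q u) = u)].

End Sphere.

Arguments Cinfty {R} n.
Arguments intertwining {R} n gamma.

(* Main.v *)
Require Import Defs.
From HB Require Import structures.
From mathcomp Require Import all_boot all_order all_algebra.
From mathcomp Require Import all_classical all_reals all_analysis.
From mathcomp Require Import measurable_realfun ring lra zify.
From mathcomp.multinomials Require mpoly.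
Import -(notations) mpoly.
Import Order.TTheory GRing.Theory Num.Theory.
Import numFieldNormedType.Exports.
Local Open Scope classical_set_scope.
Local Open Scope ring_scope.
Set Implicit Arguments.
Unset Strict Implicit.
Unset Printing Implicit Defensive.

(** Multiplication by a coordinate moves the degree of a spherical harmonic by
    one: for [Y] harmonic of degree [h], on the sphere
      [x_j Y = raise h j Y + lower h j Y],   [lower h j Y = d_j Y / (2 h + n - 1)],
    with terms of degrees [h + 1] and [h - 1] ([raise_lower]).  By Euler's
    identity, [\sum_j x_j (lower h j Y) = b_h Y] with [b_h = h / (2 h + n - 1)]
    ([sum_coord_lower]), hence [\sum_j x_j (raise h j Y) = (1 - b_h) Y].  If [m h]
    is the multiplier of the operator of order [2 gamma], the sum of commutators
    therefore multiplies [Y] by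
      [(1 - b_h) m (h + 1) + b_h m (h - 1) - m h],
    and the functional equation of Gamma turns this number into
    [gamma (n + 2 gamma - 2)] times the multiplier of order [2 (gamma - 1)]
    ([gamma_ratio_identity]).

    Passing from harmonics to a smooth function needs decay of its components.
    The operator [-Delta] is half the sum of [- rot i j (rot i j F)] over all
    ordered pairs of coordinates; the integral of an infinitesimal rotation
    vanishes ([sphere_integral_rot]), so [-Delta] is symmetric, with eigenvalue
    [h (h + n - 1)] in degree [h].  Applying it repeatedly, the L^2 norm of the
    degree [h] component decreases faster than any power of [h]
    ([smooth_rapid]), and the sup norm of a harmonic is at most a power of
    [h + 1] times its L^2 norm ([harmonic_sup_bound]).  Multipliers grow
    polynomially ([gamma_ratio_growth]), so every series converges absolutely,
    and the shift of degrees is a telescoping sum ([sum_coord_commutator]).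

    For [gamma < 1] the multipliers of the two operators are inverse to each
    other.  That the operators are inverse on smooth functions then rests on two
    facts: multiplying rapidly decreasing components by a multiplier gives the
    components of a smooth function ([smooth_on_radial_sum]), and a smooth function is
    the sum of its components ([harmonic_expansion]).  The first is proved by
    extending each harmonic to be constant along rays: a partial derivative of
    the extended series is again a combination of such series, for the rotated
    harmonics.  The second holds since a continuous function orthogonal to all
    polynomials vanishes ([orthogonal_to_harmonics_eq0]). *)

(** * The Gamma function and the multipliers *)

Section GammaFacts.
Variable R : realType.
Local Notation mu := (@lebesgue_measure R).
Implicit Types x t : R.

Let gf x t : R := t `^ (x - 1) * expR (- t).

Let gf_ge0 x t : 0 <= gf x t.
Proof. by rewrite mulr_ge0 ?powR_ge0 ?expR_ge0. Qed.

Let measurable_gf x (D : set R) : measurable_fun D (gf x).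
Proof.
apply: measurable_funTS; apply: measurable_realfun.measurable_funM.
  exact: measurable_powR.
apply: measurableT_comp => //.
Qed.

(** Monotone limits are free of integrability conditions in the extended
    reals; finiteness is proved separately. *)
Let gE x : \bar R := \int[mu]_(t in `]0%R, +oo[%classic) (gf x t)%:E.

(** Compact intervals away from 0, on which integration by parts applies. *)
Let exhaust (k : nat) : set R := [set` `[k.+2%:R^-1, k.+2%:R]].

Let exhaustU : \bigcup_k exhaust k = [set` `]0%R, +oo[].
Proof.
apply/seteqP; split => t /=.
  move=> [k _]; rewrite /exhaust /= !in_itv/= => /andP[kt _].
  by rewrite andbT (lt_le_trans _ kt).
rewrite in_itv/= andbT => t0.
have [k tk] : exists k : nat, Num.max t t^-1 <= k%:R.
  by exists (Num.truncn (Num.max t t^-1)).+1; apply/ltW/truncnS_gt.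
exists k => //; rewrite /exhaust /= in_itv/=.
have kk2 : (k%:R <= k.+2%:R :> R) by rewrite ler_nat (leq_trans (leqnSn k)).
move: tk; rewrite ge_max => /andP[tk Vtk]; apply/andP; split.
  by rewrite -[leRHS]invrK lef_pV2 ?posrE ?invr_gt0// (le_trans Vtk).
by rewrite (le_trans tk).
Qed.

Let gE_cvg x :
  (\int[mu]_(t in exhaust k) (gf x t)%:E)%E @[k --> \oo] --> gE x.
Proof.
rewrite /gE -exhaustU; apply: ge0_nondecreasing_set_cvg_integral => //.
- move=> k l kl; rewrite subsetEset => t; rewrite /exhaust/= !in_itv/=.
  move=> /andP[kt tk]; apply/andP; split.
    apply: le_trans kt; rewrite lef_pV2 ?posrE//.
    by rewrite ler_nat !ltnS.
  by rewrite (le_trans tk)// ler_nat !ltnS.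
- by move=> i; exact: measurable_itv.
- by move=> i; apply/measurable_EFinP; exact: measurable_gf.
- by move=> i t _; rewrite lee_fin.
Qed.

(** This is [ln s <= s] at [s = t / (2 x)]. *)
Let powR_le_expR x : 0 < x ->
  exists2 C, 0 < C & forall t, 0 < t -> t `^ x <= C * expR (t / 2).
Proof.
move=> x0; exists (expR (x * ln (2 * x))); first exact: expR_gt0.
move=> t t0; rewrite -expRD /powR gt_eqF// ler_expR.
have c0 : 0 < 2 * x by rewrite mulr_gt0.
have -> : t = (2 * x) * (t / (2 * x)) by rewrite mulrC divfK// gt_eqF.
rewrite lnM ?posrE ?divr_gt0// mulrDr lerD2l.
have -> : 2 * x * (t / (2 * x)) / 2 = x * (t / (2 * x)) by field; rewrite gt_eqF.
by rewrite ler_pM2l// ltW// ln_sublinear// divr_gt0.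
Qed.

Let cvg_powR_expR x : 0 < x -> t `^ x * expR (- t) @[t --> +oo%R] --> (0 : R).
Proof.
move=> x0; have [C C0 HC] := powR_le_expR x0.
apply: (@squeeze_cvgr _ _ _ _ (fun=> 0) (fun t => C * expR (- (2^-1 * t)))).
- near=> t; rewrite mulr_ge0 ?powR_ge0 ?expR_ge0//=.
  have t0 : 0 < t by near: t; exact: nbhs_pinfty_gt.
  apply: le_trans (ler_wpM2r (expR_ge0 _) (HC t t0)) _.
  rewrite -mulrA -expRD.
  by rewrite (_ : t / 2 - t = - (2^-1 * t))//; field.
- exact: cvg_cst.
- rewrite -(mulr0 C); apply: cvgMr.
  apply: (@cvg_comp _ _ _ _ (fun x => expR (- x)) _ (pinfty_nbhs R)).
    by apply: gt0_cvgMry; rewrite ?invr_gt0.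
  exact: cvgr_expR.
Unshelve. all: by end_near. Qed.

Let gE_ge0 x : (0 <= gE x)%E.
Proof. by apply: integral_ge0 => t _; rewrite lee_fin. Qed.

(** Comparison with the exponential density of rate 1/2.  For [x < 1] the
    integrand is unbounded at 0; finiteness there will follow from the
    functional equation. *)
Let gE_fin x : 1 <= x -> (gE x < +oo)%E.
Proof.
move=> x1; have x0 : 0 < x by apply: lt_le_trans x1.
have [C [C0 HC]] : exists C, 0 < C /\ forall t, 0 < t -> t `^ (x - 1) <= C * expR (t / 2).
  have [->|xn1] := eqVneq x 1.
    exists 1; split=> // t t0; rewrite subrr powRr0 mul1r.
    by rewrite -expR0 ler_expR divr_ge0// ltW.
  have [|C C0 HC] := @powR_le_expR (x - 1); first by rewrite subr_gt0 lt_neqAle eq_sym xn1.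
  by exists C.
have le1 : (gE x <= \int[mu]_(t in `]0%R, +oo[%classic) ((2 * C) * exponential_pdf 2^-1 t)%:E)%E.
  apply: ge0_le_integral => //=.
  - by move=> t _; rewrite lee_fin.
  - by apply/measurable_EFinP; exact: measurable_gf.
  - apply/measurable_EFinP; apply: measurable_funTS; apply: measurable_funM => //.
    exact: measurable_exponential_pdf.
  move=> t; rewrite in_itv/= andbT => t0; rewrite lee_fin exponential_pdfE ?(ltW t0)//.
  rewrite mulrA [_ * 2^-1](_ : _ = C); last by field.
  apply: le_trans (ler_wpM2r (expR_ge0 _) (HC t t0)) _.
  rewrite -mulrA -expRD.
  by rewrite (_ : t / 2 - t = - 2^-1 * t)//; field.
apply: le_lt_trans le1 _.
apply: (@le_lt_trans _ _ (\int[mu]_t ((2 * C) * exponential_pdf 2^-1 t)%:E)%E).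
  apply: ge0_subset_integral => //.
    apply/measurable_EFinP; apply: measurable_funM => //.
    exact: measurable_exponential_pdf.
  by move=> t _; rewrite lee_fin mulr_ge0 ?exponential_pdf_ge0 ?mulr_ge0 ?invr_ge0// ltW.
under eq_integral do rewrite EFinM.
rewrite ge0_integralZl//.
- rewrite integral_exponential_pdf// mule1 ltry//.
- by apply/measurable_EFinP; exact: measurable_exponential_pdf.
- by move=> t _; rewrite lee_fin exponential_pdf_ge0 ?invr_ge0.
- by rewrite lee_fin mulr_ge0// ltW.
Qed.

Let gE_gt0 x : (0 < gE x)%E.
Proof.
have [c c0 Hc] : exists2 c, 0 < c & forall t, 1 <= t <= 2 -> c <= gf x t.
  exists (expR (- (`|x - 1| * ln 2)) * expR (- 2)); first by rewrite mulr_gt0 ?expR_gt0.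
  move=> t /andP[t1 t2]; apply: ler_pM; rewrite ?expR_ge0//; last by rewrite ler_expR lerN2.
  rewrite /powR gt_eqF ?(lt_le_trans _ t1)// ler_expR.
  rewrite lerNl; apply: le_trans (ler_norm _) _; rewrite normrN normrM.
  apply: ler_wpM2l => //; rewrite ger0_norm ?ln_ge0// ler_ln ?posrE//.
  by rewrite (lt_le_trans _ t1).
apply: (@lt_le_trans _ _ (\int[mu]_(t in `[1%R, 2%R]%classic) c%:E)%E).
  rewrite integral_cst//= lebesgue_measure_itv/= lte_fin ltr1n.
  by rewrite -EFinB -EFinM lte_fin mulr_gt0//; lra.
apply: (@le_trans _ _ (\int[mu]_(t in `[1%R, 2%R]%classic) (gf x t)%:E)%E).
  apply: ge0_le_integral => //=.
  - by move=> t _; rewrite lee_fin ltW.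
  - by apply/measurable_EFinP; exact: measurable_gf.
apply: ge0_subset_integral => //.
- by apply/measurable_EFinP; exact: measurable_gf.
- by move=> t _; rewrite lee_fin.
- by move=> t /=; rewrite !in_itv/= andbT => /andP[t1 _]; rewrite (lt_le_trans _ t1).
Qed.

(** Integration by parts on [exhaust k], whose boundary term tends to zero. *)
Let gE_step x : 0 < x -> gE (x + 1) = (x%:E * gE x)%E.
Proof.
move=> x0.
pose a (k : nat) : R := k.+2%:R^-1; pose b (k : nat) : R := k.+2%:R.
have a0 k : 0 < a k by rewrite invr_gt0.
have ab k : a k < b k.
  rewrite /a /b (@lt_trans _ _ 1)//; first by rewrite invf_lt1// ltr1n.
  by rewrite ltr1n.
pose bd k : R := a k `^ x * expR (- a k) - b k `^ x * expR (- b k).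
have parts k : (\int[mu]_(t in exhaust k) (gf (x + 1) t)%:E =
   (bd k)%:E + x%:E * \int[mu]_(t in exhaust k) (gf x t)%:E)%E.
  have dp t : 0 < t -> is_derive t 1 ((@powR R) ^~ x) (x * t `^ (x - 1)).
    by move=> t0; exact: is_derive1_powR.
  have cp (y : R) t : 0 < t -> {for t, continuous ((@powR R) ^~ y)}.
    by move=> t0; apply/differentiable_continuous/derivable1_diffP; case: (@is_derive1_powR _ y t t0).
  have ce (t : R) : {for t, continuous (fun t => expR (- t))}.
    by apply: continuous_comp; [exact: continuousN|exact: continuous_expR].
  have cg (y t : R) : 0 < t -> {for t, continuous (gf y)}.
    move=> t0; apply: (@continuousM R R (fun t => t `^ (y - 1)) (fun t => expR (- t))).
      exact: cp.
    exact: ce.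
  have e1 t : (gf (x + 1) t)%:E = (t `^ x * expR (- t))%:E by rewrite /gf addrK.
  under eq_integral do rewrite e1.
  rewrite (@integration_by_parts R ((@powR R) ^~ x) (fun t => - expR (- t))
    (fun t => x * t `^ (x - 1)) (fun t => expR (- t)) (a k) (b k) (ab k)).
  - congr (_ + _)%E; first by congr (_%:E); rewrite /bd; ring.
    rewrite -integralZl//; last first.
      apply: continuous_compact_integrable; first exact: segment_compact.
      apply: continuous_in_subspaceT => t; rewrite inE /exhaust/= in_itv/= => /andP[at_ _].
      by apply: cg; exact: lt_le_trans at_.
      exact: measurable_itv.
    rewrite -integralN/=; last first.
      apply: integrable_add_def; first exact: measurable_itv.
      apply: continuous_compact_integrable; first exact: segment_compact.
      apply: continuous_in_subspaceT => t; rewrite inE /exhaust/= in_itv/= => /andP[at_ _].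
      apply: (@continuousM R R (fun t => x * t `^ (x - 1)) (fun t => - expR (- t))).
        apply: (@continuousM R R (fun=> x) (fun t => t `^ (x - 1))).
          exact: cst_continuous.
        by apply: cp; exact: lt_le_trans at_.
      by apply: continuousN; exact: ce.
    apply: eq_integral => t _; rewrite -EFinM; congr (_%:E).
    by rewrite /gf; ring.
  - apply: continuous_in_subspaceT => t; rewrite inE /exhaust/= in_itv/= => /andP[at_ _].
    apply: (@continuousM R R (fun=> x) (fun t => t `^ (x - 1))).
      exact: cst_continuous.
    by apply: cp; exact: lt_le_trans at_.
  - split.
    + move=> t; rewrite in_itv/= => /andP[at_ _].
      by case: (dp t (lt_trans (a0 k) at_)).
    + by apply/cvg_at_right_filter; exact: cp.
    + by apply/cvg_at_left_filter; apply: cp; rewrite (lt_trans _ (ab k)).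
  - move=> t; rewrite in_itv/= => /andP[at_ _]; rewrite derive1E; apply: derive_val.
    exact/dp/(lt_trans _ at_).
  - by apply: continuous_subspaceT => t; exact: ce.
  - split.
    + by move=> t _; exact: ex_derive.
    + by apply/cvg_at_right_filter; apply: cvgN; exact: ce.
    + by apply/cvg_at_left_filter; apply: cvgN; exact: ce.
  - move=> t _; rewrite derive1E derive_val /GRing.scale/=; ring.
have cvg_b : b k @[k --> \oo] --> +oo.
  by apply: (@cvg_trans _ ([sequence n%:R : R]_n (n + 2)%N @[n --> \oo]));
    [rewrite /b; under eq_fun do rewrite -addn2|rewrite cvg_shiftn; exact: cvgr_idn].
have cvg_a : a k @[k --> \oo] --> (0 : R).
  by apply/(@gtr0_cvgV0 _ _ _ _ b) => //; apply: nearW => k; rewrite /b.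
have bd0 : bd k @[k --> \oo] --> (0 : R).
  rewrite -[0 in X in _ --> X]subr0; apply: cvgB.
    rewrite -(mul0r (expR (- 0))); apply: cvgM.
      have := @powR_cvg0 R x x0.
      by move/cvg_at_rightP; apply; split.
    apply: (cvg_comp (G := nbhs (0 : R)) _ (fun t => expR (- t)) cvg_a).
    by apply: continuous_comp; [exact: continuousN|exact: continuous_expR].
  exact: (cvg_comp _ _ cvg_b (cvg_powR_expR x0)).
have c1 := @gE_cvg (x + 1).
have c2 : ((bd k)%:E + x%:E * \int[mu]_(t in exhaust k) (gf x t)%:E)%E @[k --> \oo] --> (0 + x%:E * gE x)%E.
  apply: cvgeD => //.
    by apply: cvg_EFin => //; apply: nearW.
  by apply: cvgeZl => //; exact: gE_cvg.
rewrite add0e in c2.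
apply: (cvg_unique _ c1) => //.
rewrite /=; under eq_fun do rewrite parts; exact: c2.
Qed.

Lemma Gamma_int_step x : 0 < x -> Gamma_int (x + 1) = x * Gamma_int x.
Proof.
move=> x0; rewrite /Gamma_int /Rintegral -/(gE _) -/(gE x) gE_step//.
have := gE_ge0 x; have := gE_gt0 x.
case: (gE x) => [r||]//= _ _.
by rewrite gt0_muley ?lte_fin//= mulr0.
Qed.

(** An infinite value at [x] would be infinite at [x + 1 > 1] as well. *)
Lemma Gamma_int_gt0 x : 0 < x -> 0 < Gamma_int x.
Proof.
move=> x0; rewrite /Gamma_int /Rintegral -/(gE _).
rewrite fine_gt0// gE_gt0/=.
have := @gE_fin (x + 1); rewrite gE_step//.
case: (gE x) => [r||]// H; rewrite ?ltry//.
by move: H; rewrite gt0_muley ?lte_fin// => -> //; rewrite lerDr ltW.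
Qed.

Lemma Gamma_pos x : 0 < x -> Gamma x = Gamma_int x.
Proof. by move=> x0; rewrite /Gamma x0 addr0 big_ord0 divr1. Qed.

Lemma Gamma_neg x : -1 < x -> x < 0 -> Gamma x = Gamma_int (x + 1) / x.
Proof.
move=> x1 x0; rewrite /Gamma ltNge (ltW x0)/=.
have -> : Num.truncn (- x) = 0%N.
  have /truncn_itv/andP[h _] : 0 <= - x by lra.
  have : (Num.truncn (- x))%:R < 1%:R :> R by lra.
  by rewrite ltr_nat ltnS leqn0 => /eqP.
by rewrite big_ord1/= addr0.
Qed.

Lemma Gamma_step x : -1 < x -> x != 0 -> Gamma (x + 1) = x * Gamma x.
Proof.
move=> x1 xn0; have x10 : 0 < x + 1 by lra.
rewrite Gamma_pos//; have [x0|x0] := ltP 0 x.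
  by rewrite Gamma_pos// Gamma_int_step.
by rewrite Gamma_neg// ?lt_neqAle ?xn0// mulrCA divff ?mulr1.
Qed.

Lemma Gamma_neq0 x : -1 < x -> x != 0 -> Gamma x != 0.
Proof.
move=> x1 xn0; have x10 : 0 < x + 1 by lra.
have := Gamma_step x1 xn0; rewrite Gamma_pos// => e.
by apply/eqP => G0; have := Gamma_int_gt0 x10; rewrite e G0 mulr0 ltxx.
Qed.

End GammaFacts.

Section Multiplier.
Variable R : realType.

Definition poly_growth (m : nat -> R) : Prop :=
  exists C k, 0 <= C /\ forall h, `|m h| <= C * h.+1%:R ^+ k.

(** By Bernoulli's inequality [1 + k / (h + 1) <= ((h + 2) / (h + 1)) ^ k], so
    the majorant [(h + 1) ^ k] grows at least as fast as [m]. *)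
Lemma poly_growth_ratio (m : nat -> R) (K : R) : 0 <= K ->
  (forall h, `|m h.+1| <= (1 + K / h.+1%:R) * `|m h|) -> poly_growth m.
Proof.
move=> K0 Hm; pose k := (Num.truncn K).+1.
have Kk : K <= k%:R by apply/ltW/truncnS_gt.
exists `|m 0%N|, k; split => // h.
elim: h => [|h IH]; first by rewrite expr1n mulr1.
apply: le_trans (Hm h) _; apply: le_trans (ler_wpM2l _ IH) _.
  by rewrite addr_ge0// divr_ge0.
rewrite mulrCA ler_wpM2l//.
have h0 : 0 < h.+1%:R :> R by [].
rewrite [h.+2%:R](_ : _ = h.+1%:R * (1 + h.+1%:R^-1)); last first.
  by rewrite mulrDr mulr1 divff ?gt_eqF// -natr1.
rewrite exprMn mulrC ler_wpM2l ?exprn_ge0//.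
apply: (@le_trans _ _ (1 + k%:R / h.+1%:R)).
  by rewrite lerD2l ler_wpM2r// invr_ge0.
have {h0} : 0 <= h.+1%:R^-1 :> R by rewrite invr_ge0.
move: (h.+1%:R^-1) => y y0.
elim: (k) => [|j IHj]; first by rewrite mul0r addr0 expr0.
rewrite exprS; apply: le_trans (ler_wpM2l _ IHj); last by rewrite addr_ge0.
have : 0 <= y * (j%:R * y) by rewrite !mulr_ge0.
by rewrite -natr1; nra.
Qed.

Variables (n : nat) (g : R).

Definition gamma_ratio (g : R) (h : nat) : R :=
  Gamma (h%:R + n%:R / 2 + g) / Gamma (h%:R + n%:R / 2 - g).

Let arg_ok (d : R) (h : nat) : -1 < d -> d != 0 ->
  -1 < h%:R + d /\ h%:R + d != 0.
Proof.
move=> d1 d0; case: h => [|h]; first by rewrite add0r.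
have h1 : 1 <= h.+1%:R :> R by rewrite ler1n.
by split; [lra|rewrite gt_eqF//; lra].
Qed.

Hypotheses (hp1 : -1 < n%:R / 2 + g) (hp0 : n%:R / 2 + g != 0).
Hypotheses (hm1 : -1 < n%:R / 2 - g) (hm0 : n%:R / 2 - g != 0).

Lemma gamma_ratioS h :
  gamma_ratio g h.+1 =
  (h%:R + n%:R / 2 + g) / (h%:R + n%:R / 2 - g) * gamma_ratio g h.
Proof.
rewrite /gamma_ratio -natr1.
have -> : h%:R + 1 + n%:R / 2 + g = (h%:R + (n%:R / 2 + g)) + 1 by ring.
have -> : h%:R + 1 + n%:R / 2 - g = (h%:R + (n%:R / 2 - g)) + 1 by ring.
have [p1 p0] := arg_ok h hp1 hp0; have [m1 m0] := arg_ok h hm1 hm0.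
rewrite !Gamma_step//.
have := Gamma_neq0 m1 m0; rewrite !addrA => G0.
rewrite addrA in m0; move: m0 G0.
move: (Gamma (h%:R + n%:R / 2 - g)) (Gamma (h%:R + n%:R / 2 + g)) => GB GA.
by move: (h%:R + n%:R / 2 - g) (h%:R + n%:R / 2 + g) => B A B0 GB0; field; rewrite B0 GB0.
Qed.

Lemma gamma_ratio_neq0 h : gamma_ratio g h != 0.
Proof.
have [p1 p0] := arg_ok h hp1 hp0; have [m1 m0] := arg_ok h hm1 hm0.
by rewrite mulf_neq0 ?invr_eq0// -addrA Gamma_neq0.
Qed.

(** Successive quotients are [1 + 2 g / (h + d)] with [d = n / 2 - g], and
    [`|h + d|] is at least a multiple of [h + 1] because [d > -1] is not 0. *)
Lemma gamma_ratio_growth : poly_growth (gamma_ratio g).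
Proof.
pose d := n%:R / 2 - g; pose c := Num.min `|d| (Num.min 1 (1 + d)) / 2.
have c0 : 0 < c.
  rewrite divr_gt0// !lt_min normr_gt0 hm0 ltr01/=.
  by have := hm1; rewrite -/d; lra.
have Hc h : c * h.+1%:R <= `|h%:R + d|.
  have : c * 2 <= Num.min `|d| (Num.min 1 (1 + d)) by rewrite divfK.
  rewrite !le_min => /and3P[c1 c2 c3].
  case: h => [|h]; first by rewrite add0r mulr1; lra.
  have h0 : 0 <= h%:R :> R by [].
  apply: le_trans (ler_norm _).
  by rewrite -!natr1; nra.
have K0 : 0 <= 2 * `|g| / c.
  by apply: divr_ge0; [apply: mulr_ge0|exact: ltW].
apply: (poly_growth_ratio K0).
move=> h; rewrite gamma_ratioS normrM ler_wpM2r//.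
have [m1 m0] := arg_ok h hm1 hm0.
have e : (h%:R + n%:R / 2 + g) / (h%:R + n%:R / 2 - g) = 1 + 2 * g / (h%:R + d).
  have -> : h%:R + n%:R / 2 + g = h%:R + d + 2 * g by rewrite /d; field.
  have -> : h%:R + n%:R / 2 - g = h%:R + d by rewrite /d addrA.
  by move: m0; rewrite -/d; move: (h%:R + d) => X X0; field.
rewrite e; apply: le_trans (ler_normD _ _) _; rewrite normr1 lerD2l.
rewrite !normrM normfV [`|2|]ger0_norm// -mulrA -[leRHS]mulrA -mulrA.
rewrite ler_wpM2l// ler_wpM2l// -invfM.
by rewrite lef_pV2 ?posrE ?normr_gt0// mulr_gt0.
Qed.

End Multiplier.

(** It keeps [n / 2 + (g - 1)], the argument of the numerator of
    [gamma_ratio n (g - 1)] in degree 0, away from the pole.  For [n = 1] the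
    sum is below 1, and above it otherwise. *)
Lemma half_dim_add_neq1 (R : realType) n (g : R) : (0 < n)%N -> 0 < g -> g < n%:R / 2 -> n%:R / 2 + g != 1.
Proof.
case: n => [//|[|m]] _ g0 gl; first by rewrite lt_eqF//; lra.
have m0 : 0 <= m%:R :> R by [].
have e : m.+2%:R = m%:R + 2 :> R by rewrite -addn2 natrD.
by rewrite gt_eqF// e; lra.
Qed.

Section MultiplierIdentity.
Variable R : realType.
Variables (n : nat) (g : R).
Hypotheses (n_ge1 : (1 <= n)%N) (g_gt0 : 0 < g) (g_lt : g < n%:R / 2).

(** The factor by which [\sum_j x_j (lower h j Y)] multiplies a harmonic [Y] of
    degree [h]. *)
Definition lower_weight (h : nat) : R := h%:R / (2 * h%:R + n%:R - 1).

Let n1 : 1 <= n%:R :> R. Proof. by rewrite ler1n. Qed.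

(** With [A = h + n/2 + g - 1] and [B = h + n/2 - g], the values at [h + 1],
    [h - 1] and the one for [g - 1] are [gamma_ratio n g h] times [(A + 1) / B],
    [(B - 1) / A] and [1 / (A B)], while [lower_weight h] is [h / (A + B)].
    What remains is an identity between rational functions. *)
Lemma gamma_ratio_identity h :
  (1 - lower_weight h) * gamma_ratio n g h.+1 + lower_weight h * gamma_ratio n g h.-1
    - gamma_ratio n g h = g * (n%:R + 2 * g - 2) * gamma_ratio n (g - 1) h.
Proof.
have G h' : gamma_ratio n g h'.+1 =
    (h'%:R + n%:R / 2 + g) / (h'%:R + n%:R / 2 - g) * gamma_ratio n g h'.
  by apply: gamma_ratioS; rewrite ?gt_eqF//; move: n1 g_gt0 g_lt; lra.
have h0 : 0 <= h%:R :> R by [].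
have sm : h%:R + n%:R / 2 - g != 0 by rewrite gt_eqF//; move: g_lt; lra.
have sp : h%:R + n%:R / 2 + g - 1 != 0.
  case: (h) => [|h']; first by rewrite add0r subr_eq0 half_dim_add_neq1.
  rewrite gt_eqF// -natr1; have : 0 <= h'%:R :> R by [].
  by move: n1 g_gt0; lra.
have -> : gamma_ratio n (g - 1) h =
    gamma_ratio n g h / ((h%:R + n%:R / 2 + g - 1) * (h%:R + n%:R / 2 - g)).
  rewrite /gamma_ratio.
  have -> : h%:R + n%:R / 2 - (g - 1) = (h%:R + n%:R / 2 - g) + 1 by ring.
  have -> : h%:R + n%:R / 2 + (g - 1) = h%:R + n%:R / 2 + g - 1 by ring.
  have {2}-> : h%:R + n%:R / 2 + g = (h%:R + n%:R / 2 + g - 1) + 1 by ring.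
  rewrite !Gamma_step//; last 2 first.
  - by move: n1 g_gt0; lra.
  - by move: g_lt; lra.
  have : Gamma (h%:R + n%:R / 2 - g) != 0 by apply: Gamma_neq0; move: g_lt sm; lra.
  move: sm sp.
  move: (Gamma (h%:R + n%:R / 2 - g)) (Gamma (h%:R + n%:R / 2 + g - 1)) => GB GA.
  by move: (h%:R + n%:R / 2 - g) (h%:R + n%:R / 2 + g - 1) => B A B0 A0 G0; field; rewrite ?G0 ?B0 ?A0.
pose A := h%:R + n%:R / 2 + g - 1; pose B := h%:R + n%:R / 2 - g.
rewrite G -/A -/B; rewrite -/A in sp; rewrite -/B in sm.
have -> : h%:R + n%:R / 2 + g = A + 1 by rewrite /A subrK.
have -> : g * (n%:R + 2 * g - 2) = (A - B + 1) * (A - h%:R) by rewrite /A /B; field.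
have -> : lower_weight h = h%:R / (A + B).
  by rewrite /lower_weight /A /B; congr (_ / _); field.
(* At [h = 0] the weight of the value at [h.-1], itself 0, vanishes. *)
have [h00|hn0] := eqVneq h 0%N; first by rewrite h00 !mul0r subr0 mul1r addr0 subr0; field; rewrite sm sp.
have h1 : 1 <= h%:R :> R by rewrite ler1n lt0n.
have AB : A + B != 0 by rewrite /A /B gt_eqF//; move: n1; lra.
have B1 : B - 1 != 0 by rewrite /B gt_eqF//; move: g_lt; lra.
have -> : gamma_ratio n g h.-1 = (B - 1) / A * gamma_ratio n g h.
  have := G h.-1; rewrite prednK ?lt0n//.
  have -> : h.-1%:R + n%:R / 2 + g = A :> R.
    by rewrite /A -[in RHS](prednK (n := h)) ?lt0n// -natr1; ring.
  have -> : h.-1%:R + n%:R / 2 - g = B - 1 :> R.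
    by rewrite /B -[in RHS](prednK (n := h)) ?lt0n// -natr1; ring.
  by move=> ->; field; rewrite sp B1.
by move: (gamma_ratio n g h) => M; field; rewrite sm sp AB.
Qed.

End MultiplierIdentity.

(** * Chain rule along curves from continuous partial derivatives *)

Section ContinuousSum.
Variables (R : realType) (T : topologicalType) (I : Type) (r : seq I).

Lemma continuous_sumr (f : I -> T -> R) (x : T) :
  (forall i, {for x, continuous (f i)}) ->
  {for x, continuous (fun y => \sum_(i <- r) f i y)}.
Proof.
move=> cf; elim: r => [|i s IH].
  rewrite (_ : (fun y => _) = cst 0); first exact: cst_continuous.
  by apply/funext => y; rewrite big_nil.
rewrite (_ : (fun y => _) = f i \+ (fun y => \sum_(j <- s) f j y)); last first.
  by apply/funext => y; rewrite big_cons.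
exact: (@continuousD R R _ (f i) (fun y => \sum_(j <- s) f j y)).
Qed.

End ContinuousSum.

Section ChainRule.
Variables (R : realType) (n : nat).
Implicit Types (F : 'rV[R]_n.+1 -> R) (x y h : 'rV[R]_n.+1).

Lemma is_derive_line F y v (s : R) :
  derivable F (y + s *: v) v ->
  is_derive s 1 (fun s : R => F (y + s *: v)) ('D_v F (y + s *: v)).
Proof.
move=> dF.
have e : (fun r : R => r^-1 *: (F (y + (r *: 1 + s) *: v) - F (y + s *: v))) =
         (fun r : R => r^-1 *: (F (r *: v + (y + s *: v)) - F (y + s *: v))).
  apply/funext => r; congr (_ *: (F _ - _)).
  by rewrite addrCA -scalerDl /GRing.scale/= mulr1.
by split; rewrite /derivable /derive /= e.
Qed.

Lemma coord_MVT F y i (r : R) :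
  (forall s : R, 0 <= s <= 1 -> derivable F (y + (s * r) *: delta_mx 0 i) (delta_mx 0 i)) ->
  exists2 s : R, 0 <= s <= 1 &
    F (y + r *: delta_mx 0 i) - F y = 'D_(delta_mx 0 i) F (y + (s * r) *: delta_mx 0 i) * r.
Proof.
move=> dF; pose v : 'rV[R]_n.+1 := delta_mx 0 i.
have d (s : R) : 0 <= s <= 1 -> is_derive s 1 (fun s : R => F (y + (s * r) *: v))
    ('D_v F (y + (s * r) *: v) * r).
  move=> s01.
  apply: (@is_derive1_comp R (fun s : R => F (y + s *: v)) (fun s : R => s * r) s).
    exact/is_derive_line/dF.
  by apply: is_derive_eq; rewrite /GRing.scale/= mulr0 mulr1 add0r.
have [||s] := @MVT_segment R (fun s : R => F (y + (s * r) *: v))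
    (fun s => 'D_v F (y + (s * r) *: v) * r) 0 1 ler01.
- by move=> s; rewrite in_itv/= => /andP[s0 s1]; apply: d; rewrite !ltW.
- by apply: derivable_within_continuous => s; rewrite in_itv/= => /d[].
by rewrite in_itv/= => s01; rewrite mul1r mul0r scale0r addr0 subr0 mulr1 => e; exists s.
Qed.

(** The vertices of a path from 0 to [h] along the coordinate axes. *)
Definition trunc_row (h : 'rV[R]_n.+1) (k : nat) : 'rV[R]_n.+1 :=
  \row_j (if (j < k)%N then h 0 j else 0).

Lemma trunc_rowS h (k : 'I_n.+1) :
  trunc_row h k.+1 = trunc_row h k + h 0 k *: delta_mx 0 k.
Proof.
apply/rowP => j; rewrite !mxE eqxx/= ltnS leq_eqVlt (inj_eq val_inj).
case: eqVneq => [->|jk]/=; first by rewrite ltnn add0r mulr1.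
by rewrite mulr0 addr0.
Qed.

Lemma row_norm_le (x : 'rV[R]_n.+1) (e : R) : 0 <= e ->
  (forall i, `|x 0 i| <= e) -> `|x| <= e.
Proof.
move=> e0 H; rewrite [leLHS]/Num.Def.normr/= mx_normrE bigmax_le// => -[i j] _/=.
by rewrite ord1.
Qed.

Lemma coord_le_norm (x : 'rV[R]_n.+1) i : `|x 0 i| <= `|x|.
Proof.
rewrite [leRHS]/Num.Def.normr/= mx_normrE.
exact: (@le_bigmax _ _ _ 0 (fun ij : 'I_1 * 'I_n.+1 => `|x ij.1 ij.2|) (0, i)).
Qed.

Definition C1_at F x := forall i,
  (\forall y \near x, derivable F y (delta_mx 0 i)) /\
  {for x, continuous ('D_(delta_mx 0 i) F)}.

Definition grad_lin F x (h : 'rV[R]_n.+1) : R :=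
  \sum_i h 0 i * 'D_(delta_mx 0 i) F x.

(** Along the path of the [trunc_row h k], each edge is an instance of the mean
    value theorem in one variable, at a point where the partial derivative is
    close to its value at [x]. *)
Lemma C1_expansion F x (e : R) : C1_at F x -> 0 < e ->
  \forall h \near (0 : 'rV[R]_n.+1), `|F (x + h) - F x - grad_lin F x h| <= e * `|h|.
Proof.
move=> C1F e0; pose e' := e / n.+1%:R.
have e'0 : 0 < e' by rewrite divr_gt0.
have : \forall y \near x, forall i, derivable F y (delta_mx 0 i) /\
     `|'D_(delta_mx 0 i) F x - 'D_(delta_mx 0 i) F y| <= e'.
  apply: (@filter_forall _ _ (fun i y => derivable F y (delta_mx 0 i) /\
     `|'D_(delta_mx 0 i) F x - 'D_(delta_mx 0 i) F y| <= e') (nbhs x)) => i; have [d1 c1] := C1F i.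
  by apply: filterI => //; move/cvgrPdist_le : c1; apply.
move/nbhs_ballP => [d /= d0 Hd].
near=> h.
have hd : `|h| < d by near: h; apply/nbhs_ballP; exists d => //= z; rewrite -ball_normE/= sub0r normrN.
have tr_le k : `|trunc_row h k| <= `|h|.
  apply: row_norm_le => // i; rewrite mxE; case: ifP => _; last by rewrite normr0.
  exact: coord_le_norm.
have step (k : 'I_n.+1) :
    `|F (x + trunc_row h k.+1) - F (x + trunc_row h k) - h 0 k * 'D_(delta_mx 0 k) F x|
      <= e' * `|h|.
  have inb (s : R) : 0 <= s <= 1 -> ball x d (x + trunc_row h k + (s * h 0 k) *: delta_mx 0 k).
    move=> /andP[s0 s1]; rewrite -ball_normE/= -addrA opprD addNKr normrN.
    apply: le_lt_trans hd; apply: row_norm_le => // i; rewrite !mxE eqxx/=.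
    case: eqVneq => [->|ik].
      rewrite ltnn add0r mulr1 normrM (ger0_norm s0).
      by rewrite (le_trans _ (coord_le_norm h k))// ler_piMl.
    rewrite mulr0 addr0; case: ifP => _; last by rewrite normr0.
    exact: coord_le_norm.
  have [|s s01] := @coord_MVT F (x + trunc_row h k) k (h 0 k).
    by move=> s s01; have [] := Hd _ (inb s s01) k.
  rewrite -addrA -trunc_rowS => ->.
  rewrite [h 0 k * _]mulrC -mulrBl normrM.
  apply: ler_pM => //; last exact: coord_le_norm.
  by rewrite distrC; have [] := Hd _ (inb s s01) k.
have t0 : trunc_row h 0 = 0 by apply/rowP => j; rewrite !mxE ltn0.
have tn : trunc_row h n.+1 = h by apply/rowP => j; rewrite !mxE ltn_ord.
have -> : F (x + h) - F x = \sum_(k < n.+1) (F (x + trunc_row h k.+1) - F (x + trunc_row h k)).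
  rewrite -(big_mkord xpredT (fun k => F (x + trunc_row h k.+1) - F (x + trunc_row h k))).
  by rewrite (telescope_sumr (fun k => F (x + trunc_row h k)))// t0 tn addr0.
rewrite /grad_lin -sumrB; apply: le_trans (ler_norm_sum _ _ _) _.
apply: (@le_trans _ _ (\sum_(k < n.+1) e' * `|h|)); first exact: ler_sum.
by rewrite sumr_const card_ord -mulrnAl -mulr_natr divfK// pnatr_eq0.
Unshelve. all: by end_near. Qed.

Lemma C1_differentiable F x : C1_at F x -> differentiable F x /\
  forall h, 'd F x h = grad_lin F x h.
Proof.
move=> C1F.
have lin : linear (grad_lin F x).
  move=> a u v; rewrite /grad_lin scaler_sumr -big_split/=; apply: eq_bigr => i _.
  by rewrite !mxE mulrDl scalerAl.
pose L : {linear 'rV[R]_n.+1 -> R} :=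
  HB.pack (grad_lin F x) (GRing.isLinear.Build _ _ _ _ _ lin).
have cL : continuous L.
  move=> y; rewrite /L/= /grad_lin.
  apply: continuous_sumr => i; apply: (@continuousM R _ (fun h : 'rV[R]_n.+1 => h 0 i)).
    exact: coord_continuous.
  exact: cst_continuous.
have ex : (F \o shift x : 'rV[R]_n.+1 -> R) = cst (F x) + L +o_ (0 : 'rV[R]_n.+1) id.
  apply/eqaddoP => e e0; have := C1_expansion C1F e0.
  apply: filterS => h; by rewrite !fctE/= opprD addrA [h + x]addrC.
have dL := diff_unique cL ex.
split; last by move=> h; rewrite dL.
by apply/diff_locallyP; rewrite dL.
Qed.

Lemma is_derive_curve F (c : R -> 'rV[R]_n.+1) (dc : 'rV[R]_n.+1) (t : R) :
  C1_at F (c t) -> (forall i, is_derive t 1 (fun s => c s 0 i) (dc 0 i)) ->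
  is_derive t 1 (F \o c) (grad_lin F (c t) dc).
Proof.
move=> /C1_differentiable[dF eF] hc.
have dc1 : derivable c t 1 by apply/derivable_mxP => i j; rewrite ord1; case: (hc j).
have Dc : 'D_1 c t = dc.
  rewrite derive_mx//; apply/rowP => j; rewrite mxE; exact: derive_val.
have dfc : differentiable c t by exact/derivable1_diffP.
have dFc := differentiable_comp dfc dF.
split; first exact/derivable1_diffP.
by rewrite deriveE// diff_comp//= eF -deriveE// Dc.
Qed.

End ChainRule.

(** * The integral over the sphere *)

Section RowContinuity.
Variables (R : realType) (T : topologicalType) (n : nat).

Lemma continuous_row (c : T -> 'rV[R]_n.+1) (p : T) :
  (forall i, {for p, continuous (fun q => c q 0 i)}) -> {for p, continuous c}.
Proof.
move=> H; apply/cvgrPdist_le => e e0; near=> q.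
apply: row_norm_le; first exact: ltW.
near: q; apply: (@filter_forall _ _ (fun i q => `|(c p - c q) 0 i| <= e) (nbhs p)) => i.
have /cvgrPdist_le/(_ e e0) := H i.
by apply: filterS => q; rewrite !mxE.
Unshelve. all: by end_near. Qed.

End RowContinuity.

Section IntervalIntegral.
Variable R : realType.
Local Notation mu := (@lebesgue_measure R).
Implicit Types (g : R -> R) (a b : R).

Lemma continuous_integrable_itv g a b : continuous g ->
  mu.-integrable `[a, b]%classic (EFin \o g).
Proof.
move=> cg; apply: continuous_compact_integrable; first exact: segment_compact.
exact: continuous_subspaceT.
Qed.

(** By continuity [g] stays above [g t1 / 2] on an interval of positive length. *)
Lemma Rintegral_itv_gt0 g a b t1 : continuous g ->
  (forall t, a <= t <= b -> 0 <= g t) -> a < t1 < b -> 0 < g t1 ->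
  0 < \int[mu]_(t in `[a, b]) g t.
Proof.
move=> cg g0 /andP[at1 t1b] gt1.
have [d d0 Hd] : exists2 d, 0 < d & forall t, t1 - d <= t <= t1 + d -> g t1 / 2 <= g t.
  have /cvgrPdist_le/(_ (g t1 / 2)) := cg t1.
  rewrite divr_gt0// => /(_ isT) /nbhs_ballP[e /= e0 He].
  exists (e / 2); first by rewrite divr_gt0.
  move=> t ht; have /= : `|g t1 - g t| <= g t1 / 2.
    by apply: He; rewrite -ball_normE/= ltr_norml; apply/andP; split; lra.
  by rewrite ler_norml => /andP[_]; lra.
pose c := Num.max a (t1 - d); pose c' := Num.min b (t1 + d).
have cc' : c < c'.
  by rewrite /c /c' lt_min !gt_max; apply/andP; split; apply/andP; split; lra.
have mg (D : set R) : measurable_fun D (EFin \o g).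
  by apply/measurable_EFinP; apply: measurable_funTS; exact: continuous_measurable_fun.
have sub : `[c, c']%classic `<=` `[a, b]%classic.
  move=> t /=; rewrite !in_itv/= /c /c' ge_max le_min.
  by move=> /andP[/andP[-> _]] /andP[-> _].
have fin : (\int[mu]_(t in `[a, b]) (g t)%:E)%E \is a fin_num.
  apply: integrable_fin_num => //=; exact: continuous_integrable_itv.
rewrite /Rintegral -lte_fin fineK//.
apply: (@lt_le_trans _ _ (\int[mu]_(t in `[c, c']) (g t1 / 2)%:E)%E).
  rewrite integral_cst//= lebesgue_measure_itv/= lte_fin cc' -EFinB -EFinM lte_fin.
  by rewrite mulr_gt0// ?divr_gt0// subr_gt0.
apply: (@le_trans _ _ (\int[mu]_(t in `[c, c']) (g t)%:E)%E).
  apply: ge0_le_integral => //=.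
  - by move=> t _; rewrite lee_fin divr_ge0// ltW.
  - exact: mg.
  move=> t; rewrite in_itv/= /c /c' ge_max le_min lee_fin => /andP[/andP[_ h1] /andP[_ h2]].
  by apply: Hd; rewrite h1 h2.
by apply: ge0_subset_integral => //=; exact: mg.
Qed.

End IntervalIntegral.

Section SphereIntegral.
Variable R : realType.
Local Notation mu := (@lebesgue_measure R).

Definition on_sphere n (x : 'rV[R]_n.+1) : bool := \sum_i x 0 i ^+ 2 == 1.

(** Continuity in the ambient space at the points of the sphere.  It passes to
    the slices of polar coordinates and holds for all functions in use, which
    are defined near the sphere. *)
Definition cont_sphere n (f : 'rV[R]_n.+1 -> R) : Prop :=
  forall x, on_sphere x -> {for x, continuous f}.

Definition polar n (t : R) (y : 'rV[R]_n.+1) : 'rV[R]_n.+2 :=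
  row_mx ((cos t)%:M : 'rV[R]_1) (sin t *: y).

Lemma polar0 n t (y : 'rV[R]_n.+1) : polar t y 0 ord0 = cos t.
Proof.
rewrite /polar mxE; case: splitP => [j _|j //].
by rewrite mxE ord1 eqxx mulr1n.
Qed.

Lemma polarS n t (y : 'rV[R]_n.+1) i : polar t y 0 (lift ord0 i) = sin t * y 0 i.
Proof.
rewrite /polar mxE; case: splitP => [j|j [/val_inj <-]]; last by rewrite mxE.
by rewrite ord1.
Qed.

Lemma polar_on_sphere n t (y : 'rV[R]_n.+1) : on_sphere y -> on_sphere (polar t y).
Proof.
rewrite /on_sphere => /eqP y1; rewrite big_ord_recl polar0.
under eq_bigr do rewrite polarS exprMn.
by rewrite -mulr_sumr y1 mulr1 cos2Dsin2.
Qed.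

Lemma polar_surj n (x : 'rV[R]_n.+2) : on_sphere x ->
  exists t y, [/\ 0 <= t <= pi, on_sphere y & x = polar t y].
Proof.
rewrite /on_sphere big_ord_recl => /eqP x1.
have s0 : 0 <= \sum_(i < n.+1) x 0 (lift ord0 i) ^+ 2 by apply: sumr_ge0 => i _; exact: sqr_ge0.
have x01 : -1 <= x 0 ord0 <= 1 by apply/andP; split; nra.
pose t := acos (x 0 ord0).
have ct : cos t = x 0 ord0 by rewrite /t acosK// in_itv.
have t0 : 0 <= t <= pi by rewrite /t acos_ge0// acos_lepi.
have st : sin t ^+ 2 = \sum_(i < n.+1) x 0 (lift ord0 i) ^+ 2.
  by have := cos2Dsin2 t; rewrite ct; lra.
exists t; have [s_eq0|sn0] := eqVneq (sin t) 0.
  (* At a pole the other coordinates vanish, and every [y] will do. *)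
  exists (delta_mx 0 0); split=> //.
    rewrite (bigD1 (0 : 'I_n.+1))//= big1 ?mxE ?eqxx ?addr0 ?expr1n//.
    by move=> i i0; rewrite mxE (negbTE i0) andbF expr0n.
  apply/rowP => j; case: (unliftP ord0 j) => [i|] ->; last by rewrite polar0 ct.
  rewrite polarS s_eq0 mul0r; apply/eqP; rewrite -sqrf_eq0.
  move: st; rewrite s_eq0 expr0n/= => /esym/eqP.
  by rewrite psumr_eq0 => [/allP/(_ i)|k _]; rewrite ?mem_index_enum ?sqr_ge0//; apply.
exists (\row_i (x 0 (lift ord0 i) / sin t)); split=> //.
  under eq_bigr do rewrite mxE exprMn exprVn.
  by rewrite -mulr_suml -st divff// sqrf_eq0.
apply/rowP => j; case: (unliftP ord0 j) => [i|] ->; last by rewrite polar0 ct.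
by rewrite polarS mxE mulrC divfK.
Qed.

Lemma continuous_polar n (p : R * 'rV[R]_n.+1) :
  {for p, continuous (fun q : R * 'rV[R]_n.+1 => polar q.1 q.2)}.
Proof.
apply: continuous_row => j; case: (unliftP ord0 j) => [i|] ->.
  rewrite (_ : (fun q => _) = (fun q : R * 'rV[R]_n.+1 => sin q.1 * q.2 0 i)); last first.
    by apply/funext => q; rewrite polarS.
  apply: (@continuousM R _ (fun q : R * 'rV[R]_n.+1 => sin q.1)).
    apply: continuous_comp; [exact: cvg_fst|exact: continuous_sin].
  apply: (@continuous_comp _ _ _ (fun q : R * 'rV[R]_n.+1 => q.2) (fun y : 'rV[R]_n.+1 => y 0 i)).
    exact: cvg_snd.
  exact: coord_continuous.
rewrite (_ : (fun q => _) = (fun q : R * 'rV[R]_n.+1 => cos q.1)); last first.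
  by apply/funext => q; rewrite polar0.
apply: continuous_comp; [exact: cvg_fst|exact: continuous_cos].
Qed.

Lemma continuous_pairl (T : topologicalType) (t : R) (y : T) :
  {for y, continuous (fun y : T => (t, y))}.
Proof.
by apply: (@cvg_pair _ _ _ (nbhs y) (nbhs t) (nbhs y) _ _ _ (fun=> t) id);
  [exact: cvg_cst|exact: cvg_id].
Qed.

Lemma cont_sphere_polar n (f : 'rV[R]_n.+2 -> R) t : cont_sphere f -> cont_sphere (fun y => f (polar t y)).
Proof.
move=> cf y yS.
apply: (@continuous_comp _ _ _ (fun y => polar t y) f); last exact/cf/polar_on_sphere.
apply: (@continuous_comp _ _ _ (fun y => (t, y)) (fun q => polar q.1 q.2)).
  exact: continuous_pairl.
exact: continuous_polar.
Qed.

Lemma compact_sphere n : compact [set x : 'rV[R]_n.+1 | on_sphere x].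
Proof.
apply: bounded_closed_compact.
  exists 1; split=> // M M1 x /= /eqP x1; apply: row_norm_le; first lra.
  move=> i; have : x 0 i ^+ 2 <= 1.
    rewrite -x1 (bigD1 i)//= lerDl; apply: sumr_ge0 => j _; exact: sqr_ge0.
  by rewrite -real_normK ?num_real//; have := normr_ge0 (x 0 i); nra.
rewrite (_ : mkset _ = (fun x : 'rV[R]_n.+1 => \sum_i x 0 i ^+ 2) @^-1` [set 1]); last first.
  by apply/seteqP; split => x /= /eqP.
apply: closed_comp; last exact: closed_eq.
move=> x _; apply: continuous_sumr => i.
apply: (@continuous_comp _ _ _ (fun x : 'rV[R]_n.+1 => x 0 i) (fun r => r ^+ 2)).
  exact: coord_continuous.
exact: exprn_continuous.
Qed.

Lemma cont_sphere_bounded n (f : 'rV[R]_n.+1 -> R) : cont_sphere f ->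
  exists M, 0 <= M /\ forall x, on_sphere x -> `|f x| <= M.
Proof.
move=> cf.
have /compact_bounded[M [_ HM]] : compact (f @` [set x | on_sphere x]).
  apply: continuous_compact; last exact: compact_sphere.
  by apply: continuous_in_subspaceT => x; rewrite inE => /cf.
exists (`|M| + 1); split; first by rewrite addr_ge0.
move=> x xS; apply: (HM (`|M| + 1)); last by exists x.
by rewrite (le_lt_trans (ler_norm M))// ltrDl.
Qed.

Notation I := sphere_integral.

Lemma sphere_integralS n (f : 'rV[R]_n.+2 -> R) :
  I f = \int[mu]_(t in `[0%R, pi]) (sin t ^+ n * I (fun y => f (polar t y))).
Proof. by []. Qed.

Lemma eq_sphere_integral n (f g : 'rV[R]_n.+1 -> R) :
  (forall x, on_sphere x -> f x = g x) -> I f = I g.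
Proof.
elim: n f g => [|n IH] f g fg.
  by congr (_ + _); apply: fg; rewrite /on_sphere big_ord1 mxE ?sqrrN expr1n.
rewrite !sphere_integralS; apply: eq_Rintegral => t _; congr (_ * _).
by apply: IH => y yS; apply/fg/polar_on_sphere.
Qed.

Lemma cont_sphere_cst n c : cont_sphere (fun _ : 'rV[R]_n.+1 => c).
Proof. by move=> x _; exact: cst_continuous. Qed.

Lemma cont_sphereD n (f g : 'rV[R]_n.+1 -> R) : cont_sphere f -> cont_sphere g -> cont_sphere (fun x => f x + g x).
Proof. by move=> cf cg x xS; apply: (@continuousD R R _ f g); [exact: cf|exact: cg]. Qed.

Lemma cont_sphereM n (f g : 'rV[R]_n.+1 -> R) : cont_sphere f -> cont_sphere g -> cont_sphere (fun x => f x * g x).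
Proof. by move=> cf cg x xS; apply: (@continuousM R _ f g); [exact: cf|exact: cg]. Qed.

Lemma cont_sphereZ n (c : R) (f : 'rV[R]_n.+1 -> R) : cont_sphere f -> cont_sphere (fun x => c * f x).
Proof. exact/cont_sphereM/cont_sphere_cst. Qed.

Lemma cont_sphereN n (f : 'rV[R]_n.+1 -> R) : cont_sphere f -> cont_sphere (fun x => - f x).
Proof. by move=> cf x xS; apply: continuousN; exact: cf. Qed.

Lemma cont_sphereB n (f g : 'rV[R]_n.+1 -> R) : cont_sphere f -> cont_sphere g -> cont_sphere (fun x => f x - g x).
Proof. by move=> cf cg; apply: cont_sphereD => //; exact: cont_sphereN. Qed.

Definition joint_cont n (k : R -> 'rV[R]_n.+1 -> R) := forall t y, on_sphere y ->
  {for (t, y), continuous (fun q : R * 'rV[R]_n.+1 => k q.1 q.2)}.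

Lemma joint_cont_cont_sphere n (k : R -> 'rV[R]_n.+1 -> R) t : joint_cont k -> cont_sphere (k t).
Proof.
move=> ck y yS; have := ck t y yS.
move=> /(@continuous_comp _ _ _ (fun y => (t, y)) (fun q => k q.1 q.2)); apply.
exact: continuous_pairl.
Qed.

(** Compactness of the sphere makes the continuity in [t] uniform in [y]. *)
Lemma joint_cont_unif n (k : R -> 'rV[R]_n.+1 -> R) t (e : R) : joint_cont k -> 0 < e ->
  \forall s \near t, forall y, on_sphere y -> `|k t y - k s y| <= e.
Proof.
move=> ck e0.
have /compact_near_coveringP/(_ R (nbhs t) (fun s y => `|k t y - k s y| <= e)) := @compact_sphere n.
apply=> y yS.
have e20 : 0 < e / 2 by rewrite divr_gt0.
have /cvgrPdist_le/(_ _ e20)[[A B] [/= At By] AB] := ck t y yS.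
exists (B, A) => //= -[y' s] /= [By' As].
have h1 := AB (s, y') (conj As By').
have h2 := AB (t, y') (conj (nbhs_singleton At) By').
rewrite /= in h1 h2.
have -> : k t y' - k s y' = (k t y - k s y') - (k t y - k t y') by ring.
by rewrite (le_trans (ler_normB _ _))//; lra.
Qed.

(** These properties are proved together by induction on [n]: on the next
    sphere, integrability in [t] comes from continuity of the slice integrals,
    which needs all three of them here. *)
Definition int_props n :=
 [/\ (forall f g : 'rV[R]_n.+1 -> R, cont_sphere f -> cont_sphere g -> I (fun x => f x + g x) = I f + I g),
     (forall c (f : 'rV[R]_n.+1 -> R), cont_sphere f -> I (fun x => c * f x) = c * I f) &
     (forall f : 'rV[R]_n.+1 -> R, cont_sphere f -> (forall x, on_sphere x -> 0 <= f x) -> 0 <= I f)].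

Lemma int_props_bound n (f : 'rV[R]_n.+1 -> R) M : int_props n -> cont_sphere f ->
  (forall x, on_sphere x -> `|f x| <= M) -> `|I f| <= M * I (fun _ : 'rV[R]_n.+1 => 1).
Proof.
move=> [ID IZ I0] cf fM.
have c1 := @cont_sphere_cst n 1.
rewrite -IZ// ler_norml; apply/andP; split.
  rewrite -subr_ge0 opprK -ID//; last exact: cont_sphereZ.
  apply: I0; first by apply: cont_sphereD => //; exact: cont_sphereZ.
  by move=> x /fM; rewrite ler_norml mulr1 => /andP[+ _]; lra.
rewrite -subr_ge0 -mulN1r -IZ// -ID//; [|exact: cont_sphereZ..].
apply: I0; first by apply: cont_sphereD; exact: cont_sphereZ.
by move=> x /fM; rewrite ler_norml mulr1 => /andP[_]; lra.
Qed.

Lemma int_props_param n (k : R -> 'rV[R]_n.+1 -> R) : int_props n -> joint_cont k ->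
  continuous (fun t => I (k t)).
Proof.
move=> P ck t; have [ID IZ I0] := P.
have c1 := @cont_sphere_cst n 1; have I10 : 0 <= I (fun _ : 'rV[R]_n.+1 => 1) by exact: I0.
apply/cvgrPdist_le => e e0; pose V := I (fun _ : 'rV[R]_n.+1 => 1) + 1.
have V0 : 0 < V by rewrite ltr_pwDr.
have := @joint_cont_unif n k t (e / V) ck (divr_gt0 e0 V0).
apply: filterS => s Hs.
have ckt := @joint_cont_cont_sphere _ _ t ck; have cks := @joint_cont_cont_sphere _ _ s ck.
have -> : I (k t) - I (k s) = I (fun y => k t y - k s y).
  rewrite ID//; last exact: cont_sphereN.
  congr (_ + _); rewrite -mulN1r -IZ//.
  by apply: eq_sphere_integral => y _; rewrite mulN1r.
apply: le_trans (int_props_bound P (cont_sphereB ckt cks) Hs) _.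
rewrite -[leRHS](divfK (lt0r_neq0 V0)) ler_wpM2l// ?divr_ge0 ?ltW//.
by rewrite /V ltrDl.
Qed.

Lemma joint_cont_polar n (f : 'rV[R]_n.+2 -> R) : cont_sphere f -> joint_cont (fun t y => f (polar t y)).
Proof.
move=> cf t y yS.
apply: (@continuous_comp _ _ _ (fun q : R * 'rV[R]_n.+1 => polar q.1 q.2) f).
  exact: continuous_polar.
by apply: cf; exact: polar_on_sphere.
Qed.

Lemma continuous_sin_slice n (k : R -> 'rV[R]_n.+1 -> R) j : int_props n -> joint_cont k ->
  continuous (fun t => sin t ^+ j * I (k t)).
Proof.
move=> P ck t; apply: (@continuousM R _ (fun t => sin t ^+ j) (fun t => I (k t))).
  apply: (@continuous_comp _ _ _ (@sin R) (fun r => r ^+ j)).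
    exact: continuous_sin.
  exact: exprn_continuous.
exact: int_props_param.
Qed.

Lemma sphere_integral_props n : int_props n.
Proof.
elim: n => [|n IH].
  split=> [f g _ _|c f _|f _ f0]; rewrite /I/=.
  - by rewrite addrACA.
  - by rewrite mulrDr.
  - by rewrite addr_ge0// f0// /on_sphere big_ord1 mxE ?sqrrN expr1n.
have [ID IZ I0] := IH.
have int (f : 'rV[R]_n.+2 -> R) : cont_sphere f ->
    mu.-integrable `[0%R, pi]%classic (EFin \o (fun t => sin t ^+ n * I (fun y => f (polar t y)))).
  move=> cf; apply: continuous_integrable_itv; apply: continuous_sin_slice => //.
  exact: joint_cont_polar.
split.
- move=> f g cf cg; rewrite !sphere_integralS -RintegralD//; [|exact: int..].
  apply: eq_Rintegral => t _; rewrite -mulrDr -ID//; exact: cont_sphere_polar.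
- move=> c f cf; rewrite !sphere_integralS -RintegralZl//; last exact: int.
  by apply: eq_Rintegral => t _; rewrite mulrCA IZ//; exact: cont_sphere_polar.
- move=> f cf f0; rewrite sphere_integralS; apply: Rintegral_ge0 => t /=.
  rewrite in_itv/= => tp; apply: mulr_ge0; first by rewrite exprn_ge0// sin_ge0_pi.
  apply: I0; first exact: cont_sphere_polar.
  by move=> y yS; apply/f0/polar_on_sphere.
Qed.

(** The point [x0] may be a pole of the polar coordinates, where the density
    [sin t ^+ n] vanishes; by continuity some slice off the poles has positive
    integral too. *)
Lemma sphere_integral_gt0 n (f : 'rV[R]_n.+1 -> R) x0 : cont_sphere f ->
  (forall x, on_sphere x -> 0 <= f x) -> on_sphere x0 -> 0 < f x0 -> 0 < I f.
Proof.
elim: n f x0 => [|n IH] f x0 cf f0 x0S fx0.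
  have S1 : on_sphere (const_mx 1 : 'rV[R]_1) by rewrite /on_sphere big_ord1 mxE expr1n.
  have S2 : on_sphere (const_mx (-1) : 'rV[R]_1).
    by rewrite /on_sphere big_ord1 mxE sqrrN expr1n.
  rewrite /I/=; have := f0 _ S1; have := f0 _ S2.
  have : x0 = const_mx 1 \/ x0 = const_mx (-1).
    move: x0S; rewrite /on_sphere big_ord1 sqrf_eq1 => /orP[]/eqP e; [left|right];
      by apply/rowP => i; rewrite ord1 mxE e.
  by move: fx0 => /[swap] -[->|->]; lra.
have [t [y [t0 yS x0E]]] := polar_surj x0S.
have cn := @continuous_sin_slice n (fun t y => f (polar t y)) n
  (sphere_integral_props n) (joint_cont_polar cf).
have It0 : 0 < I (fun y => f (polar t y)).
  apply: (IH _ y) => //; first exact: cont_sphere_polar; last by rewrite -x0E.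
  by move=> z zS; apply/f0/polar_on_sphere.
have ci := int_props_param (sphere_integral_props n) (joint_cont_polar cf).
have [t1 t1p It1] : exists2 t1, 0 < t1 < pi & 0 < I (fun y => f (polar t1 y)).
  have /cvgrPdist_lt/(_ _ It0) := ci t.
  move=> /nbhs_ballP[e /= e0 He].
  have p0 := pi_gt0 R.
  pose d := Num.min (e / 2) (pi / 4).
  have d0 : 0 < d by rewrite lt_min; apply/andP; split; lra.
  have [de dp] : d <= e / 2 /\ d <= pi / 4 by split; rewrite /d ge_min lexx ?orbT.
  (* A small step from [t] towards the equator. *)
  pose t1 := if t <= pi / 2 then t + d else t - d.
  have ht1 : 0 < t1 < pi /\ `|t - t1| < e.
    move: t0 => /andP[ta tb].
    by rewrite /t1; case: (lerP t (pi / 2)) => h; rewrite ltr_norml; split;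
      apply/andP; split; lra.
  exists t1; first by case: ht1.
  have : `|I (fun y => f (polar t y)) - I (fun y => f (polar t1 y))| < I (fun y => f (polar t y)).
    by apply: He; rewrite -ball_normE/=; case: ht1.
  by rewrite ltr_norml => /andP[_]; lra.
rewrite sphere_integralS; apply: (Rintegral_itv_gt0 cn _ t1p).
  move=> s sp; apply: mulr_ge0; first by rewrite exprn_ge0// sin_ge0_pi.
  have [_ _] := sphere_integral_props n; apply; first exact: cont_sphere_polar.
  by move=> z zS; apply/f0/polar_on_sphere.
by rewrite mulr_gt0// exprn_gt0// sin_gt0_pi.
Qed.

Section Consequences.
Variable n : nat.
Implicit Types f g : 'rV[R]_n.+1 -> R.

Lemma sphere_integralD f g : cont_sphere f -> cont_sphere g -> I (fun x => f x + g x) = I f + I g.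
Proof. by have [H _ _] := sphere_integral_props n; exact: H. Qed.

Lemma sphere_integralZ c f : cont_sphere f -> I (fun x => c * f x) = c * I f.
Proof. by have [_ H _] := sphere_integral_props n; exact: H. Qed.

Lemma sphere_integral_ge0 f : cont_sphere f -> (forall x, on_sphere x -> 0 <= f x) -> 0 <= I f.
Proof. by have [_ _ H] := sphere_integral_props n; exact: H. Qed.

Lemma sphere_integralN f : cont_sphere f -> I (fun x => - f x) = - I f.
Proof.
move=> cf; rewrite -mulN1r -sphere_integralZ//.
by apply: eq_sphere_integral => x _; rewrite mulN1r.
Qed.

Lemma sphere_integralB f g : cont_sphere f -> cont_sphere g -> I (fun x => f x - g x) = I f - I g.
Proof.
by move=> cf cg; rewrite sphere_integralD ?sphere_integralN//; exact: cont_sphereN.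
Qed.

Lemma sphere_integral0 : I (fun _ : 'rV[R]_n.+1 => 0) = 0.
Proof.
rewrite -[RHS](mul0r (I (fun _ : 'rV[R]_n.+1 => 0))) -sphere_integralZ; last exact: cont_sphere_cst.
by apply: eq_sphere_integral => x _; rewrite mul0r.
Qed.

Lemma cont_sphere_sum (J : Type) (r : seq J) (f : J -> 'rV[R]_n.+1 -> R) :
  (forall j, cont_sphere (f j)) -> cont_sphere (fun x => \sum_(j <- r) f j x).
Proof. by move=> cf x xS; apply: continuous_sumr => j; exact: cf. Qed.

Lemma sphere_integral_sum (J : Type) (r : seq J) (f : J -> 'rV[R]_n.+1 -> R) :
  (forall j, cont_sphere (f j)) -> I (fun x => \sum_(j <- r) f j x) = \sum_(j <- r) I (f j).
Proof.
move=> cf; elim: r => [|j r IH].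
  by rewrite big_nil -[RHS]sphere_integral0; apply: eq_sphere_integral => x _; rewrite big_nil.
rewrite big_cons -IH -sphere_integralD//; last exact: cont_sphere_sum.
by apply: eq_sphere_integral => x _; rewrite big_cons.
Qed.

Lemma ler_sphere_integral f g : cont_sphere f -> cont_sphere g ->
  (forall x, on_sphere x -> f x <= g x) -> I f <= I g.
Proof.
move=> cf cg fg; rewrite -subr_ge0 -sphere_integralB//.
by apply: sphere_integral_ge0; [exact: cont_sphereB|move=> x /fg; rewrite subr_ge0].
Qed.

Lemma sphere_integral_bound f M : cont_sphere f -> (forall x, on_sphere x -> `|f x| <= M) ->
  `|I f| <= M * I (fun _ : 'rV[R]_n.+1 => 1).
Proof. exact/int_props_bound/sphere_integral_props. Qed.

Lemma on_sphere_delta i : on_sphere (delta_mx 0 i : 'rV[R]_n.+1).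
Proof.
rewrite /on_sphere (bigD1 i)//= big1 ?mxE ?eqxx ?addr0 ?expr1n//.
by move=> j ji; rewrite mxE (negbTE ji) andbF expr0n.
Qed.

Lemma sphere_volume_gt0 : 0 < I (fun _ : 'rV[R]_n.+1 => 1).
Proof.
apply: (@sphere_integral_gt0 _ _ (delta_mx 0 0)) => //; first exact: cont_sphere_cst.
exact: on_sphere_delta.
Qed.

Lemma sphere_integral_eq0 f : cont_sphere f -> (forall x, on_sphere x -> 0 <= f x) ->
  I f = 0 -> forall x, on_sphere x -> f x = 0.
Proof.
move=> cf f0 If x xS; apply/eqP; rewrite eq_le f0// andbT leNgt.
by apply/negP => fx; have := sphere_integral_gt0 cf f0 xS fx; rewrite If ltxx.
Qed.

(** The mean value theorem bounds the error of the difference quotients by the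
    variation of [dk] in [t], which is small uniformly on the sphere. *)
Lemma is_derive_sphere_integral (k dk : R -> 'rV[R]_n.+1 -> R) (t : R) :
  joint_cont k -> joint_cont dk ->
  (forall (s : R) y, on_sphere y -> is_derive s 1 (fun s : R => k s y) (dk s y)) ->
  is_derive t 1 (fun t : R => I (k t)) (I (dk t)).
Proof.
move=> ck cdk Hd.
have V0 := sphere_volume_gt0; set V := I (fun=> 1) in V0.
have cdkt := @joint_cont_cont_sphere _ _ t cdk.
suff lim : (fun h : R => h^-1 *: (I (k (h *: 1 + t)) - I (k t))) @ 0^' --> I (dk t).
  by split; [exact: cvgP lim|exact: cvg_lim lim].
apply/cvgrPdist_le => e e0.
have := @joint_cont_unif n dk t (e / V) cdk (divr_gt0 e0 V0).
move=> /nbhs_ballP[d /= d0 Hball]; near=> h.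
have hn0 : h != 0 by near: h; exact: nbhs_dnbhs_neq.
have hd : `|h| < d by near: h; exact: dnbhs0_lt.
rewrite [h *: 1]mulr1.
have ckt := @joint_cont_cont_sphere _ _ t ck; have ckh := @joint_cont_cont_sphere _ _ (h + t) ck.
rewrite distrC.
have -> : h^-1 *: (I (k (h + t)) - I (k t)) - I (dk t) =
    I (fun y => h^-1 * (k (h + t) y - k t y) - dk t y).
  rewrite sphere_integralB//; last by apply/cont_sphereZ/cont_sphereB.
  by rewrite sphere_integralZ ?sphere_integralB//; exact: cont_sphereB.
rewrite -[leRHS](divfK (lt0r_neq0 V0)).
apply: sphere_integral_bound.
  by apply: cont_sphereB => //; apply/cont_sphereZ/cont_sphereB.
move=> y yS.
have [s /andP[s0 s1] es] : exists2 s : R, 0 <= s <= 1 & k (h + t) y - k t y = dk (t + s * h) y * h.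
  have d1 (s : R) : is_derive s 1 (fun s : R => k (t + s * h) y) (dk (t + s * h) y * h).
    apply: (@is_derive1_comp R (fun s : R => k s y) (fun s : R => t + s * h) s).
      exact: Hd.
    by apply: is_derive_eq; rewrite /GRing.scale/=; ring.
  have [|s] := @MVT_segment R _ _ 0 1 ler01 (fun s _ => d1 s).
    by apply: derivable_within_continuous => s _; case: (d1 s).
  rewrite in_itv/= => s01; rewrite mul1r mul0r addr0 subr0 mulr1 [t + h]addrC.
  by exists s.
rewrite es mulrCA mulVf// mulr1 distrC; apply: Hball => //.
rewrite -ball_normE/= opprD addNKr normrN normrM (ger0_norm s0).
by rewrite (le_lt_trans _ hd)// ler_piMl.
Unshelve. all: by end_near. Qed.

End Consequences.

End SphereIntegral.

(** * Infinitesimal rotations integrate to zero *)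

Section SmoothCalculus.
Variables (R : realType) (n : nat).
Implicit Types (F G : 'rV[R]_n.+1 -> R) (x : 'rV[R]_n.+1) (i j : 'I_n.+1).
Local Notation e_ i := (delta_mx 0 i : 'rV[R]_n.+1).

Definition pd i F : 'rV[R]_n.+1 -> R := 'D_(e_ i) F.

Lemma is_derive_coord i j x : is_derive x (e_ i) (fun y : 'rV[R]_n.+1 => y 0 j) (i == j)%:R.
Proof.
have e : (fun h : R => h^-1 *: ((h *: e_ i + x) 0 j - x 0 j)) @ 0^' --> ((i == j)%:R : R).
  apply/cvgrPdist_le => e e0; near=> h.
  have hn0 : h != 0 by near: h; exact: nbhs_dnbhs_neq.
  rewrite !mxE eqxx/= addrK [j == i]eq_sym scalerA mulVf// scale1r.
  by rewrite subrr normr0 ltW.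
by split; [exact: cvgP e|exact: cvg_lim e].
Unshelve. all: by end_near. Qed.

Lemma near_eq_continuous F G x : (\forall z \near x, F z = G z) ->
  {for x, continuous F} -> {for x, continuous G}.
Proof.
move=> FG cF; rewrite /prop_for /continuous_at -(nbhs_singleton FG).
exact: cvg_trans (near_eq_cvg FG) cF.
Qed.

Lemma C1_at_continuous F x : C1_at F x -> {for x, continuous F}.
Proof. by move=> /C1_differentiable[dF _]; exact: differentiable_continuous. Qed.

Lemma C1_at_derivable F x i : C1_at F x -> derivable F x (e_ i).
Proof. by move=> /(_ i)[/nbhs_singleton]. Qed.

Lemma pdM i F G x : derivable F x (e_ i) -> derivable G x (e_ i) ->
  pd i (F \* G) x = pd i F x * G x + F x * pd i G x.
Proof.
by move=> dF dG; rewrite /pd deriveM//= /GRing.scale/=; ring.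
Qed.

End SmoothCalculus.

Section SkewSymmetry.
Variable R : realType.
Local Notation I := sphere_integral.
Local Notation e_ i := (delta_mx 0 i).

Lemma polar_shift n t (y : 'rV[R]_n.+1) (h : R) i :
  polar t (h *: e_ i + y) = (h * sin t) *: e_ (lift ord0 i) + polar t y.
Proof.
apply/rowP => j; case: (unliftP ord0 j) => [l|] ->.
  rewrite [RHS]mxE [X in _ = X + _]mxE !polarS !mxE !eqxx/= (inj_eq lift_inj).
  by rewrite mulrDr; congr (_ + _); rewrite mulrCA mulrA.
by rewrite [RHS]mxE [X in _ = X + _]mxE !polar0 !mxE /= mulr0 add0r.
Qed.

Lemma is_derive_slice n (F : 'rV[R]_n.+2 -> R) t (y : 'rV[R]_n.+1) i :
  derivable F (polar t y) (e_ (lift ord0 i)) ->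
  is_derive y (e_ i) (fun y => F (polar t y)) (sin t * pd (lift ord0 i) F (polar t y)).
Proof.
move=> dF.
have d1 := @is_derive_line _ _ F (polar t y) (e_ (lift ord0 i)) 0.
rewrite scale0r addr0 in d1; have {}d1 := d1 dF.
have d2 : is_derive (0 : R) 1 (fun h : R => F (polar t y + (h * sin t) *: e_ (lift ord0 i)))
    ('D_(e_ (lift ord0 i)) F (polar t y) * sin t).
  apply: (@is_derive1_comp R (fun h : R => F (polar t y + h *: e_ (lift ord0 i))) (fun h : R => h * sin t) 0).
    by rewrite mul0r.
  by apply: is_derive_eq; rewrite /GRing.scale/=; ring.
have e : (fun h : R => h^-1 *: (F (polar t (h *: e_ i + y)) - F (polar t y))) =
   (fun h : R => h^-1 *: (F (polar t y + ((h *: 1 + 0) * sin t) *: e_ (lift ord0 i)) -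
      F (polar t y + (0 * sin t) *: e_ (lift ord0 i)))).
  apply/funext => h; rewrite polar_shift mul0r scale0r !addr0 /GRing.scale/= mulr1.
  by congr (_ * (F _ - _)); rewrite addrC.
rewrite [sin t * _]mulrC /pd.
by split; rewrite /derivable /derive /= e; case: d2.
Qed.

Definition C1_sphere n (F : 'rV[R]_n.+1 -> R) := forall x, on_sphere x -> C1_at F x.

Lemma C1_sphere_cont_sphere n (F : 'rV[R]_n.+1 -> R) : C1_sphere F -> cont_sphere F.
Proof. by move=> CF x xS; exact/C1_at_continuous/CF. Qed.

Lemma C1_sphere_cont_sphere_pd n (F : 'rV[R]_n.+1 -> R) i : C1_sphere F -> cont_sphere (pd i F).
Proof. by move=> CF x xS; case: (CF x xS i). Qed.

Lemma cont_sphere_coord n (i : 'I_n.+1) : cont_sphere (fun x : 'rV[R]_n.+1 => x 0 i).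
Proof. by move=> x _; exact: coord_continuous. Qed.

Lemma continuous_polar_t n t (y : 'rV[R]_n.+1) : {for y, continuous (polar t)}.
Proof.
apply: (@continuous_comp _ _ _ (fun y => (t, y)) (fun q => polar q.1 q.2)).
  exact: continuous_pairl.
exact: continuous_polar.
Qed.

Lemma C1_sphere_slice n (F : 'rV[R]_n.+2 -> R) t : C1_sphere F -> C1_sphere (fun y => F (polar t y)).
Proof.
move=> CF y yS i; have [nd cd] := CF _ (polar_on_sphere t yS) (lift ord0 i).
have nd' : \forall z \near y, derivable F (polar t z) (e_ (lift ord0 i)).
  exact: (@continuous_polar_t n t y _ nd).
split; first by apply: filterS nd' => z /is_derive_slice[].
have ne : \forall z \near y, sin t * pd (lift ord0 i) F (polar t z) =
    'D_(e_ i) (fun y : 'rV[R]_n.+1 => F (polar t y)) z.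
  by apply: filterS nd' => z /is_derive_slice dz; rewrite derive_val.
apply: (near_eq_continuous ne).
apply: (@continuousM R _ (fun=> sin t) (fun z => pd (lift ord0 i) F (polar t z))).
  exact: cst_continuous.
apply: (@continuous_comp _ _ _ (polar t) (pd (lift ord0 i) F)) => //.
exact: continuous_polar_t.
Qed.

Lemma C1_sphere_coordM n (F : 'rV[R]_n.+1 -> R) j : C1_sphere F ->
  C1_sphere (fun x : 'rV[R]_n.+1 => x 0 j * F x).
Proof.
move=> CF x xS i; have [nd cd] := CF x xS i.
have dc (z : 'rV[R]_n.+1) : derivable (fun y : 'rV[R]_n.+1 => y 0 j) z (e_ i).
  by case: (is_derive_coord i j z).
split; first by apply: filterS nd => z dz; exact: (derivableM (dc z) dz).
have ne : \forall z \near x, (i == j)%:R * F z + z 0 j * pd i F z =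
    'D_(e_ i) (fun x : 'rV[R]_n.+1 => x 0 j * F x) z.
  apply: filterS nd => z dz.
  rewrite -[RHS]/(pd i ((fun x : 'rV[R]_n.+1 => x 0 j) \* F) z) pdM//.
  by congr (_ * _ + _); rewrite /pd; have := is_derive_coord i j z => dd; rewrite derive_val.
apply: (near_eq_continuous ne).
apply: (@continuousD R R _ (fun z => (i == j)%:R * F z) (fun z : 'rV[R]_n.+1 => z 0 j * pd i F z)).
  apply: (@continuousM R _ (fun=> (i == j)%:R) F); first exact: cst_continuous.
  exact: C1_sphere_cont_sphere.
apply: (@continuousM R _ (fun z : 'rV[R]_n.+1 => z 0 j)) => //; exact: coord_continuous.
Qed.

(** The infinitesimal rotation in the plane of the coordinates [i] and [j]. *)
Definition rot n (i j : 'I_n.+1) (F : 'rV[R]_n.+1 -> R) (x : 'rV[R]_n.+1) : R :=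
  x 0 i * pd j F x - x 0 j * pd i F x.

Lemma cont_sphere_rot n i j (F : 'rV[R]_n.+1 -> R) : C1_sphere F -> cont_sphere (rot i j F).
Proof.
by move=> CF; apply: cont_sphereB; apply: cont_sphereM;
  [exact: cont_sphere_coord|exact: C1_sphere_cont_sphere_pd..|exact: cont_sphere_coord|exact: C1_sphere_cont_sphere_pd].
Qed.

Lemma rot_coordM n i j (F : 'rV[R]_n.+1 -> R) x : C1_sphere F -> on_sphere x ->
  rot i j (fun x => x 0 i * F x) x =
  x 0 i * rot i j F x + ((i == j)%:R * x 0 i * F x - x 0 j * F x).
Proof.
move=> CF xS; rewrite /rot.
have dc l : derivable (fun y : 'rV[R]_n.+1 => y 0 i) x (e_ l).
  by case: (is_derive_coord l i x).
have E l : pd l (fun x => x 0 i * F x) x = (l == i)%:R * F x + x 0 i * pd l F x.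
  rewrite -[LHS]/(pd l ((fun x : 'rV[R]_n.+1 => x 0 i) \* F) x) pdM//; last first.
    exact/C1_at_derivable/CF.
  by congr (_ * _ + _); rewrite /pd; have := is_derive_coord l i x => dd; rewrite derive_val.
by rewrite !E eqxx [j == i]eq_sym /=; ring.
Qed.

Lemma integral_coord0 m (j : 'I_m.+1) : m = 0%N -> I (fun y : 'rV[R]_m.+1 => y 0 j) = 0.
Proof. by case: m j => // j _; rewrite /I/= !mxE subrr. Qed.

Section PolarStep.
Variables (m : nat) (F : 'rV[R]_m.+2 -> R).
Hypothesis CF : C1_sphere F.
Hypothesis IH : forall (G : 'rV[R]_m.+1 -> R) i j, C1_sphere G -> I (rot i j G) = 0.
Variable j : 'I_m.+1.

Let k t (y : 'rV[R]_m.+1) : R := y 0 j * F (polar t y).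
Let dk t (y : 'rV[R]_m.+1) : R := y 0 j *
  (- sin t * pd ord0 F (polar t y) + cos t * \sum_i y 0 i * pd (lift ord0 i) F (polar t y)).
Let a t (y : 'rV[R]_m.+1) : R := rot ord0 (lift ord0 j) F (polar t y).

Let joint_coord i : joint_cont (fun (_ : R) (y : 'rV[R]_m.+1) => y 0 i).
Proof.
move=> t y _.
apply: (@continuous_comp _ _ _ (fun q : R * 'rV[R]_m.+1 => q.2) (fun y : 'rV[R]_m.+1 => y 0 i)).
  exact: cvg_snd.
exact: coord_continuous.
Qed.

Let joint_t (g : R -> R) : continuous g -> joint_cont (fun (t : R) (_ : 'rV[R]_m.+1) => g t).
Proof.
move=> cg t y _.
apply: (@cvg_comp _ _ _ (fun q : R * 'rV[R]_m.+1 => q.1) g _ (nbhs t)); last exact: cg.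
exact: cvg_fst.
Qed.

Let jointM (f g : R -> 'rV[R]_m.+1 -> R) : joint_cont f -> joint_cont g ->
  joint_cont (fun t y => f t y * g t y).
Proof. by move=> cf cg t y yS; apply: continuousM; [exact: cf|exact: cg]. Qed.

Let jointD (f g : R -> 'rV[R]_m.+1 -> R) : joint_cont f -> joint_cont g ->
  joint_cont (fun t y => f t y + g t y).
Proof.
move=> cf cg t y yS.
by apply: (@continuousD R R _ (fun q => f q.1 q.2) (fun q => g q.1 q.2)); [exact: cf|exact: cg].
Qed.

Let joint_k : joint_cont k.
Proof. by apply: jointM => //; exact/joint_cont_polar/C1_sphere_cont_sphere. Qed.

Let joint_pd i : joint_cont (fun t y => pd i F (polar t y)).
Proof. exact/joint_cont_polar/C1_sphere_cont_sphere_pd. Qed.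

Let joint_dk : joint_cont dk.
Proof.
apply: jointM => //; apply: jointD; apply: jointM => //.
- by apply: joint_t => t; apply: continuousN; exact: continuous_sin.
- by apply: joint_t; exact: continuous_cos.
- move=> t y yS.
  apply: (@continuous_sumr R _ _ _
    (fun i (q : R * 'rV[R]_m.+1) => q.2 0 i * pd (lift ord0 i) F (polar q.1 q.2))) => i.
  exact: (jointM (@joint_coord i) (@joint_pd (lift ord0 i)) yS).
Qed.

Let joint_a : joint_cont a.
Proof. exact/joint_cont_polar/cont_sphere_rot. Qed.

Let is_derive_k (t : R) y : on_sphere y -> is_derive t 1 (fun t : R => k t y) (dk t y).
Proof.
(* The velocity of a meridian is the point a quarter turn ahead. *)
move=> yS; pose dc : 'rV[R]_m.+2 := polar (t + pi / 2) y.
have hc i : is_derive t 1 (fun s : R => polar s y 0 i) (dc 0 i).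
  case: (unliftP ord0 i) => [l|] ->.
    rewrite (_ : (fun s => _) = (fun s : R => sin s * y 0 l)); last first.
      by apply/funext => s; rewrite polarS.
    rewrite /dc polarS sinDpihalf.
    by apply: is_derive_eq; rewrite /GRing.scale/=; ring.
  rewrite (_ : (fun s => _) = (@cos R)); last by apply/funext => s; rewrite polar0.
  by rewrite /dc polar0 cosDpihalf; exact: is_derive_cos.
have d := @is_derive_curve _ _ F (fun t : R => polar t y) dc t (CF (polar_on_sphere t yS)) hc.
have e : dk t y = y 0 j * grad_lin F (polar t y) dc.
  rewrite /dk /grad_lin [X in _ = _ * X]big_ord_recl /dc polar0 cosDpihalf; congr (_ * (_ + _)).
  rewrite mulr_sumr; apply: eq_bigr => i _; rewrite polarS sinDpihalf /pd; ring.
by rewrite e; apply: is_derive_eq; rewrite /GRing.scale/=.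
Qed.

(** The rotation moving the polar axis is [y_j d/dt] plus [cos t / sin t] times
    the field [\sum_i y_i rot i j] tangent to the slice.  Integrating the latter
    by parts with the induction hypothesis leaves [m] times the integral of
    [y_j F]. *)
Let slice_identity t : sin t * I (a t) = sin t * I (dk t) + cos t * (m%:R * I (k t)).
Proof.
pose g y := F (polar t y).
have Cg : C1_sphere g by exact: C1_sphere_slice.
have cg := C1_sphere_cont_sphere Cg.
have sumI : \sum_i I (fun y => y 0 i * rot i j g y) = m%:R * I (k t).
  transitivity (\sum_i (I (fun y => y 0 j * g y) - I (fun y => (i == j)%:R * (y 0 i * g y)))).
    apply: eq_bigr => i _.
    have := IH i j (C1_sphere_coordM i Cg).
    have cij : cont_sphere (fun y => (i == j)%:R * (y 0 i * g y)).
      by apply/cont_sphereZ/cont_sphereM => //; exact: cont_sphere_coord.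
    have cj : cont_sphere (fun y => y 0 j * g y) by apply: cont_sphereM => //; exact: cont_sphere_coord.
    have cr : cont_sphere (fun y => y 0 i * rot i j g y).
      by apply: cont_sphereM; [exact: cont_sphere_coord|exact: cont_sphere_rot].
    rewrite -sphere_integralB// => e0; apply/eqP; rewrite -subr_eq0 -e0 -sphere_integralB//;
      last exact: cont_sphereB.
    apply/eqP/eq_sphere_integral => y yS; rewrite rot_coordM//; ring.
  rewrite sumrB sumr_const card_ord (bigD1 j)//= eqxx.
  rewrite [X in _ - (_ + X)]big1 ?addr0; last first.
    move=> i /negbTE ->; rewrite -[RHS](@sphere_integral0 R m).
    by apply: eq_sphere_integral => y _; rewrite mul0r.
  have -> : I (fun y => 1 * (y 0 j * g y)) = I (k t).
    by apply: eq_sphere_integral => y _; rewrite mul1r.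
  by rewrite mulrS addrAC subrr add0r mulr_natl.
have ca := @joint_cont_cont_sphere _ _ _ t joint_a; have cdk := @joint_cont_cont_sphere _ _ _ t joint_dk.
apply/eqP; rewrite addrC -subr_eq -mulrBr -sphere_integralB// -sumI.
have ci i : cont_sphere (fun y => y 0 i * rot i j g y).
  by apply: cont_sphereM; [exact: cont_sphere_coord|exact: cont_sphere_rot].
rewrite -sphere_integral_sum// -!sphere_integralZ//; [|exact: cont_sphereB|exact: cont_sphere_sum].
apply/eqP/eq_sphere_integral => y yS.
have Eg i : pd i g y = sin t * pd (lift ord0 i) F (polar t y).
  have := @is_derive_slice m F t y i (@C1_at_derivable _ _ F _ _ (CF (polar_on_sphere t yS))).
  by move=> dd; rewrite /pd derive_val.
rewrite /a /dk /rot polar0 polarS.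
under [in RHS]eq_bigr do rewrite !Eg mulrBr.
rewrite sumrB.
have -> : \sum_i y 0 i * (y 0 i * (sin t * pd (lift ord0 j) F (polar t y))) =
    sin t * pd (lift ord0 j) F (polar t y).
  transitivity ((\sum_i y 0 i ^+ 2) * (sin t * pd (lift ord0 j) F (polar t y))).
    by rewrite mulr_suml; apply: eq_bigr => i _; rewrite mulrA expr2.
  by rewrite (eqP yS) mul1r.
have -> : \sum_i y 0 i * (y 0 j * (sin t * pd (lift ord0 i) F (polar t y))) =
    y 0 j * sin t * \sum_i y 0 i * pd (lift ord0 i) F (polar t y).
  by rewrite mulr_sumr; apply: eq_bigr => i _; ring.
ring.
Qed.

(** The slice consists of two points, where [y_j ^+ 2 = 1]: there is no tangent
    part. *)
Let slice_identity0 t : m = 0%N -> I (a t) = I (dk t).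
Proof.
move=> m0; apply: eq_sphere_integral => y yS; rewrite /a /dk /rot polar0 polarS.
have u (i : 'I_m.+1) : i = j.
  have z (l : 'I_m.+1) : l = 0%N :> nat.
    by apply/eqP; rewrite -leqn0 -ltnS (leq_trans (ltn_ord l))// m0.
  by apply/val_inj; rewrite /= !z.
have y1 : y 0 j * y 0 j = 1.
  move: yS; rewrite /on_sphere (bigD1 j)//= big1 ?addr0 ?expr2; first by move/eqP.
  by move=> i; rewrite (u i) eqxx.
rewrite (bigD1 j)//= big1 ?addr0; last first.
  by move=> i; rewrite (u i) eqxx.
have e (p q : R) : y 0 j * (- sin t * p + cos t * (y 0 j * q)) =
  - sin t * y 0 j * p + cos t * q * (y 0 j * y 0 j) by ring.
by rewrite e y1; ring.
Qed.

(** By the slice identity, the integrand is the derivative in [t] of [sin t ^+ m]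
    times the slice integral of [y_j F].  The boundary terms vanish: for
    [m > 0] because of the power of the sine, and for [m = 0] because at a pole
    [F] does not depend on [y]. *)
Lemma rot_pole_integral : I (rot ord0 (lift ord0 j) F) = 0.
Proof.
rewrite sphere_integralS.
pose H t := sin t ^+ m * I (k t).
have dH (t : R) : is_derive t 1 H (sin t ^+ m * I (a t)).
  have dK := @is_derive_sphere_integral _ _ k dk t joint_k joint_dk (fun s y yS => is_derive_k s yS).
  have ds : is_derive t 1 (fun t : R => sin t ^+ m) (m%:R * sin t ^+ m.-1 * cos t).
    apply: (@is_derive1_comp R (fun r => r ^+ m) sin t).
    by split; [exact: exprn_derivable|rewrite exp_derive /GRing.scale/= mulr1].
  rewrite /H; apply: is_derive_eq; rewrite /GRing.scale/=.
  case: (posnP m) => [m0|m_gt0].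
    have -> : m%:R = 0 :> R by rewrite m0.
    by rewrite slice_identity0// !mul0r mulr0 addr0.
  have e : sin t ^+ m = sin t ^+ m.-1 * sin t by rewrite -exprSr prednK.
  rewrite e -mulrA -mulrA slice_identity -mulr_natl; ring.
have cH : continuous (fun t => sin t ^+ m * I (a t)).
  by apply: continuous_sin_slice => //; exact: sphere_integral_props.
have cH0 t : {for t, continuous H}.
  by apply: differentiable_continuous; apply/derivable1_diffP; case: (dH t).
rewrite /Rintegral (continuous_FTC2 (F := H)) ?pi_gt0//=.
- rewrite /H; case: (posnP m) => [m0|m_gt0]; last first.
    by rewrite sinpi sin0 !expr0n !gtn_eqF//= !mul0r subrr.
  suff Z t : sin t = 0 -> I (k t) = 0.
    by rewrite !Z ?sinpi ?sin0 ?mulr0 ?subrr.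
  move=> st; pose y0 : 'rV[R]_m.+1 := 0.
  transitivity (I (fun y : 'rV[R]_m.+1 => F (polar t y0) * y 0 j)).
    apply: eq_sphere_integral => y _; rewrite /k mulrC; congr (F _ * _).
    by rewrite /polar st !scale0r.
  by rewrite sphere_integralZ ?integral_coord0 ?mulr0//; exact: cont_sphere_coord.
- exact: continuous_subspaceT.
- split.
  + by move=> t _; case: (dH t).
  + exact/cvg_at_right_filter/cH0.
  + exact/cvg_at_left_filter/cH0.
- by move=> t _; rewrite derive1E; case: (dH t).
Qed.

End PolarStep.

(** Induction on the dimension.  A rotation fixing the polar axis acts on every
    slice; the others are the subject of [rot_pole_integral]. *)
Lemma sphere_integral_rot n (F : 'rV[R]_n.+1 -> R) i j : C1_sphere F -> I (rot i j F) = 0.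
Proof.
elim: n F i j => [|m IH] F i j CF.
  rewrite -[RHS](@sphere_integral0 R 0); apply: eq_sphere_integral => x _.
  by rewrite /rot !ord1 subrr.
have anti p q : I (rot p q F) = - I (rot q p F).
  rewrite -sphere_integralN; last exact: cont_sphere_rot.
  by apply: eq_sphere_integral => x _; rewrite /rot opprB.
case: (unliftP ord0 i) => [i'|] ->; case: (unliftP ord0 j) => [j'|] ->.
- rewrite sphere_integralS /Rintegral integral0_eq// => t _; congr (_%:E).
  rewrite -[RHS](mulr0 (sin t ^+ m)) -(IH (fun y => F (polar t y)) i' j'); last exact: C1_sphere_slice.
  congr (_ * _); apply: eq_sphere_integral => y yS.
  have Eg l : pd l (fun y => F (polar t y)) y = sin t * pd (lift ord0 l) F (polar t y).
    have := @is_derive_slice m F t y l (@C1_at_derivable _ _ F _ _ (CF _ (polar_on_sphere t yS))).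
    by move=> dd; rewrite /pd derive_val.
  by rewrite /rot !Eg !polarS; ring.
- by rewrite anti rot_pole_integral ?oppr0.
- exact: rot_pole_integral.
- rewrite -[RHS](@sphere_integral0 R m.+1); apply: eq_sphere_integral => x _.
  by rewrite /rot subrr.
Qed.

End SkewSymmetry.

(** * Algebra of harmonic polynomials *)

Section HarmonicPolynomials.
Variables (R : realType) (n : nat).
Local Notation P := (mpolyType R n.+1).
Local Notation Xv i := (@mpolyX n.+1 R (mnm1 i)).
Implicit Types (p q Y : mpolyType R n.+1) (i j k : 'I_n.+1) (h : nat).

Definition homog h p := p \is ishomog1 h mdeg.
Definition laplace p : P := \sum_i mderiv i (mderiv i p).
Definition euler p : P := \sum_i Xv i * mderiv i p.
Definition normsq : P := \sum_i Xv i * Xv i.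
Definition prot i j p : P := Xv i * mderiv j p - Xv j * mderiv i p.

Lemma mderivXU i j : mderiv i (Xv j) = (i == j)%:R.
Proof.
rewrite mderivX mnm1E eq_sym; case: eqVneq => [->|_]; last by rewrite scale0r.
rewrite scale1r (_ : mnm_sub (mnm1 j) (mnm1 j) = mnm0) ?mpolyX0//.
by apply/mnmP => k; rewrite mnmBE subnn mnm0E.
Qed.

Lemma mulX_mderivX i m : Xv i * mderiv i (mpolyX R m) = (m i)%:R *: mpolyX R m.
Proof.
rewrite mderivX -scalerAr -mpolyXD; have [->|mi] := eqVneq (m i) 0%N; first by rewrite !scale0r.
congr (_ *: mpolyX _ _); apply/mnmP => j; rewrite mnmDE mnmBE mnm1E subnKC//.
by case: eqVneq => // <-; rewrite lt0n.
Qed.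

Lemma euler_linear : linear euler.
Proof.
move=> c p q; rewrite /euler scaler_sumr -big_split/=; apply: eq_bigr => i _.
by rewrite linearP mulrDr scalerAr.
Qed.
HB.instance Definition _ := GRing.isLinear.Build R P P _ euler euler_linear.

Lemma laplace_linear : linear laplace.
Proof.
move=> c p q; rewrite /laplace scaler_sumr -big_split/=; apply: eq_bigr => i _.
by rewrite !linearP.
Qed.
HB.instance Definition _ := GRing.isLinear.Build R P P _ laplace laplace_linear.

Lemma eulerX m : euler (mpolyX R m) = (mdeg m)%:R *: mpolyX R m.
Proof.
rewrite /euler mdegE natr_sum scaler_suml.
by apply: eq_bigr => i _; rewrite mulX_mderivX.
Qed.

Lemma homog_ind h (Q : P -> Prop) : Q 0 -> (forall p q, Q p -> Q q -> Q (p + q)) ->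
  (forall c m, mdeg m = h -> Q (c *: mpolyX R m)) -> forall p, homog h p -> Q p.
Proof.
move=> Q0 QD QX p /dhomogP hp; rewrite [p]mpolyE big_seq.
by elim/big_ind: _ => // m mp; apply: QX; exact: hp.
Qed.

Lemma homog_euler h p : homog h p -> euler p = h%:R *: p.
Proof.
move: p; apply: homog_ind => [|p q ep eq|c m <-].
- by rewrite linear0 scaler0.
- by rewrite linearD/= ep eq scalerDr.
- by rewrite linearZ/= eulerX !scalerA mulrC.
Qed.

Lemma homog_mderiv h p i : homog h p -> homog h.-1 (mderiv i p).
Proof.
move: p; apply: homog_ind => [|p q ep eq|c m <-].
- by rewrite mderiv0; exact: dhomog0.
- by rewrite mderivD; exact: dhomogD.
- rewrite mderivZ mderivX scalerA; have [->|mi] := eqVneq (m i) 0%N.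
    by rewrite mulr0 scale0r; exact: dhomog0.
  apply: dhomogZ; rewrite /homog dhomogX; apply/eqP.
  have : (mdeg (mnm1 i) + mdeg (mnm_sub m (mnm1 i)) = mdeg m)%N.
    rewrite -mdegD; congr mdeg; apply/mnmP => j; rewrite mnmDE mnmBE mnm1E subnKC//.
    by case: eqVneq => // <-; rewrite lt0n.
  by rewrite mdeg1 add1n => <-.
Qed.

Lemma homog0_mderiv p i : homog 0 p -> mderiv i p = 0.
Proof.
move: p; apply: homog_ind => [|p q ep eq|c m /eqP].
- by rewrite mderiv0.
- by rewrite mderivD ep eq addr0.
- by rewrite mdeg_eq0 => /eqP ->; rewrite mderivZ mderivX mnm0E scale0r scaler0.
Qed.

Lemma homogX i : homog 1 (Xv i).
Proof. by rewrite /homog dhomogX; apply/eqP; exact: mdeg1. Qed.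

Lemma homogM h h' p q : homog h p -> homog h' q -> homog (h + h') (p * q).
Proof. exact: dhomogM. Qed.

Lemma homogD h p q : homog h p -> homog h q -> homog h (p + q).
Proof. exact: dhomogD. Qed.

Lemma homogZ h c p : homog h p -> homog h (c *: p).
Proof. exact: dhomogZ. Qed.

Lemma homogB h p q : homog h p -> homog h q -> homog h (p - q).
Proof. by move=> hp hq; apply: homogD => //; rewrite /homog dhomogN. Qed.

Lemma homog_sum h (J : Type) (r : seq J) (f : J -> P) :
  (forall l, homog h (f l)) -> homog h (\sum_(l <- r) f l).
Proof. by move=> hf; elim/big_ind: _ => //; [exact: dhomog0|exact: homogD]. Qed.

Lemma homog_normsq : homog 2 normsq.
Proof. by apply: homog_sum => i; exact: (homogM (homogX i) (homogX i)). Qed.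

Lemma laplaceM p q : laplace (p * q) =
  laplace p * q + p * laplace q + 2%:R * \sum_i mderiv i p * mderiv i q.
Proof.
rewrite /laplace mulr_suml mulr_sumr mulr_sumr -!big_split/=; apply: eq_bigr => i _.
by rewrite !(mderivM, mderivD); ring.
Qed.

Lemma laplaceX i : laplace (Xv i) = 0.
Proof. by rewrite /laplace big1// => k _; rewrite mderivXU -[_%:R]mpolyC_nat mderivC. Qed.

Lemma sum_deltaM i (f : 'I_n.+1 -> P) : \sum_k (k == i)%:R * f k = f i.
Proof.
rewrite (bigD1 i)//= eqxx mul1r big1 ?addr0// => k /negbTE ->.
by rewrite mul0r.
Qed.

Lemma laplaceXM i p : laplace (Xv i * p) = Xv i * laplace p + 2%:R * mderiv i p.
Proof.
rewrite laplaceM laplaceX mul0r add0r; congr (_ + _ * _).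
under eq_bigr do rewrite mderivXU; exact: sum_deltaM.
Qed.

Lemma mderiv_normsq i : mderiv i normsq = 2%:R * Xv i.
Proof.
rewrite /normsq linear_sum/=.
transitivity (\sum_k ((k == i)%:R * (2%:R * Xv k) : P)); last exact: sum_deltaM.
by apply: eq_bigr => k _; rewrite mderivM mderivXU eq_sym; ring.
Qed.

Lemma laplace_normsq : laplace normsq = (2 * n.+1)%:R.
Proof.
rewrite /laplace (eq_bigr (fun=> 2%:R)); last first.
  move=> i _; rewrite mderiv_normsq -mpolyC_nat mderiv_mulC mderivXU eqxx mulr1.
  by rewrite mpolyC_nat.
by rewrite sumr_const card_ord natrM mulr_natr.
Qed.

Lemma laplace_normsqM p : laplace (normsq * p) =
  normsq * laplace p + 4%:R * euler p + (2 * n.+1)%:R * p.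
Proof.
rewrite laplaceM laplace_normsq /euler.
have -> : \sum_i mderiv i normsq * mderiv i p = 2%:R * \sum_i Xv i * mderiv i p.
  by rewrite mulr_sumr; apply: eq_bigr => i _; rewrite mderiv_normsq mulrA.
ring.
Qed.

Lemma laplace_mderiv p i : laplace (mderiv i p) = mderiv i (laplace p).
Proof.
rewrite /laplace linear_sum/=; apply: eq_bigr => k _.
by rewrite [mderiv k (mderiv i p)]mderiv_comm mderiv_comm.
Qed.

Lemma laplace_prot i j p : laplace (prot i j p) = prot i j (laplace p).
Proof.
rewrite /prot linearB/= !laplaceXM !laplace_mderiv [mderiv j (mderiv i p)]mderiv_comm.
ring.
Qed.

Lemma homog_prot h i j p : homog h p -> homog h (prot i j p).
Proof.
case: h => [|h] hp.
  by rewrite /prot !homog0_mderiv// !mulr0 subrr; exact: dhomog0.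
rewrite /prot; apply: homogB; rewrite -add1n; apply: homogM;
  by [exact: homogX|exact: (homog_mderiv _ hp)].
Qed.

Lemma harmonic_prot h i j p : harmonic_homog h p -> harmonic_homog h (prot i j p).
Proof.
move=> [hp lp]; split; first exact: homog_prot.
by rewrite -/(laplace _) laplace_prot /laplace lp /prot !mderiv0 !mulr0 subrr.
Qed.

Lemma harmonic0 h : harmonic_homog h (0 : P).
Proof.
split; first exact: dhomog0.
by rewrite -/(laplace _) linear0.
Qed.

Lemma harmonicD h p q : harmonic_homog h p -> harmonic_homog h q -> harmonic_homog h (p + q).
Proof.
move=> [hp lp] [hq lq]; split; first exact: homogD.
by rewrite -/(laplace _) linearD/= /laplace lp lq addr0.
Qed.

Lemma harmonicZ h c p : harmonic_homog h p -> harmonic_homog h (c *: p).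
Proof.
move=> [hp lp]; split; first exact: homogZ.
by rewrite -/(laplace _) linearZ/= /laplace lp scaler0.
Qed.

Lemma harmonicB h p q : harmonic_homog h p -> harmonic_homog h q -> harmonic_homog h (p - q).
Proof.
by move=> hp hq; apply: harmonicD => //; rewrite -scaleN1r; exact: harmonicZ.
Qed.

Lemma harmonic_mderiv h p i : harmonic_homog h p -> harmonic_homog h.-1 (mderiv i p).
Proof.
move=> [hp lp]; split; first exact: homog_mderiv.
by rewrite -/(laplace _) laplace_mderiv /laplace lp mderiv0.
Qed.

(** On the sphere, [lower h i p] and [raise h i p] are the components of
    [x_i p], for [p] harmonic of degree [h], in degrees [h - 1] and [h + 1].  The
    constant is the one that makes [raise] harmonic. *)
Definition lower h i p : P := (2 * h%:R + n%:R - 1 : R)^-1 *: mderiv i p.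
Definition raise h i p : P := Xv i * p - normsq * lower h i p.

Lemma harmonic_lower h p i : harmonic_homog h p -> harmonic_homog h.-1 (lower h i p).
Proof. by move=> hp; apply/harmonicZ/harmonic_mderiv. Qed.

Lemma lower0 p i : harmonic_homog 0 p -> lower 0 i p = 0.
Proof. by move=> [hp _]; rewrite /lower homog0_mderiv// scaler0. Qed.

Lemma lower_den_gt0 h : 0 < 2 * h.+1%:R + n%:R - 1 :> R.
Proof.
rewrite -natr1; have : 0 <= h%:R :> R by [].
by have : 0 <= n%:R :> R by []; lra.
Qed.

Lemma natM h p : h%:R * p = h%:R *: p.
Proof. by rewrite scaler_nat mulr_natl. Qed.

(** The Laplacians of [x_i p] and [|x|^2 d_i p] are [2 d_i p] and
    [(4 (h - 1) + 2 (n + 1)) d_i p]; the constant in [lower] balances them. *)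
Lemma harmonic_raise h p i : harmonic_homog h p -> harmonic_homog h.+1 (raise h i p).
Proof.
move=> hp; have [hhp lp] := hp; split.
  apply: homogB; first by rewrite -add1n; apply: homogM => //; exact: homogX.
  case: h hp hhp => [|h] hp hhp; first by rewrite lower0// mulr0; exact: dhomog0.
  by rewrite -[h.+2]/(2 + h)%N; apply: homogM; [exact: homog_normsq|case: (harmonic_lower i hp)].
rewrite -/(laplace _) /raise linearB/= laplaceXM laplace_normsqM.
have [hl ll] := harmonic_lower i hp; rewrite (homog_euler hl) /laplace lp ll !mulr0 !add0r.
case: h {hl} hp hhp ll => [|h] hp hhp ll.
  by rewrite (homog0_mderiv _ hhp) lower0// scaler0 !mulr0 addr0 subrr.
have d0 := lower_den_gt0 h.
rewrite /lower !natM !scalerA -scalerDl -scalerBl [X in X *: _](_ : _ = 0) ?scale0r//.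
by rewrite natrM -!natr1; move: d0; rewrite -natr1 => d0; field; rewrite gt_eqF.
Qed.

Lemma raise_lower h p i : Xv i * p = raise h i p + normsq * lower h i p.
Proof. by rewrite /raise subrK. Qed.

(** The sum of the squares of the rotations is the Laplacian without its radial
    part, counted twice since every plane occurs in two orders; Euler's identity
    evaluates the radial part. *)
Lemma casimir h p : harmonic_homog h p ->
  \sum_i \sum_j prot i j (prot i j p) = (- (2 * (h * (h + n - 1)))%N%:R) *: p.
Proof.
move=> [hp lp].
have E1 : \sum_i Xv i * mderiv i p = h%:R *: p := homog_euler hp.
have E2 i : \sum_j Xv j * mderiv j (mderiv i p) = h.-1%:R *: mderiv i p.
  exact: (homog_euler (homog_mderiv i hp)).
have s1 i j : prot i j (prot i j p) =
   ((j == i)%:R * (Xv j * mderiv j p) + Xv i * Xv i * mderiv j (mderiv j p)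
   - Xv i * mderiv i p - Xv j * mderiv j p)
   - Xv i * (Xv j * mderiv j (mderiv i p)) - Xv i * (Xv j * mderiv j (mderiv i p))
   + ((j == i)%:R * (Xv j * mderiv j p) + Xv j * Xv j * mderiv i (mderiv i p)).
  rewrite /prot !(mderivB, mderivM) !mderivXU !eqxx [i == j]eq_sym.
  rewrite [mderiv i (mderiv j p)]mderiv_comm.
  case: eqVneq => [->|_]/=; ring.
under eq_bigr => i _ do under eq_bigr => j _ do rewrite s1.
under eq_bigr => i _.
  rewrite !(big_split, sumrB) /= !sumrN !sum_deltaM -!mulr_sumr -mulr_suml.
  rewrite E1 E2 -/(normsq) [\sum_i0 mderiv i0 _]lp mulr0 addr0 sumr_const card_ord.
  over.
rewrite /=.
transitivity (\sum_i ((2 - n.+1%:R - 2 * h.-1%:R) *: (Xv i * mderiv i p) - h%:R *: p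
    + normsq * mderiv i (mderiv i p))).
  apply: eq_bigr => i _.
  rewrite -scaler_nat -!scalerAr !scalerBl !scalerDl !scale1r -scalerA.
  by rewrite [2 *: (_ *: _)]scaler_nat !mulr2n; ring.
rewrite !big_split/= sumrN -scaler_sumr E1 -mulr_sumr [\sum_i0 mderiv i0 _]lp mulr0 addr0.
have -> : \sum_(i < n.+1) h%:R *: p = n.+1%:R *: (h%:R *: p).
  by rewrite sumr_const card_ord [RHS]scaler_nat.
rewrite !scalerA -scalerBl; congr (_ *: _).
case: (h) => [|k]; first by rewrite mul0n !mulr0 subr0 oppr0.
have -> : (k.+1 + n - 1 = k + n)%N by rewrite addSn subn1.
by rewrite !natrM natrD /= -!natr1; ring.
Qed.

End HarmonicPolynomials.

(** * Smooth functions and Green's formula *)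

Section CkCalculus.
Variables (R : realType) (n : nat) (U : set 'rV[R]_n.+1).
Hypothesis oU : open U.
Implicit Types (F G : 'rV[R]_n.+1 -> R) (x : 'rV[R]_n.+1) (i j : 'I_n.+1) (k : nat).
Local Notation e_ i := (delta_mx 0 i : 'rV[R]_n.+1).

Lemma Ck_continuous k F x : Ck k U F -> U x -> {for x, continuous F}.
Proof. by case: k => [|k] [H _]; exact: H. Qed.

Lemma Ck_derivable k F x i : Ck k.+1 U F -> U x -> derivable F x (e_ i).
Proof. by move=> [_ /(_ i)[H _]]; exact: H. Qed.

Lemma Ck_pd k F i : Ck k.+1 U F -> Ck k U (pd i F).
Proof. by move=> [_ /(_ i)[]]. Qed.

Lemma CkS_intro k F :
  (forall x, U x -> {for x, continuous F}) ->
  (forall i x, U x -> derivable F x (e_ i)) ->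
  (forall i, Ck k U (pd i F)) -> Ck k.+1 U F.
Proof. by move=> H1 H2 H3; split=> // i; split; [exact: H2|exact: H3]. Qed.

Lemma near_U x : U x -> \forall z \near x, U z.
Proof. by move=> Ux; exact: open_nbhs_nbhs. Qed.

Lemma near_eqU F G x : (forall x, U x -> F x = G x) -> U x -> \forall z \near x, F z = G z.
Proof. by move=> FG Ux; apply: filterS (near_U Ux) => z; exact: FG. Qed.

Lemma Ck_ext k F G : (forall x, U x -> F x = G x) -> Ck k U F -> Ck k U G.
Proof.
elim: k F G => [|k IH] F G FG CF.
  split=> // x Ux; apply: near_eq_continuous (near_eqU FG Ux) _.
  exact: Ck_continuous CF Ux.
apply: CkS_intro.
- move=> x Ux; apply: near_eq_continuous (near_eqU FG Ux) _.
  exact: Ck_continuous CF Ux.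
- move=> i x Ux; apply: near_eq_derivable (near_eqU FG Ux) _.
  exact: Ck_derivable CF Ux.
- move=> i; apply: IH (Ck_pd i CF) => x Ux.
  exact/near_eq_derive/near_eqU.
Qed.

Lemma CkW k F : Ck k.+1 U F -> Ck k U F.
Proof.
elim: k F => [|k IH] F CF.
  by split=> // x; exact: Ck_continuous CF.
apply: CkS_intro => [x|i x|i].
- exact: Ck_continuous CF.
- exact: Ck_derivable CF.
- exact/IH/Ck_pd.
Qed.

Lemma CkD k F G : Ck k U F -> Ck k U G -> Ck k U (fun x => F x + G x).
Proof.
elim: k F G => [|k IH] F G CF CG.
  split=> // x Ux; apply: (@continuousD R R _ F G); [exact: Ck_continuous CF Ux|exact: Ck_continuous CG Ux].
apply: CkS_intro => [x Ux|i x Ux|i].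
- by apply: (@continuousD R R _ F G); [exact: Ck_continuous CF Ux|exact: Ck_continuous CG Ux].
- by apply: derivableD; [exact: Ck_derivable CF Ux|exact: Ck_derivable CG Ux].
apply: Ck_ext (IH _ _ (Ck_pd i CF) (Ck_pd i CG)) => x Ux.
by rewrite /pd -deriveD//; [exact: Ck_derivable CF Ux|exact: Ck_derivable CG Ux].
Qed.

Lemma CkM k F G : Ck k U F -> Ck k U G -> Ck k U (fun x => F x * G x).
Proof.
elim: k F G => [|k IH] F G CF CG.
  split=> // x Ux; apply: (@continuousM R _ F G); [exact: Ck_continuous CF Ux|exact: Ck_continuous CG Ux].
apply: CkS_intro => [x Ux|i x Ux|i].
- by apply: (@continuousM R _ F G); [exact: Ck_continuous CF Ux|exact: Ck_continuous CG Ux].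
- by apply: derivableM; [exact: Ck_derivable CF Ux|exact: Ck_derivable CG Ux].
apply: (@Ck_ext _ (fun x => pd i F x * G x + F x * pd i G x)) => [x Ux|].
  by rewrite -(pdM (Ck_derivable CF Ux) (Ck_derivable CG Ux)).
apply: CkD; apply: IH; [exact: Ck_pd|exact: CkW|exact: CkW|exact: Ck_pd].
Qed.

Lemma Ck_cst k c : Ck k U (fun=> c).
Proof.
elim: k c => [|k IH] c; first by split=> // x _; exact: cst_continuous.
apply: CkS_intro => [x _|i x _|i]; [exact: cst_continuous|exact: derivable_cst|].
by apply: Ck_ext (IH 0) => x _; rewrite /pd derive_cst.
Qed.

Lemma Ck_coord k j : Ck k U (fun x => x 0 j).
Proof.
case: k => [|k]; first by split=> // x _; exact: coord_continuous.
apply: CkS_intro => [x _|i x _|i]; first exact: coord_continuous.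
  by case: (is_derive_coord i j x).
apply: Ck_ext (Ck_cst k (i == j)%:R) => x _.
by have := is_derive_coord i j x => dd; rewrite /pd derive_val.
Qed.

Definition smooth_on F := forall k, Ck k U F.

Lemma smooth_on_ext F G : (forall x, U x -> F x = G x) -> smooth_on F -> smooth_on G.
Proof. by move=> FG SF k; exact: Ck_ext (SF k). Qed.

Lemma smooth_on_pd F i : smooth_on F -> smooth_on (pd i F).
Proof. by move=> SF k; exact/Ck_pd. Qed.

Lemma smooth_onD F G : smooth_on F -> smooth_on G -> smooth_on (fun x => F x + G x).
Proof. by move=> SF SG k; exact: CkD. Qed.

Lemma smooth_onM F G : smooth_on F -> smooth_on G -> smooth_on (fun x => F x * G x).
Proof. by move=> SF SG k; exact: CkM. Qed.

Lemma smooth_on_cst c : smooth_on (fun=> c).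
Proof. by move=> k; exact: Ck_cst. Qed.

Lemma smooth_on_coord j : smooth_on (fun x => x 0 j).
Proof. by move=> k; exact: Ck_coord. Qed.

Lemma smooth_onZ c F : smooth_on F -> smooth_on (fun x => c * F x).
Proof. exact/smooth_onM/smooth_on_cst. Qed.

Lemma smooth_onB F G : smooth_on F -> smooth_on G -> smooth_on (fun x => F x - G x).
Proof.
move=> SF SG; apply: (@smooth_on_ext (fun x => F x + (-1) * G x)) => [x _|]; first by rewrite mulN1r.
by apply: smooth_onD => //; exact: smooth_onZ.
Qed.

Lemma smooth_on_sum (J : Type) (r : seq J) (f : J -> 'rV[R]_n.+1 -> R) :
  (forall l, smooth_on (f l)) -> smooth_on (fun x => \sum_(l <- r) f l x).
Proof.
move=> Sf; elim: r => [|l r IH].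
  by apply: smooth_on_ext (smooth_on_cst 0) => x _; rewrite big_nil.
by apply: (smooth_on_ext _ (smooth_onD (Sf l) IH)) => x _; rewrite big_cons.
Qed.

Lemma smooth_on_rot i j F : smooth_on F -> smooth_on (rot i j F).
Proof.
by move=> SF; apply: smooth_onB; apply: smooth_onM;
  [exact: smooth_on_coord|exact: smooth_on_pd|exact: smooth_on_coord|exact: smooth_on_pd].
Qed.

Lemma smooth_on_derivable F x i : smooth_on F -> U x -> derivable F x (e_ i).
Proof. by move=> SF Ux; apply: (@Ck_derivable 0 F x i) => //; exact: SF. Qed.

Lemma smooth_on_C1_at F x : smooth_on F -> U x -> C1_at F x.
Proof.
move=> SF Ux i; split.
  by apply: filterS (near_U Ux) => z; exact: smooth_on_derivable.
exact: (Ck_continuous (smooth_on_pd i SF 0%N)).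
Qed.

Hypothesis SU : forall x, on_sphere x -> U x.

Lemma smooth_on_C1_sphere F : smooth_on F -> C1_sphere F.
Proof. by move=> SF x xS; apply: smooth_on_C1_at => //; exact: SU. Qed.

Lemma smooth_on_cont_sphere F : smooth_on F -> cont_sphere F.
Proof. by move=> /smooth_on_C1_sphere/C1_sphere_cont_sphere. Qed.

Lemma rotM i j F G x : smooth_on F -> smooth_on G -> U x ->
  rot i j (fun x => F x * G x) x = rot i j F x * G x + F x * rot i j G x.
Proof.
move=> SF SG Ux; rewrite /rot.
have E l : pd l (fun x => F x * G x) x = pd l F x * G x + F x * pd l G x.
  by rewrite -(pdM (smooth_on_derivable SF Ux) (smooth_on_derivable SG Ux)).
rewrite !E; ring.
Qed.

(** Rotations are derivations whose values integrate to zero. *)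
Lemma sphere_integral_rot_parts i j F G : smooth_on F -> smooth_on G ->
  sphere_integral (fun x => rot i j F x * G x) =
  - sphere_integral (fun x => F x * rot i j G x).
Proof.
move=> SF SG; apply/eqP; rewrite -addr_eq0 -sphere_integralD; last 2 first.
- exact/smooth_on_cont_sphere/smooth_onM/SG/smooth_on_rot.
- exact/smooth_on_cont_sphere/smooth_onM/smooth_on_rot.
rewrite -[X in _ == X](sphere_integral_rot i j (smooth_on_C1_sphere (smooth_onM SF SG))); apply/eqP.
by apply: eq_sphere_integral => x xS; rewrite rotM//; exact: SU.
Qed.

End CkCalculus.

Section PolynomialFunctions.
Variables (R : realType) (n : nat).
Local Notation P := (mpolyType R n.+1).
Local Notation Xv i := (@mpolyX n.+1 R (mnm1 i)).
Local Notation e_ i := (delta_mx 0 i : 'rV[R]_n.+1).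
Local Notation I := sphere_integral.
Implicit Types (p q Y : mpolyType R n.+1) (i j k : 'I_n.+1) (h : nat) (x : 'rV[R]_n.+1).

Definition peval p x : R := meval (fun i => x 0 i) p.

Lemma pevalD p q x : peval (p + q) x = peval p x + peval q x. Proof. exact: mevalD. Qed.
Lemma pevalB p q x : peval (p - q) x = peval p x - peval q x. Proof. exact: mevalB. Qed.
Lemma pevalM p q x : peval (p * q) x = peval p x * peval q x. Proof. exact: mevalM. Qed.
Lemma pevalZ c p x : peval (c *: p) x = c * peval p x. Proof. exact: mevalZ. Qed.
Lemma pevalX i x : peval (Xv i) x = x 0 i. Proof. exact: mevalXU. Qed.
Lemma peval0 x : peval 0 x = 0. Proof. exact: meval0. Qed.
Lemma peval1 x : peval 1 x = 1. Proof. exact: meval1. Qed.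

Lemma peval_sum (J : Type) (r : seq J) (f : J -> P) x :
  peval (\sum_(l <- r) f l) x = \sum_(l <- r) peval (f l) x.
Proof. by elim/big_rec2: _ => [|l a b _ <-]; [exact: peval0|rewrite pevalD]. Qed.

Lemma mpoly_closed_ind (Q : P -> Prop) :
  (forall c, Q (mpolyC n.+1 c)) -> (forall i, Q (Xv i)) ->
  (forall p q, Q p -> Q q -> Q (p + q)) -> (forall p q, Q p -> Q q -> Q (p * q)) ->
  forall p, Q p.
Proof.
move=> QC QX QD QM; apply: mpolyind; first by rewrite -mpolyC0.
move=> c m p _ _ Qp; apply: QD => //; rewrite -mul_mpolyC; apply: (QM) => //.
rewrite mpolyXE_id; elim/big_ind: _ => [||i _]; [by rewrite -mpolyC1|exact: QM|].
elim: (m i) => [|d IH]; first by rewrite expr0 -mpolyC1.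
by rewrite exprS; exact: QM.
Qed.

Lemma is_derive_peval p x i : is_derive x (e_ i) (peval p) (peval (mderiv i p) x).
Proof.
move: p; apply: mpoly_closed_ind => [c|j|p q dp dq|p q dp dq].
- rewrite mderivC peval0 (_ : peval _ = cst c); first exact: is_derive_cst.
  by apply/funext => y; exact: mevalC.
- rewrite mderivXU (_ : peval (Xv j) = fun y : 'rV[R]_n.+1 => y 0 j); last first.
    by apply/funext => y; rewrite pevalX.
  have -> : peval (i == j)%:R x = (i == j)%:R by case: (i == j); [exact: peval1|exact: peval0].
  exact: is_derive_coord.
- rewrite mderivD pevalD (_ : peval (p + q) = peval p \+ peval q); last first.
    by apply/funext => y; rewrite pevalD.
  exact: is_deriveD.
- rewrite mderivM pevalD !pevalM (_ : peval (p * q) = peval p \* peval q); last first.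
    by apply/funext => y; rewrite pevalM.
  have [dp1 dp2] := dp; have [dq1 dq2] := dq.
  split; first exact: derivableM.
  by rewrite -[LHS]/(pd i (peval p \* peval q) x) pdM// /pd dp2 dq2.
Qed.

Lemma pd_peval i p : pd i (peval p) = peval (mderiv i p).
Proof. by apply/funext => x; case: (is_derive_peval p x i). Qed.

Lemma continuous_peval p : continuous (peval p).
Proof.
move: p; apply: mpoly_closed_ind => [c|j|p q dp dq|p q dp dq] x.
- rewrite (_ : peval _ = cst c); first exact: cst_continuous.
  by apply/funext => y; exact: mevalC.
- rewrite (_ : peval (Xv j) = fun y : 'rV[R]_n.+1 => y 0 j); first exact: coord_continuous.
  by apply/funext => y; rewrite pevalX.
- rewrite (_ : peval (p + q) = peval p \+ peval q); last first.
    by apply/funext => y; rewrite pevalD.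
  by apply: continuousD; [exact: dp|exact: dq].
- rewrite (_ : peval (p * q) = peval p \* peval q); last first.
    by apply/funext => y; rewrite pevalM.
  by apply: continuousM; [exact: dp|exact: dq].
Qed.

Lemma smooth_on_peval (U : set 'rV[R]_n.+1) p : smooth_on U (peval p).
Proof.
move=> k; elim: k p => [|k IH] p; first by split=> // x _; exact: continuous_peval.
apply: CkS_intro => [x _|i x _|i]; first exact: continuous_peval.
  by case: (is_derive_peval p x i).
by rewrite pd_peval; exact: IH.
Qed.

Lemma cont_sphere_peval p : cont_sphere (peval p).
Proof. by move=> x _; exact: continuous_peval. Qed.

Lemma rot_peval i j p : rot i j (peval p) = peval (prot i j p).
Proof. by apply/funext => x; rewrite /rot !pd_peval pevalB !pevalM !pevalX. Qed.

Lemma peval_normsq x : on_sphere x -> peval (normsq R n) x = 1.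
Proof.
move=> /eqP <-; rewrite peval_sum; apply: eq_bigr => i _.
by rewrite pevalM pevalX expr2.
Qed.

(** The operator [-Delta] of the sphere; the factor 1/2 because every plane
    occurs in two orders. *)
Definition sphere_lap (F : 'rV[R]_n.+1 -> R) (x : 'rV[R]_n.+1) : R :=
  - (2^-1 * \sum_i \sum_j rot i j (rot i j F) x).

(** The eigenvalue of [sphere_lap] in degree [h]; where the subtraction
    truncates, the factor [h] is 0. *)
Definition eigen h : R := (h * (h + n - 1))%N%:R.

Section Green.
Variables (U : set 'rV[R]_n.+1).
Hypotheses (oU : open U) (SU : forall x, on_sphere x -> U x).

Lemma smooth_on_sphere_lap F : smooth_on U F -> smooth_on U (sphere_lap F).
Proof.
move=> SF; apply: (@smooth_on_ext _ _ U oU (fun x => (- 2^-1) * \sum_i \sum_j rot i j (rot i j F) x)).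
  by move=> x _; rewrite mulNr.
apply: smooth_onZ => //; apply: smooth_on_sum => // i; apply: smooth_on_sum => // j.
by apply: smooth_on_rot => //; exact: smooth_on_rot.
Qed.

(** Two integrations by parts move each squared rotation to the polynomial,
    where [casimir] evaluates their sum. *)
Lemma green_harmonic F h Y : smooth_on U F -> harmonic_homog h Y ->
  I (fun x => sphere_lap F x * peval Y x) = eigen h * I (fun x => F x * peval Y x).
Proof.
move=> SF HY.
have SY q : smooth_on U (peval q) by exact: smooth_on_peval.
have SFY : smooth_on U (fun x => F x * peval Y x) by exact: smooth_onM.
have E i j : I (fun x => rot i j (rot i j F) x * peval Y x) =
             I (fun x => F x * peval (prot i j (prot i j Y)) x).
  rewrite (sphere_integral_rot_parts oU SU)//; last exact: smooth_on_rot.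
  by rewrite rot_peval (sphere_integral_rot_parts oU SU)// opprK rot_peval.
transitivity (- (2^-1 * \sum_i \sum_j I (fun x => rot i j (rot i j F) x * peval Y x))).
  have c i j : cont_sphere (fun x => rot i j (rot i j F) x * peval Y x).
    by apply/(smooth_on_cont_sphere oU SU)/smooth_onM => //; apply: smooth_on_rot => //; exact: smooth_on_rot.
  under [in RHS]eq_bigr => i _ do rewrite -sphere_integral_sum//.
  rewrite -sphere_integral_sum; last by move=> i; exact: cont_sphere_sum.
  rewrite -sphere_integralZ; last by apply: cont_sphere_sum => i; exact: cont_sphere_sum.
  rewrite -sphere_integralN; last by apply: cont_sphereZ; apply: cont_sphere_sum => i; exact: cont_sphere_sum.
  apply: eq_sphere_integral => x _; rewrite /sphere_lap mulNr -mulrA mulr_suml.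
  by congr (- (_ * _)); apply: eq_bigr => i _; rewrite mulr_suml.
have cc q : cont_sphere (fun x => F x * peval q x).
  by apply/(smooth_on_cont_sphere oU SU)/smooth_onM.
under eq_bigr => i _ do under eq_bigr => j _ do rewrite E.
under eq_bigr => i _ do rewrite -sphere_integral_sum//.
rewrite -sphere_integral_sum; last by move=> i; exact: cont_sphere_sum.
rewrite -[2^-1 * _]sphere_integralZ; last by apply: cont_sphere_sum => i; exact: cont_sphere_sum.
rewrite -sphere_integralN; last by apply: cont_sphereZ; apply: cont_sphere_sum => i; exact: cont_sphere_sum.
rewrite -sphere_integralZ//; apply: eq_sphere_integral => x _.
under eq_bigr => i _ do rewrite -mulr_sumr -peval_sum.
rewrite -mulr_sumr -peval_sum (casimir HY) pevalZ /eigen natrM; by field.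
Qed.

End Green.

End PolynomialFunctions.

(** * Spherical harmonics and their sup norm *)

Section InnerProduct.
Variables (R : realType) (n : nat).
Local Notation P := (mpolyType R n.+1).
Local Notation Xv i := (@mpolyX n.+1 R (mnm1 i)).
Local Notation I := sphere_integral.
Implicit Types (p q Y Z a b : mpolyType R n.+1) (i j : 'I_n.+1) (h : nat) (x : 'rV[R]_n.+1).

(** Only semidefinite on polynomials: [normsq - 1] vanishes on the sphere. *)
Definition pdot p q : R := I (fun x => peval p x * peval q x).

Lemma cont_sphere_pevalM p q : cont_sphere (fun x => peval p x * peval q x).
Proof. by apply: cont_sphereM; exact: cont_sphere_peval. Qed.

Lemma pdotC p q : pdot p q = pdot q p.
Proof. by apply: eq_sphere_integral => x _; rewrite mulrC. Qed.

Lemma eq_pdot p q r : (forall x, on_sphere x -> peval p x = peval q x) -> pdot p r = pdot q r.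
Proof. by move=> pq; apply: eq_sphere_integral => x xS; rewrite pq. Qed.

Lemma pdotDl p q r : pdot (p + q) r = pdot p r + pdot q r.
Proof.
rewrite -sphere_integralD; [|exact: cont_sphere_pevalM..].
by apply: eq_sphere_integral => x _; rewrite pevalD mulrDl.
Qed.

Lemma pdotZl c p r : pdot (c *: p) r = c * pdot p r.
Proof.
rewrite -sphere_integralZ; last exact: cont_sphere_pevalM.
by apply: eq_sphere_integral => x _; rewrite pevalZ mulrA.
Qed.

Lemma pdotBl p q r : pdot (p - q) r = pdot p r - pdot q r.
Proof. by rewrite -scaleN1r pdotDl pdotZl mulN1r. Qed.

Lemma pdot0l r : pdot 0 r = 0.
Proof. by rewrite -(scale0r 0) pdotZl mul0r. Qed.

Lemma pdot_suml (J : Type) (s : seq J) (f : J -> P) r :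
  pdot (\sum_(l <- s) f l) r = \sum_(l <- s) pdot (f l) r.
Proof. by elim/big_rec2: _ => [|l u v _ <-]; [exact: pdot0l|rewrite pdotDl]. Qed.

Lemma pdot_ge0 p : 0 <= pdot p p.
Proof.
apply: sphere_integral_ge0; first exact: cont_sphere_pevalM.
by move=> x _; rewrite -expr2 sqr_ge0.
Qed.

Lemma pdot_eq0 p : pdot p p = 0 -> forall x, on_sphere x -> peval p x = 0.
Proof.
move=> p0 x xS; apply/eqP; rewrite -sqrf_eq0 expr2; apply/eqP.
apply: (@sphere_integral_eq0 _ _ (fun x => peval p x * peval p x)) => // [|y _].
  exact: cont_sphere_pevalM.
by rewrite -expr2 sqr_ge0.
Qed.

Lemma pdot_prot i j p q : pdot (prot i j p) q = - pdot p (prot i j q).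
Proof.
have := @sphere_integral_rot_parts R n setT openT (fun _ _ => Logic.I) i j (peval p) (peval q).
by rewrite !rot_peval; apply; exact: smooth_on_peval.
Qed.

Lemma sphere_lap_harmonic h Y : harmonic_homog h Y ->
  forall x, sphere_lap (peval Y) x = eigen R n h * peval Y x.
Proof.
move=> HY x; rewrite /sphere_lap.
under eq_bigr => i _ do under eq_bigr => j _ do rewrite !rot_peval.
under eq_bigr => i _ do rewrite -peval_sum.
by rewrite -peval_sum (casimir HY) pevalZ /eigen natrM; field.
Qed.

Lemma eigen_inj h h' : (0 < n)%N -> eigen R n h = eigen R n h' -> h = h'.
Proof.
move=> n0 /eqP; rewrite eqr_nat => /eqP.
by case: n n0 => // k _; rewrite -!addnBA// !subn1 /=; nia.
Qed.

Lemma eigen_gt0 h : (0 < n)%N -> (0 < h)%N -> 0 < eigen R n h.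
Proof.
by move=> n0 h0; rewrite ltr0n; case: n n0 => // k _; rewrite -!addnBA// !subn1 /=; nia.
Qed.

(** Eigenvectors of a symmetric operator for distinct eigenvalues. *)
Lemma harmonic_orthogonal h h' Y Z : (0 < n)%N -> h != h' ->
  harmonic_homog h Y -> harmonic_homog h' Z -> pdot Y Z = 0.
Proof.
move=> n0 hh' HY HZ.
have := @green_harmonic R n setT openT (fun _ _ => Logic.I) (peval Y) h' Z (@smooth_on_peval _ _ _ Y) HZ.
have -> : I (fun x => sphere_lap (peval Y) x * peval Z x) = eigen R n h * pdot Y Z.
  rewrite -sphere_integralZ; last exact: cont_sphere_pevalM.
  by apply: eq_sphere_integral => x _; rewrite (sphere_lap_harmonic HY) mulrA.
move=> /eqP; rewrite -/(pdot Y Z) -subr_eq0 -mulrBl mulf_eq0 subr_eq0.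
case/orP => [/eqP/(eigen_inj n0) e|/eqP//].
by rewrite e eqxx in hh'.
Qed.

Fixpoint orthonormal_seq (e : seq P) : Prop :=
  if e is a :: e' then
    [/\ pdot a a = 1, (forall b, b \in e' -> pdot a b = 0) & orthonormal_seq e']
  else True.

Lemma orthonormal_norm e a : orthonormal_seq e -> a \in e -> pdot a a = 1.
Proof.
elim: e => //= b e IH [bb _ oe]; rewrite inE => /predU1P[->//|].
exact: IH.
Qed.

Lemma orthonormal_coef e (c : P -> R) b : orthonormal_seq e -> b \in e ->
  \sum_(a <- e) c a * pdot a b = c b.
Proof.
elim: e => //= a e IH [aa ae oe]; rewrite inE big_cons => /predU1P[->|be].
  rewrite aa mulr1 big_seq big1 ?addr0// => d de.
  by rewrite pdotC ae// mulr0.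
by rewrite ae// mulr0 add0r IH.
Qed.

(** As [pdot] is degenerate, the vectors of [s] are recovered as functions on the
    sphere only; a vector whose orthogonal part has norm 0 adds nothing. *)
Lemma gram_schmidt (S : P -> Prop) (s : seq P) :
  S 0 -> (forall p q, S p -> S q -> S (p + q)) -> (forall c p, S p -> S (c *: p)) ->
  (forall v, v \in s -> S v) ->
  exists e : seq P, [/\ orthonormal_seq e, (size e <= size s)%N, (forall a, a \in e -> S a) &
    forall v, v \in s -> forall x, on_sphere x ->
      peval v x = \sum_(a <- e) pdot v a * peval a x].
Proof.
move=> S0 SD SZ; elim: s => [_|v s IH Ss]; first by exists [::].
have [|e [oe se eS es]] := IH; first by move=> w ws; apply: Ss; rewrite inE ws orbT.
pose w := \sum_(a <- e) pdot v a *: a; pose v' := v - w.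
have Sw : S w.
  rewrite /w big_seq; elim/big_ind: _ => // a ae; exact/SZ/eS.
have Sv' : S v'.
  by apply: SD; [apply: Ss; rewrite mem_head|rewrite -scaleN1r; exact: SZ].
have orth b : b \in e -> pdot v' b = 0.
  move=> be; rewrite pdotBl pdot_suml.
  under eq_bigr do rewrite pdotZl.
  by rewrite (orthonormal_coef (pdot v))// subrr.
have [v'0|v'n0] := eqVneq (pdot v' v') 0.
  exists e; split=> //; first exact: leqW.
  move=> u; rewrite inE => /predU1P[->|us] x xS; last exact: es.
  have := pdot_eq0 v'0 xS; rewrite pevalB peval_sum => /eqP; rewrite subr_eq0 => /eqP ->.
  by apply: eq_bigr => a _; rewrite pevalZ.
pose c := (Num.sqrt (pdot v' v'))^-1.
have v'gt0 : 0 < pdot v' v' by rewrite lt_neqAle eq_sym v'n0 pdot_ge0.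
have c0 : c != 0 by rewrite invr_eq0 sqrtr_eq0 -ltNge.
have cc : c * c * pdot v' v' = 1.
  by rewrite -invfM -expr2 sqr_sqrtr ?ltW// mulVf.
have cv' b : b \in e -> pdot (c *: v') b = 0 by move=> be; rewrite pdotZl orth// mulr0.
exists (c *: v' :: e); split=> //=.
- split=> //; by rewrite pdotZl pdotC pdotZl mulrA.
- by move=> a; rewrite inE => /predU1P[->|ae]; [exact: SZ|exact: eS].
move=> u uin x xS; rewrite big_cons; move: uin; rewrite inE => /predU1P[->|us].
  have -> : pdot v (c *: v') = c * pdot v' v'.
    rewrite pdotC pdotZl pdotC -{1}(subrK w v) -/v' pdotDl.
    have -> : pdot w v' = 0; last by rewrite addr0.
    rewrite pdot_suml big_seq big1// => a ae.
    by rewrite pdotZl [pdot a v']pdotC orth// mulr0.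
  have e2 (t : R) : c * pdot v' v' * (c * t) = t by rewrite -[RHS]mul1r -cc; ring.
  rewrite pevalZ e2 /v' pevalB peval_sum.
  by under [X in _ - X]eq_bigr do rewrite pevalZ; rewrite subrK.
have -> : pdot u (c *: v') = 0.
  transitivity (\sum_(a <- e) pdot u a * pdot a (c *: v')).
    rewrite -(@eq_pdot (\sum_(a <- e) pdot u a *: a)) ?pdot_suml; last first.
      move=> y yS; rewrite peval_sum (es u us y yS).
      by apply: eq_bigr => a _; rewrite pevalZ.
    by apply: eq_bigr => a _; rewrite pdotZl.
  rewrite big_seq big1// => a ae.
  by rewrite [pdot a _]pdotC cv'// mulr0.
by rewrite mul0r add0r; exact: es.
Qed.

End InnerProduct.

Section HarmonicBasis.
Variables (R : realType) (n h : nat).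
Local Notation P := (mpolyType R n.+1).

Let lap_dhomog_proof (p : dhomog n.+1 R h) :
  homog h.-1.-1 (laplace (mpoly_of_dhomog p)).
Proof.
apply: homog_sum => i; apply/homog_mderiv/homog_mderiv.
exact: dhomog_is_dhomog.
Qed.

(** Restricted to a finite-dimensional space, so that its kernel has a basis. *)
Let lap_dhomog (p : dhomog n.+1 R h) : dhomog n.+1 R h.-1.-1 := DHomog (lap_dhomog_proof p).

Let lap_dhomog_linear : linear lap_dhomog.
Proof. by move=> c p q; apply/val_inj; rewrite /= laplace_linear. Qed.

HB.instance Definition _ := GRing.isLinear.Build R _ _ _ lap_dhomog lap_dhomog_linear.

(** Spanning is stated as an induction principle, which applies to every
    property stable under linear combinations.  The bound on the size is the
    dimension of the space of all homogeneous polynomials. *)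
Lemma harmonic_spanning : exists s : seq P, [/\ (size s <= 'C(h + n, h))%N,
  (forall v, v \in s -> harmonic_homog h v) &
  forall Q : P -> Prop, Q 0 -> (forall p q, Q p -> Q q -> Q (p + q)) ->
    (forall c p, Q p -> Q (c *: p)) -> (forall v, v \in s -> Q v) ->
    forall p, harmonic_homog h p -> Q p].
Proof.
pose K := lker (linfun lap_dhomog).
exists [seq mpoly_of_dhomog b | b <- vbasis K]; split.
- rewrite size_map size_tuple; apply: leq_trans (dimvS (subvf K)) _.
  by rewrite dimvf.
- move=> v /mapP[b bB ->]; split; first exact: dhomog_is_dhomog.
  have : b \in K by apply: vbasis_mem.
  by rewrite memv_ker lfunE => /eqP/(congr1 val).
move=> Q Q0 QD QZ Qs p [hp lp].
pose p' : dhomog n.+1 R h := DHomog hp.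
have pK : p' \in K.
  by rewrite memv_ker lfunE; apply/eqP/val_inj.
have : forall b : dhomog n.+1 R h, b \in vbasis K -> Q (mpoly_of_dhomog b).
  by move=> b bK; apply: (Qs); exact: map_f.
rewrite -[p]/(mpoly_of_dhomog p') (coord_vbasis pK) => Qb.
elim/big_ind: _ => [|u v Qu Qv|i _]; first exact: Q0.
  exact: QD.
by apply: (QZ); apply/Qb/mem_nth; rewrite size_tuple.
Qed.

End HarmonicBasis.

Section Reproducing.
Variables (R : realType) (n : nat).
Local Notation P := (mpolyType R n.+1).
Local Notation Xv i := (@mpolyX n.+1 R (mnm1 i)).
Local Notation I := sphere_integral.
Implicit Types (p q Y Z a b : mpolyType R n.+1) (i j : 'I_n.+1) (h : nat) (x : 'rV[R]_n.+1).

Lemma harmonic_basis h : exists e : seq P, [/\ orthonormal_seq e,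
  (size e <= 'C(h + n, h))%N, (forall a, a \in e -> harmonic_homog h a) &
  forall p, harmonic_homog h p -> forall x, on_sphere x ->
    peval p x = \sum_(a <- e) pdot p a * peval a x].
Proof.
have [s [ss sH sind]] := harmonic_spanning R n h.
have [e [oe se eH es]] := @gram_schmidt R n (harmonic_homog h) s (harmonic0 _ _ h)
  (fun p q => @harmonicD R n h p q) (fun c p => @harmonicZ R n h c p) sH.
exists e; split=> //; first exact: leq_trans ss.
apply: sind => [x xS|p q ep eq x xS|c p ep x xS|v vs]; last exact: es.
- by rewrite peval0 big1// => a _; rewrite pdot0l mul0r.
- rewrite pevalD ep// eq// -big_split; apply: eq_bigr => a _.
  by rewrite pdotDl mulrDl.
- rewrite pevalZ ep// mulr_sumr; apply: eq_bigr => a _.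
  by rewrite pdotZl mulrA.
Qed.

Definition harmonic_sum_on_sphere p := exists s : seq (nat * P),
  (forall d, d \in s -> harmonic_homog d.1 d.2) /\
  forall x, on_sphere x -> peval p x = \sum_(d <- s) peval d.2 x.

Lemma harmonic_sumD p q : harmonic_sum_on_sphere p -> harmonic_sum_on_sphere q ->
  harmonic_sum_on_sphere (p + q).
Proof.
move=> [s [sH sE]] [t [tH tE]]; exists (s ++ t); split.
  by move=> d; rewrite mem_cat => /orP[/sH|/tH].
by move=> x xS; rewrite pevalD sE// tE// big_cat.
Qed.

Lemma harmonic_sumZ c p : harmonic_sum_on_sphere p -> harmonic_sum_on_sphere (c *: p).
Proof.
move=> [s [sH sE]]; exists [seq (d.1, c *: d.2) | d <- s]; split.
  by move=> _ /mapP[d ds ->]; apply/harmonicZ/sH.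
move=> x xS; rewrite pevalZ sE// big_map mulr_sumr.
by apply: eq_bigr => d _; rewrite pevalZ.
Qed.

Lemma harmonic_sumX i p : harmonic_sum_on_sphere p -> harmonic_sum_on_sphere (Xv i * p).
Proof.
move=> [s [sH sE]].
exists ([seq (d.1.+1, raise d.1 i d.2) | d <- s] ++ [seq (d.1.-1, lower d.1 i d.2) | d <- s]).
split.
  move=> d; rewrite mem_cat => /orP[]/mapP[d' /sH d's ->]/=; first exact: harmonic_raise.
  exact: harmonic_lower.
move=> x xS; rewrite big_cat/= !big_map -big_split/= pevalM sE// mulr_sumr.
apply: eq_bigr => d _; rewrite -pevalM (raise_lower d.1) pevalD pevalM.
by rewrite peval_normsq// mul1r.
Qed.

(** By [raise_lower] and [|x|^2 = 1], such sums are stable under multiplication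
    by the variables, which generate all polynomials. *)
Lemma harmonic_decomposition p : harmonic_sum_on_sphere p.
Proof.
suff H : forall q, harmonic_sum_on_sphere q -> harmonic_sum_on_sphere (p * q).
  rewrite -[p]mulr1; apply: H; exists [:: (0%N, 1)]; split; last first.
    by move=> x _; rewrite big_seq1.
  move=> d; rewrite inE => /eqP ->; split.
    by rewrite /=; exact: dhomog1.
  by rewrite big1// => i _; rewrite -mpolyC1 !mderivC.
move: p; apply: mpoly_closed_ind => [c|i|p q Hp Hq|p q Hp Hq] r Hr.
- by rewrite mul_mpolyC; exact: harmonic_sumZ.
- exact: harmonic_sumX.
- by rewrite mulrDl; apply: harmonic_sumD; [exact: Hp|exact: Hq].
- by rewrite -mulrA; apply/Hp/Hq.
Qed.

Lemma homog0_const p : homog 0 p -> forall x y, peval p x = peval p y.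
Proof.
move: p; apply: homog_ind => [|p q Hp Hq|c m /eqP m0] x y.
- by rewrite !peval0.
- by rewrite !pevalD (Hp x y) (Hq x y).
- by move: m0; rewrite mdeg_eq0 => /eqP ->; rewrite mpolyX0 !pevalZ !peval1.
Qed.

Hypothesis n_gt0 : (0 < n)%N.

(** By [casimir] a harmonic of positive degree is a multiple of a sum of
    rotations of rotations, so that it is orthogonal to [p].  Hence [p] agrees
    with its component of degree 0. *)
Lemma rot_invariant_const p :
  (forall i j x, on_sphere x -> peval (prot i j p) x = 0) ->
  exists c, forall x, on_sphere x -> peval p x = c.
Proof.
move=> p0.
have orth h Z : (0 < h)%N -> harmonic_homog h Z -> pdot p Z = 0.
  move=> h0 HZ; have e0 := eigen_gt0 R n_gt0 h0.
  have : \sum_i \sum_j pdot p (prot i j (prot i j Z)) = 0.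
    rewrite big1// => i _; rewrite big1// => j _.
    rewrite pdotC pdot_prot pdotC -(@eq_pdot _ _ 0) ?pdot0l ?oppr0//.
    by move=> x xS; rewrite peval0 p0.
  under eq_bigr => i _ do under eq_bigr => j _ do rewrite pdotC.
  under eq_bigr => i _ do rewrite -pdot_suml.
  rewrite -pdot_suml (casimir HZ) pdotZl => /eqP.
  rewrite mulf_eq0 oppr_eq0 natrM mulf_eq0 pnatr_eq0/= -/(eigen R n h) (gt_eqF e0)/=.
  by rewrite pdotC => /eqP.
have [s [sH sE]] := harmonic_decomposition p.
pose c := \sum_(d <- s | d.1 == 0%N) d.2; pose w := \sum_(d <- s | d.1 != 0%N) d.2.
have Hc : harmonic_homog 0 c.
  rewrite /c big_seq_cond; elim/big_ind: _ => [||d /andP[ds /eqP d0]].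
  - exact: harmonic0.
  - exact: harmonicD.
  - by rewrite -d0; exact: sH.
have pE x : on_sphere x -> peval p x = peval (c + w) x.
  move=> xS; rewrite sE// pevalD /c /w -!(big_filter s) !peval_sum !big_filter.
  by rewrite (bigID (fun d => d.1 == 0%N)).
have ww : pdot w w = 0.
  rewrite {1}/w -big_filter pdot_suml big_filter big_seq_cond big1// => d /andP[ds d0].
  have Hd := sH d ds.
  have -> : pdot d.2 w = pdot (p - c) d.2.
    rewrite pdotC; apply: eq_pdot => x xS.
    by rewrite pevalB pE// pevalD addrAC subrr add0r.
  rewrite pdotBl (orth d.1)// ?lt0n// (@harmonic_orthogonal R n 0 d.1) ?subrr//.
  by rewrite eq_sym.
exists (peval c 0) => x xS.
by rewrite pE// pevalD (pdot_eq0 ww)// addr0; apply: homog0_const; case: Hc.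
Qed.

Lemma bin_le_expn h m : ('C(h + m, h) <= h.+1 ^ m)%N.
Proof.
elim: m => [|m IH]; first by rewrite addn0 binn.
have := mul_bin_diag (h + m).+1 m.
rewrite -(bin_sub (leq_addl h m)) addnK -addnS => e.
have : (m.+1 * 'C(h + m.+1, h) <= m.+1 * h.+1 ^ m.+1)%N.
  rewrite -[X in 'C(_, X)](addnK m.+1 h) bin_sub ?leq_addl// -e expnS.
  rewrite mulnA leq_mul//; nia.
by rewrite leq_mul2l.
Qed.

Lemma sum_cauchy_schwarz (T : eqType) (s : seq T) (f g : T -> R) :
  (\sum_(a <- s) f a * g a) ^+ 2 <= (\sum_(a <- s) f a ^+ 2) * (\sum_(a <- s) g a ^+ 2).
Proof.
set A := \sum_(a <- s) f a ^+ 2; set B := \sum_(a <- s) f a * g a.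
set C := \sum_(a <- s) g a ^+ 2.
have C0 : 0 <= C by apply: sumr_ge0 => a _; exact: sqr_ge0.
have q : 0 <= C * (A * C - B ^+ 2).
  have -> : C * (A * C - B ^+ 2) = \sum_(a <- s) (C * f a - B * g a) ^+ 2.
    transitivity (\sum_(a <- s) (C ^+ 2 * f a ^+ 2 - 2 * C * B * (f a * g a) + B ^+ 2 * g a ^+ 2)).
      by rewrite big_split sumrB/= -!mulr_sumr -/A -/B -/C; ring.
    by apply: eq_bigr => a _; ring.
  by apply: sumr_ge0 => a _; exact: sqr_ge0.
have [c0|cn0] := eqVneq C 0; last first.
  by rewrite -subr_ge0 -(pmulr_rge0 _ (_ : 0 < C))// lt_neqAle eq_sym cn0.
rewrite c0 mulr0 (_ : B = 0) ?expr0n//.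
rewrite /B big_seq big1// => a as_; move: c0 => /eqP.
rewrite psumr_eq0 => [/allP/(_ a as_)|? _]; last exact: sqr_ge0.
by rewrite sqrf_eq0 => /eqP ->; rewrite mulr0.
Qed.

(** The sum of [a(x)^2] over an orthonormal basis is invariant under rotations,
    so it is constant, equal to the dimension divided by the volume; then the
    Cauchy-Schwarz inequality bounds the expansion of [Y] in the basis. *)
Lemma harmonic_sup_bound h Y x : harmonic_homog h Y -> on_sphere x ->
  peval Y x ^+ 2 <= h.+1%:R ^+ n / I (fun _ : 'rV[R]_n.+1 => 1) * pdot Y Y.
Proof.
move=> HY xS; have [e [oe se eH eE]] := harmonic_basis h.
have V0 := @sphere_volume_gt0 R n; set V := I (fun=> 1) in V0 *.
pose K : P := \sum_(a <- e) a * a.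
have [c Kc] : exists c, forall x, on_sphere x -> peval K x = c.
  apply: rot_invariant_const => i j y yS.
  have -> : prot i j K = \sum_(a <- e) (prot i j a * a *+ 2).
    rewrite /prot /K !linear_sum/= !mulr_sumr -sumrB; apply: eq_bigr => a _.
    by rewrite !mderivM mulr2n; ring.
  have -> : peval (\sum_(a <- e) prot i j a * a *+ 2) y =
      (\sum_(a <- e) \sum_(b <- e) pdot (prot i j a) b * peval a y * peval b y) *+ 2.
    rewrite peval_sum -sumrMnl big_seq [RHS]big_seq; apply: eq_bigr => a ae.
    rewrite !mulr2n pevalD pevalM (eE _ (harmonic_prot i j (eH a ae)))//.
    by congr (_ + _); rewrite mulr_suml; apply: eq_bigr => b _; ring.
  (* The rotation has a skew-symmetric matrix in the basis. *)
  set S := \sum_(a <- e) _.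
  have SN : S = - S.
    rewrite {1}/S exchange_big /S -sumrN; apply: eq_bigr => a _.
    rewrite -sumrN; apply: eq_bigr => b _.
    by rewrite pdot_prot [pdot b _]pdotC; ring.
  have -> : S = 0 by move: SN; lra.
  by rewrite mul0rn.
have cV : c * V = (size e)%:R.
  rewrite /V -sphere_integralZ; last exact: cont_sphere_cst.
  transitivity (\sum_(a <- e) pdot a a).
    rewrite -sphere_integral_sum; last by move=> a; exact: cont_sphere_pevalM.
    apply: eq_sphere_integral => y yS; rewrite mulr1 -(Kc y yS) peval_sum.
    by apply: eq_bigr => a _; rewrite pevalM.
  rewrite big_seq (eq_bigr (fun=> 1)); last by move=> a; exact: orthonormal_norm.
  by rewrite -big_seq big_const_seq count_predT iter_addr addr0.
have cle : c <= h.+1%:R ^+ n / V.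
  rewrite ler_pdivlMr// cV -natrX ler_nat.
  exact: leq_trans se (bin_le_expn h n).
rewrite (eE Y HY x xS); apply: le_trans (sum_cauchy_schwarz _ _ _) _.
have -> : \sum_(a <- e) peval a x ^+ 2 = c.
  rewrite -(Kc x xS) peval_sum; apply: eq_bigr => a _; rewrite pevalM; ring.
have -> : \sum_(a <- e) pdot Y a ^+ 2 = pdot Y Y.
  rewrite -[RHS](@eq_pdot _ _ (\sum_(a <- e) pdot Y a *: a)); last first.
    move=> y yS; rewrite peval_sum (eE Y HY y yS).
    by apply: eq_bigr => a _; rewrite pevalZ.
  by rewrite pdot_suml; apply: eq_bigr => a _; rewrite pdotZl [pdot a _]pdotC expr2.
by rewrite mulrC ler_wpM2r// pdot_ge0.
Qed.

(** The Fourier sum over an orthonormal basis. *)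
Lemma harmonic_projection_exists h (F : 'rV[R]_n.+1 -> R) : cont_sphere F ->
  exists2 p, harmonic_homog h p &
    forall q, harmonic_homog h q -> I (fun x => F x * peval q x) = pdot p q.
Proof.
move=> cF; have [e [oe se eH eE]] := harmonic_basis h.
exists (\sum_(a <- e) I (fun x => F x * peval a x) *: a).
  rewrite big_seq; elim/big_ind: _ => [||a ae]; [exact: harmonic0|exact: harmonicD|].
  exact/harmonicZ/eH.
move=> q Hq; rewrite pdot_suml.
transitivity (I (fun x => \sum_(a <- e) pdot q a * (F x * peval a x))).
  apply: eq_sphere_integral => x xS; rewrite (eE q Hq x xS) mulr_sumr.
  by apply: eq_bigr => a _; rewrite mulrCA.
have cFa a : cont_sphere (fun x => F x * peval a x) by apply: cont_sphereM => //; exact: cont_sphere_peval.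
rewrite sphere_integral_sum; last by move=> a; exact: cont_sphereZ.
apply: eq_bigr => a _; rewrite sphere_integralZ// pdotZl mulrC.
by rewrite [pdot a q]pdotC.
Qed.

End Reproducing.

(** * Dominated series and rapidly decreasing components *)

Section DominatedSeries.
Variable R : realType.
Implicit Types (a b : nat -> R) (C : R).

(** The majorant [1 / ((h + 1) (h + 2))]: its tails are explicit, so that
    domination gives rates of convergence uniform in parameters. *)
Definition tele (h : nat) : R := h.+1%:R^-1 - h.+2%:R^-1.

Lemma tele_ge0 h : 0 <= tele h.
Proof. by rewrite subr_ge0 lef_pV2 ?posrE// ler_nat. Qed.

Lemma sum_tele N M : (N <= M)%N -> \sum_(N <= h < M) tele h = N.+1%:R^-1 - M.+1%:R^-1.
Proof.
move=> NM; rewrite /tele -[RHS]opprB -[RHS]mulN1r -(telescope_sumr (fun h => h.+1%:R^-1 : R))//.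
by rewrite mulr_sumr; apply: eq_bigr => h _; rewrite mulN1r opprB.
Qed.

Definition tele_dom C a := forall h, `|a h| <= C * tele h.

Lemma tele_dom_C_ge0 C a : tele_dom C a -> 0 <= C.
Proof.
move=> /(_ 0%N) H; have := le_trans (normr_ge0 _) H.
by rewrite pmulr_lge0// /tele subr_gt0 ltf_pV2 ?posrE// ltr_nat.
Qed.

Lemma sq_tele_dom C a : (forall h, h.+1%:R ^+ 2 * `|a h| <= C) -> tele_dom (2 * C) a.
Proof.
move=> H h; have h0 : 0 < h.+1%:R :> R by [].
have C0 : 0 <= C by apply: le_trans (H h); rewrite mulr_ge0// exprn_ge0.
have -> : 2 * C * tele h = 2 * C / (h.+1%:R * h.+2%:R).
  rewrite /tele -[h.+2%:R]natr1; move: (h.+1%:R) h0 => y y0.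
  by field; apply/andP; split; apply: lt0r_neq0; lra.
rewrite ler_pdivlMr ?mulr_gt0//; apply: le_trans (_ : 2 * (h.+1%:R ^+ 2 * `|a h|) <= _); last first.
  by rewrite ler_pM2l//; exact: H.
have h1 : 1 <= h.+1%:R :> R by rewrite ler1n.
have h2 : h.+2%:R <= 2 * h.+1%:R :> R by rewrite -[h.+2%:R]natr1; lra.
have : `|a h| * (h.+1%:R * h.+2%:R) <= `|a h| * (h.+1%:R * (2 * h.+1%:R)).
  by rewrite ler_wpM2l// ler_pM2l.
by move=> /le_trans; apply; rewrite expr2 le_eqVlt; apply/orP; left; apply/eqP; ring.
Qed.

Lemma tele_dom_cvg C a : tele_dom C a -> cvgn (series a).
Proof.
move=> Ha; have C0 := tele_dom_C_ge0 Ha.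
apply: normed_cvg; apply: (@series_le_cvg _ _ (fun h => C * tele h)) => //.
- by move=> h /=; exact: normr_ge0.
- by move=> h; rewrite mulr_ge0 ?tele_ge0.
apply/cvg_ex; exists (C * (1 - 0)).
rewrite (_ : series _ = fun N => C * (1 - N.+1%:R^-1)); last first.
  by apply/funext => N; rewrite /series/= -mulr_sumr sum_tele// invr1.
apply: cvgMr; apply: cvgB; first exact: cvg_cst.
exact: cvg_harmonic.
Qed.

Lemma tele_dom_tail C a N : tele_dom C a ->
  `|limn (series a) - series a N| <= C / N.+1%:R.
Proof.
move=> Ha; have ca := tele_dom_cvg Ha; have C0 := tele_dom_C_ge0 Ha.
have c1 : `|series a M - series a N| @[M --> \oo] --> `|limn (series a) - series a N|.
  by apply: cvg_norm; apply: cvgB => //; exact: cvg_cst.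
rewrite -(cvg_lim _ c1)//; apply: limr_le; first by apply/cvg_ex; eexists; exact: c1.
near=> M.
have NM : (N <= M)%N by near: M; exact: nbhs_infty_ge.
rewrite sub_series_geq//; apply: le_trans (ler_norm_sum _ _ _) _.
apply: (@le_trans _ _ (\sum_(N <= h < M) C * tele h)); first by apply: ler_sum => h _; exact: Ha.
by rewrite -mulr_sumr sum_tele// ler_wpM2l// gerBl invr_ge0.
Unshelve. all: by end_near. Qed.

(** Tannery's theorem: the tails are small uniformly in [t], and the partial
    sums converge. *)
Lemma tannery (T : Type) (F : set_system T) (FF : ProperFilter F)
  (a : nat -> T -> R) (b : nat -> R) C :
  (\forall t \near F, tele_dom C (a ^~ t)) -> tele_dom C b ->
  (forall h, a h t @[t --> F] --> b h) ->
  limn (series (a ^~ t)) @[t --> F] --> limn (series b).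
Proof.
move=> Ha Hb ab; have C0 := tele_dom_C_ge0 Hb.
apply/cvgrPdist_le => e e0.
(* With this [N], each tail is at most [e / 3]. *)
pose N := Num.truncn (3 * C / e).
have N1 : C / N.+1%:R <= e / 3.
  have : 3 * C / e < N.+1%:R by exact: truncnS_gt.
  rewrite ltr_pdivrMr// => H; rewrite ler_pdivrMr// mulrAC ler_pdivlMr//; lra.
have sN : series (a ^~ t) N @[t --> F] --> series b N.
  rewrite /series/=; elim: N {N1} => [|N IH].
    under eq_fun do rewrite big_geq//.
    by rewrite big_geq//; exact: cvg_cst.
  under eq_fun do rewrite big_nat_recr//=.
  by rewrite big_nat_recr//=; apply: cvgD.
have e3 : 0 < e / 3 by rewrite divr_gt0.
move/cvgrPdist_le/(_ _ e3): sN => sN.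
near=> t.
have h1 : `|series b N - series (a ^~ t) N| <= e / 3 by near: t.
have h2 : `|limn (series (a ^~ t)) - series (a ^~ t) N| <= e / 3.
  apply: le_trans N1; apply: tele_dom_tail; by near: t.
have h3 := le_trans (tele_dom_tail N Hb) N1.
move: h1 h2 h3; rewrite !ler_norml => /andP[? ?] /andP[? ?] /andP[? ?].
by apply/andP; split; lra.
Unshelve. all: by end_near. Qed.

End DominatedSeries.

Section RapidSequences.
Variables (R : realType) (n : nat).
Hypothesis n_gt0 : (0 < n)%N.
Local Notation P := (mpolyType R n.+1).
Local Notation I := sphere_integral.
Local Notation vol := (sphere_integral (fun _ : 'rV[R]_n.+1 => 1)).
Implicit Types (Y Z : nat -> mpolyType R n.+1) (i j : 'I_n.+1) (h k : nat) (x : 'rV[R]_n.+1).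

(** The L^2 norms decrease faster than every power of the degree; squaring them
    only doubles the powers. *)
Definition rapid Y := (forall h, harmonic_homog h (Y h)) /\
  forall k, exists C, forall h, h.+1%:R ^+ k * pdot (Y h) (Y h) <= C.

Lemma rapid_sup Y k : rapid Y -> exists C, forall h x, on_sphere x ->
  h.+1%:R ^+ k * `|peval (Y h) x| <= C.
Proof.
move=> [HY /(_ (k + k + n)%N)[C HC]].
have V0 := @sphere_volume_gt0 R n.
exists (1 + C / vol) => h x xS; have h0 : 0 <= h.+1%:R :> R by [].
set t := _ * _; have t0 : 0 <= t by rewrite mulr_ge0// exprn_ge0.
have t2 : t ^+ 2 <= C / vol.
  rewrite /t exprMn real_normK ?num_real// -exprM muln2 -addnn.
  apply: le_trans (ler_wpM2l (exprn_ge0 _ h0) (harmonic_sup_bound n_gt0 (HY h) xS)) _.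
  rewrite mulrA mulrA -exprD -[_ / vol * _]mulrAC ler_wpM2r ?invr_ge0 ?(ltW V0)//.
have C0 : 0 <= C / vol by apply: le_trans t2; exact: sqr_ge0.
by nra.
Qed.

Lemma rapid_mult Y m : poly_growth m -> rapid Y -> rapid (fun h => m h *: Y h).
Proof.
move=> [C [d [C0 Hm]]] [HY rY]; split; first by move=> h; exact: harmonicZ.
move=> k; have [D HD] := rY (k + d + d)%N.
exists (C ^+ 2 * D) => h.
have h0 : 0 <= h.+1%:R :> R by [].
rewrite pdotZl pdotC pdotZl mulrA.
have m2 : m h * m h <= C ^+ 2 * h.+1%:R ^+ (d + d).
  rewrite -expr2 -real_normK ?num_real// exprD -[h.+1%:R ^+ d * _]expr2 -exprMn.
  by rewrite ler_pXn2r ?nnegrE ?mulr_ge0 ?exprn_ge0.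
apply: le_trans (_ : _ <= C ^+ 2 * (h.+1%:R ^+ (k + d + d) * pdot (Y h) (Y h))) _; last first.
  by rewrite ler_wpM2l ?sqr_ge0.
have -> : h.+1%:R ^+ k * (m h * m h * pdot (Y h) (Y h)) =
  (h.+1%:R ^+ k * (m h * m h)) * pdot (Y h) (Y h) by ring.
rewrite [leRHS]mulrA ler_wpM2r ?pdot_ge0//.
have -> : C ^+ 2 * h.+1%:R ^+ (k + d + d) = h.+1%:R ^+ k * (C ^+ 2 * h.+1%:R ^+ (d + d)).
  by rewrite -addnA [in LHS]exprD; ring.
by rewrite ler_wpM2l ?exprn_ge0.
Qed.

(** By skew-symmetry and [casimir], the squared norms of all the rotations of
    [p] add up to the right-hand side. *)
Lemma pdot_prot_le i j h p : harmonic_homog h p ->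
  pdot (prot i j p) (prot i j p) <= 2 * eigen R n h * pdot p p.
Proof.
move=> Hp.
have -> : 2 * eigen R n h * pdot p p = \sum_i \sum_j pdot (prot i j p) (prot i j p).
  transitivity (- pdot (\sum_i \sum_j prot i j (prot i j p)) p).
    by rewrite (casimir Hp) pdotZl mulNr opprK natrM.
  rewrite pdot_suml -sumrN; apply: eq_bigr => k _.
  rewrite pdot_suml -sumrN; apply: eq_bigr => l _.
  by rewrite pdot_prot opprK.
rewrite (bigD1 i)//= (bigD1 j)//= -addrA lerDl addr_ge0//.
  by apply: sumr_ge0 => l _; exact: pdot_ge0.
by apply: sumr_ge0 => k _; apply: sumr_ge0 => l _; exact: pdot_ge0.
Qed.

Lemma eigen_le h : eigen R n h <= n.+1%:R * h.+1%:R ^+ 2.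
Proof. by rewrite -natrX -natrM ler_nat; nia. Qed.

Lemma rapid_prot Y i j : rapid Y -> rapid (fun h => prot i j (Y h)).
Proof.
move=> [HY rY]; split; first by move=> h; exact: harmonic_prot.
move=> k; have [D HD] := rY (k + 2)%N.
exists (2 * n.+1%:R * D) => h.
have h0 : 0 <= h.+1%:R :> R by [].
apply: le_trans (ler_wpM2l (exprn_ge0 _ h0) (pdot_prot_le i j (HY h))) _.
apply: le_trans (_ : _ <= 2 * n.+1%:R * (h.+1%:R ^+ (k + 2) * pdot (Y h) (Y h))) _; last first.
  by rewrite ler_wpM2l ?mulr_ge0.
rewrite !mulrA ler_wpM2r ?pdot_ge0// exprD.
have -> : h.+1%:R ^+ k * 2 * eigen R n h = (2 * h.+1%:R ^+ k) * eigen R n h by ring.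
have -> : 2 * n.+1%:R * (h.+1%:R ^+ k * h.+1%:R ^+ 2) = (2 * h.+1%:R ^+ k) * (n.+1%:R * h.+1%:R ^+ 2) :> R by ring.
by rewrite ler_wpM2l ?mulr_ge0 ?exprn_ge0// eigen_le.
Qed.

Section SmoothDecay.
Variables (U : set 'rV[R]_n.+1) (F : 'rV[R]_n.+1 -> R).
Hypotheses (oU : open U) (SU : forall x, on_sphere x -> U x) (SF : smooth_on U F).
Variable Y : nat -> P.
Hypothesis HY : forall h, harmonic_homog h (Y h).
Hypothesis YF : forall h q, harmonic_homog h q -> I (fun x => F x * peval q x) = pdot (Y h) q.

Let Fk k := iter k (@sphere_lap R n) F.

Let SFk k : smooth_on U (Fk k).
Proof. by elim: k => //= k IH; exact: smooth_on_sphere_lap. Qed.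

Let IFk k h q : harmonic_homog h q ->
  I (fun x => Fk k x * peval q x) = eigen R n h ^+ k * pdot (Y h) q.
Proof.
move=> Hq; elim: k => [|k IH]; first by rewrite expr0 mul1r /Fk/= (YF Hq).
by rewrite /Fk iterS (green_harmonic oU SU (SFk k) Hq) IH exprS mulrA.
Qed.

(** Bessel's inequality for [Fk k], whose component of degree [h] is
    [eigen R n h ^+ k *: Y h]. *)
Let decay k h : eigen R n h ^+ (2 * k) * pdot (Y h) (Y h) <= I (fun x => Fk k x * Fk k x).
Proof.
set l := eigen R n h ^+ k.
have cF : cont_sphere (Fk k) by exact: (smooth_on_cont_sphere oU SU).
have cY : cont_sphere (peval (Y h)) by exact: cont_sphere_peval.
have : 0 <= I (fun x => (Fk k x - l * peval (Y h) x) ^+ 2).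
  apply: sphere_integral_ge0; last by move=> x _; exact: sqr_ge0.
  have c : cont_sphere (fun x => Fk k x - l * peval (Y h) x) by apply: cont_sphereB => //; exact: cont_sphereZ.
  exact: (cont_sphereM c c).
have -> : I (fun x => (Fk k x - l * peval (Y h) x) ^+ 2) =
    I (fun x => Fk k x * Fk k x) - l * l * pdot (Y h) (Y h).
  have c1 : cont_sphere (fun x => Fk k x * Fk k x) by exact: cont_sphereM.
  have c2 : cont_sphere (fun x => Fk k x * peval (Y h) x) by exact: cont_sphereM.
  have c3 := @cont_sphere_pevalM R n (Y h) (Y h).
  transitivity (I (fun x => Fk k x * Fk k x) - 2 * l * I (fun x => Fk k x * peval (Y h) x)
     + l * l * pdot (Y h) (Y h)); last by rewrite (IFk k (HY h)) -/l; ring.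
  rewrite -!sphere_integralZ// -sphere_integralB//; last exact: cont_sphereZ.
  rewrite -sphere_integralD; [|by apply: cont_sphereB => //; exact: cont_sphereZ|exact: cont_sphereZ].
  by apply: eq_sphere_integral => x _; ring.
by rewrite subr_ge0 -expr2 -exprM mulnC.
Qed.

(** The norms in [decay] are bounded in [h], and [eigen R n h] is at least of the
    order of [h] for [h > 0]. *)
Lemma smooth_rapid : rapid Y.
Proof.
split=> // k; exists (pdot (Y 0%N) (Y 0%N) + 2 ^+ (2 * k) * I (fun x => Fk k x * Fk k x)).
have I0 : 0 <= I (fun x => Fk k x * Fk k x).
  apply: sphere_integral_ge0; last by move=> x _; rewrite -expr2 sqr_ge0.
  by apply: cont_sphereM; exact: (smooth_on_cont_sphere oU SU).
case=> [|h].
  by rewrite expr1n mul1r lerDl mulr_ge0// exprn_ge0.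
apply: le_trans (_ : _ <= 2 ^+ (2 * k) * I (fun x => Fk k x * Fk k x)) _; last first.
  by rewrite lerDr pdot_ge0.
apply: le_trans (ler_wpM2l _ (decay k h.+1)); last by rewrite exprn_ge0.
rewrite mulrA ler_wpM2r ?pdot_ge0// -exprMn.
have e1 : h.+2%:R <= 2 * eigen R n h.+1 :> R.
  rewrite /eigen -natrM ler_nat; move: n_gt0; case: (n) => // m _.
  by rewrite addnS subn1 /=; nia.
have h1 : 1 <= h.+2%:R :> R by rewrite ler1n.
apply: le_trans (_ : h.+2%:R ^+ (2 * k) <= _).
  by rewrite ler_weXn2l// leq_pmull.
by rewrite lerXn2r ?nnegrE// (le_trans _ e1).
Qed.

End SmoothDecay.

End RapidSequences.

(** * Smoothness of series of harmonics *)

Section RadialExtension.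
Variables (R : realType) (n : nat).
Local Notation P := (mpolyType R n.+1).
Local Notation e_ i := (delta_mx 0 i : 'rV[R]_n.+1).
Implicit Types (i j : 'I_n.+1) (h k : nat) (x y : 'rV[R]_n.+1).

Definition sqnorm x : R := \sum_i x 0 i ^+ 2.
Definition punctured : set 'rV[R]_n.+1 := [set x | 0 < sqnorm x].
Definition inv_norm x : R := (Num.sqrt (sqnorm x))^-1.

Lemma continuous_sqnorm : continuous sqnorm.
Proof.
move=> x; apply: continuous_sumr => i.
apply: (@continuous_comp _ _ _ (fun x : 'rV[R]_n.+1 => x 0 i) (fun r => r ^+ 2)).
  exact: coord_continuous.
exact: exprn_continuous.
Qed.

Lemma open_punctured : open punctured.
Proof.
rewrite (_ : punctured = sqnorm @^-1` [set r | 0 < r]); last by [].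
by apply: open_comp => [x _|]; [exact: continuous_sqnorm|exact: open_gt].
Qed.

Lemma sphere_punctured x : on_sphere x -> punctured x.
Proof. by rewrite /on_sphere /punctured/= /sqnorm => /eqP ->. Qed.

Lemma inv_norm_gt0 x : punctured x -> 0 < inv_norm x.
Proof. by move=> x0; rewrite invr_gt0 sqrtr_gt0. Qed.

Lemma inv_norm_sq x : punctured x -> inv_norm x ^+ 2 * sqnorm x = 1.
Proof. by move=> x0; rewrite /inv_norm exprVn sqr_sqrtr ?ltW// mulVf ?gt_eqF. Qed.

Lemma inv_norm_sphere x : on_sphere x -> inv_norm x = 1.
Proof. by rewrite /inv_norm /sqnorm => /eqP ->; rewrite sqrtr1 invr1. Qed.

Lemma normalize_on_sphere x : punctured x -> on_sphere (inv_norm x *: x).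
Proof.
move=> x0; rewrite /on_sphere; under eq_bigr do rewrite mxE exprMn.
by rewrite -mulr_sumr -/(sqnorm x) inv_norm_sq.
Qed.

Lemma coord_inv_norm_le x j : punctured x -> `|x 0 j| * inv_norm x <= 1.
Proof.
move=> x0; have r0 := inv_norm_gt0 x0.
have : (`|x 0 j| * inv_norm x) ^+ 2 <= 1.
  rewrite exprMn real_normK ?num_real// -(inv_norm_sq x0) mulrC ler_wpM2l ?sqr_ge0//.
  by rewrite /sqnorm (bigD1 j)//= lerDl; apply: sumr_ge0 => i _; exact: sqr_ge0.
have : 0 <= `|x 0 j| * inv_norm x by rewrite mulr_ge0// ltW.
by nra.
Qed.

Lemma is_derive_via_line (F : 'rV[R]_n.+1 -> R) x v (d : R) :
  is_derive (0 : R) 1 (fun s : R => F (x + s *: v)) d -> is_derive x v F d.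
Proof.
have e : (fun r : R => r^-1 *: (F (r *: v + x) - F x)) =
         (fun r : R => r^-1 *: (F (x + (r *: 1 + 0) *: v) - F (x + 0 *: v))).
  by apply/funext => r; rewrite scale0r !addr0 /GRing.scale/= mulr1 [x + _]addrC.
by move=> [d1 d2]; split; rewrite /derivable /derive /= e.
Qed.

Lemma is_derive_sqnorm x i : is_derive x (e_ i) sqnorm (2 * x 0 i).
Proof.
apply: is_derive_via_line.
have e (s : R) : sqnorm (x + s *: e_ i) = sqnorm x + s * (2 * x 0 i) + s * s.
  rewrite /sqnorm (bigD1 i)//= [in RHS](bigD1 i)//= !mxE !eqxx/=.
  rewrite (eq_bigr (fun j => x 0 j ^+ 2)); first by ring.
  by move=> j ji; rewrite !mxE (negbTE ji) mulr0 addr0.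
under eq_fun do rewrite e.
by apply: is_derive_eq; rewrite /GRing.scale/=; ring.
Qed.

Lemma is_derive_inv_norm x i : punctured x ->
  is_derive x (e_ i) inv_norm (- x 0 i * inv_norm x ^+ 3).
Proof.
move=> x0; apply: is_derive_via_line.
have d1 : is_derive (0 : R) 1 (fun s : R => sqnorm (x + s *: e_ i)) (2 * x 0 i).
  have := @is_derive_line R n sqnorm x (e_ i) 0; rewrite scale0r addr0.
  have [d2 d3] := is_derive_sqnorm x i.
  by move=> /(_ d2); rewrite d3.
have s0 : 0 < sqnorm (x + (0 : R) *: e_ i) by rewrite scale0r addr0.
have sq0 : Num.sqrt (sqnorm (x + (0 : R) *: e_ i)) != 0 by rewrite gt_eqF// sqrtr_gt0.
have d4 := is_derive1_comp (is_derive1_sqrt s0) d1.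
pose g (s : R) : R := Num.sqrt (sqnorm (x + s *: e_ i)).
have d5 := @is_deriveV R g 0 _ 1 sq0 d4.
apply: is_derive_eq d5 _.
rewrite /= /inv_norm scale0r addr0 /GRing.scale/=.
have r0 : Num.sqrt (sqnorm x) != 0 by rewrite gt_eqF// sqrtr_gt0.
by rewrite /g scale0r addr0 exprVn; field; rewrite r0.
Qed.

Lemma continuous_inv_norm x : punctured x -> {for x, continuous inv_norm}.
Proof.
move=> x0; apply: (@continuous_comp _ _ _ sqnorm (fun r : R => (Num.sqrt r)^-1)).
  exact: continuous_sqnorm.
apply: (@continuous_comp _ _ _ Num.sqrt (fun r : R => r^-1)).
  exact: sqrt_continuous.
by apply: inv_continuous; rewrite gt_eqF// sqrtr_gt0.
Qed.

Lemma smooth_on_inv_norm : smooth_on punctured inv_norm.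
Proof.
have oU := open_punctured.
elim=> [|k IH]; first by split=> // x; exact: continuous_inv_norm.
apply: CkS_intro => [x Ux|i x Ux|i]; first exact: continuous_inv_norm.
  by case: (is_derive_inv_norm i Ux).
apply: (@Ck_ext _ _ _ oU _ (fun x => ((-1) * x 0 i) * (inv_norm x * (inv_norm x * inv_norm x)))).
  move=> x Ux; have [_ e] := is_derive_inv_norm i Ux.
  by rewrite /pd e mulN1r; ring.
by apply: CkM => //; [apply: CkM => //; [exact: Ck_cst|exact: Ck_coord]|apply: CkM => //; exact: CkM].
Qed.

Lemma homog_peval_scale h (p : P) c x : homog h p -> peval p (c *: x) = c ^+ h * peval p x.
Proof.
move: p; apply: homog_ind => [|p q Hp Hq|d m <-].
- by rewrite !peval0 mulr0.
- by rewrite !pevalD Hp Hq mulrDr.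
- rewrite !pevalZ mulrCA; congr (_ * _).
  rewrite /peval !mevalX mdegE expr_sum -big_split/=.
  by apply: eq_bigr => i _; rewrite mxE exprMn.
Qed.

Lemma peval_normalize h (p : P) x : homog h p ->
  peval p x * inv_norm x ^+ h = peval p (inv_norm x *: x).
Proof. by move=> hp; rewrite (homog_peval_scale _ _ hp) mulrC. Qed.

(** The function is constant along rays, so its gradient is tangent to the
    spheres: with [r = |x|], [d_i] acts on it as [r^-2 \sum_j x_j (rot j i)]. *)
Lemma pd_radial h (p : P) x i : homog h p -> punctured x ->
  is_derive x (e_ i) (fun x => peval p x * inv_norm x ^+ h)
    (\sum_j x 0 j * inv_norm x ^+ 2 * (peval (prot j i p) x * inv_norm x ^+ h)).
Proof.
move=> hp Ux.
have dp := is_derive_peval p x i.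
have dr : is_derive x (e_ i) (fun x => inv_norm x ^+ h)
    (- (h%:R * x 0 i * inv_norm x ^+ 2 * inv_norm x ^+ h)).
  case: (h) => [|m].
    rewrite !mul0r oppr0; under eq_fun do rewrite expr0.
    exact: is_derive_cst.
  have e : (fun x => inv_norm x ^+ m.+1) = (@inv_norm) ^+ m.+1 by apply/funext => y; rewrite fctE.
  rewrite e.
  apply: is_derive_eq (@is_deriveX R _ inv_norm m.+1 x (e_ i) _ (is_derive_inv_norm i Ux)) _.
  change (m.+1%:R * inv_norm x ^+ m * (- x 0 i * inv_norm x ^+ 3) =
    - (m.+1%:R * x 0 i * inv_norm x ^+ 2 * inv_norm x ^+ m.+1)).
  by rewrite [inv_norm x ^+ m.+1]exprS; ring.
have dm := @is_deriveM R _ (peval p) (fun x => inv_norm x ^+ h) x (e_ i) _ _ dp dr.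
apply: is_derive_eq dm _; rewrite /GRing.scale/=.
under eq_bigr do rewrite pevalB !pevalM !pevalX mulrBl mulrBr.
rewrite sumrB.
have -> : \sum_j x 0 j * inv_norm x ^+ 2 * (x 0 j * peval (mderiv i p) x * inv_norm x ^+ h) =
   peval (mderiv i p) x * inv_norm x ^+ h.
  transitivity (sqnorm x * inv_norm x ^+ 2 * (peval (mderiv i p) x * inv_norm x ^+ h)).
    move: (peval _ x) => a.
    by rewrite /sqnorm !mulr_suml; apply: eq_bigr => j _; ring.
  by rewrite [sqnorm x * _]mulrC inv_norm_sq// mul1r.
have -> : \sum_j x 0 j * inv_norm x ^+ 2 * (x 0 i * peval (mderiv j p) x * inv_norm x ^+ h) =
   x 0 i * inv_norm x ^+ 2 * inv_norm x ^+ h * (h%:R * peval p x).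
  rewrite -pevalZ -(homog_euler hp) /euler peval_sum mulr_sumr.
  by apply: eq_bigr => j _; rewrite pevalM pevalX; ring.
ring.
Qed.

End RadialExtension.

Section SmoothSum.
Variables (R : realType) (n : nat).
Hypothesis n_gt0 : (0 < n)%N.
Local Notation P := (mpolyType R n.+1).
Local Notation e_ i := (delta_mx 0 i : 'rV[R]_n.+1).
Local Notation punct := (@punctured R n).
Implicit Types (Y Z : nat -> mpolyType R n.+1) (i j : 'I_n.+1) (h k : nat) (x y : 'rV[R]_n.+1).

(** The extension of [Y h] from the sphere that is constant along rays.  Unlike
    the polynomial itself, it has the same bounds off the sphere as on it. *)
Definition radial_term Y h x : R := peval (Y h) x * inv_norm x ^+ h.
Definition radial_sum Y x : R := limn (series (fun h => radial_term Y h x)).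

Lemma radial_dom Y : rapid Y -> exists C, forall x, punct x ->
  tele_dom C (fun h => radial_term Y h x).
Proof.
move=> rY; have [C HC] := rapid_sup n_gt0 2 rY.
exists (2 * C) => x Ux; apply: sq_tele_dom => h.
have [HY _] := rY; have [hY _] := HY h.
rewrite /radial_term (peval_normalize _ hY); apply: HC; exact: normalize_on_sphere.
Qed.

Lemma continuous_radial_term Y h x : punct x -> {for x, continuous (radial_term Y h)}.
Proof.
move=> Ux; apply: (@continuousM R _ (peval (Y h)) (fun x => inv_norm x ^+ h)).
  exact: continuous_peval.
apply: (@continuous_comp _ _ _ (@inv_norm R n) (fun r => r ^+ h)).
  exact: continuous_inv_norm.
exact: exprn_continuous.
Qed.

Lemma near_punct x : punct x -> \forall z \near x, punct z.
Proof. by move=> Ux; apply: open_nbhs_nbhs; split=> //; exact: open_punctured. Qed.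

Lemma continuous_radial_sum Y x : rapid Y -> punct x -> {for x, continuous (radial_sum Y)}.
Proof.
move=> rY Ux; have [C HC] := radial_dom rY.
apply: (@tannery R _ (nbhs x) _ (fun h y => radial_term Y h y) (fun h => radial_term Y h x) C).
- by apply: filterS (near_punct Ux) => z; exact: HC.
- exact: HC.
- by move=> h; exact: continuous_radial_term.
Qed.

Lemma cvg_series_sum (J : Type) (r : seq J) (f : J -> nat -> R) (c : J -> R) :
  (forall l, cvgn (series (f l))) ->
  series (fun h => \sum_(l <- r) c l * f l h) @ \oo --> \sum_(l <- r) c l * limn (series (f l)).
Proof.
move=> cf.
rewrite (_ : series _ = fun N => \sum_(l <- r) c l * series (f l) N); last first.
  apply/funext => N; rewrite /series/= exchange_big/=.
  by apply: eq_bigr => l _; rewrite mulr_sumr.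
elim: r => [|l r IH].
  under eq_fun do rewrite big_nil.
  by rewrite big_nil; exact: cvg_cst.
under eq_fun do rewrite big_cons.
by rewrite big_cons; apply: cvgD => //; apply: cvgMr; exact: cf.
Qed.

(** Tannery's theorem for the difference quotients: by the mean value theorem
    they are derivatives at intermediate points, which are dominated in a ball
    where [inv_norm] is bounded. *)
Lemma is_derive_radial_sum Y x i : rapid Y -> punct x ->
  is_derive x (e_ i) (radial_sum Y)
    (\sum_j x 0 j * inv_norm x ^+ 2 * radial_sum (fun h => prot j i (Y h)) x).
Proof.
move=> rY Ux; have [C HC] := radial_dom rY.
have rP j := rapid_prot n_gt0 j i rY.
have [D HD] : exists D, forall j y, punct y ->
    tele_dom D (fun h => radial_term (fun h => prot j i (Y h)) h y).
  have H j := radial_dom (rP j).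
  have [f Hf] := choice H.
  exists (\sum_j `|f j|) => j y Uy h; apply: le_trans (Hf j y Uy h) _.
  rewrite ler_wpM2r ?tele_ge0// (le_trans (ler_norm _))// (bigD1 j)//= lerDl.
  exact: sumr_ge0.
pose dphi h y := \sum_j y 0 j * inv_norm y ^+ 2 * radial_term (fun h => prot j i (Y h)) h y.
have dterm h y : punct y -> is_derive y (e_ i) (radial_term Y h) (dphi h y).
  by move=> Uy; have [HY _] := rY; have [hY _] := HY h; exact: pd_radial.
have domd (K : R) y : punct y -> inv_norm y <= K -> tele_dom (n.+1%:R * (K * D)) (dphi ^~ y).
  move=> Uy yK h; have r0 := inv_norm_gt0 Uy.
  apply: le_trans (ler_norm_sum _ _ _) _.
  apply: (@le_trans _ _ (\sum_(j < n.+1) K * D * tele R h)); last first.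
    by rewrite sumr_const card_ord -mulrnAl mulr_natl.
  apply: ler_sum => j _; rewrite normrM -mulrA; apply: ler_pM => //; last exact: HD.
  rewrite normrM normrX (gtr0_norm r0) expr2 mulrA.
  rewrite -[leRHS]mul1r; apply: ler_pM => //; [by rewrite mulr_ge0// ltW|exact: ltW|].
  exact: coord_inv_norm_le.
have lim_dphi : limn (series (dphi ^~ x)) =
    \sum_j x 0 j * inv_norm x ^+ 2 * radial_sum (fun h => prot j i (Y h)) x.
  apply/cvg_lim => //; rewrite /dphi.
  apply: (@cvg_series_sum _ _ (fun j h => radial_term (fun h => prot j i (Y h)) h x)
    (fun j => x 0 j * inv_norm x ^+ 2)) => j.
  exact: tele_dom_cvg (HD j x Ux).
rewrite -lim_dphi.
pose K := inv_norm x + 1.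
have [d d0 Hd] : exists2 d : R, 0 < d & forall y, ball x d y -> punct y /\ inv_norm y <= K.
  have : \forall y \near x, punct y /\ inv_norm y <= K.
    apply: filterI; first exact: near_punct.
    have /cvgrPdist_le/(_ 1 ltr01) := continuous_inv_norm Ux.
    by apply: filterS => y; rewrite ler_norml => /andP[+ _]; rewrite /K; lra.
  by move=> /nbhs_ballP[d /= d0 Hd]; exists d.
have lim : (fun s : R => s^-1 *: (radial_sum Y (s *: e_ i + x) - radial_sum Y x)) @ 0^'
    --> limn (series (dphi ^~ x)).
  have seg s h : `|s| < d -> forall r : R, 0 <= r <= 1 -> ball x d (x + (r * s) *: e_ i).
    move=> sd r /andP[r0 r1]; rewrite -ball_normE/= opprD addNKr normrN.
    apply: le_lt_trans sd; apply: row_norm_le => // j; rewrite !mxE eqxx/=.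
    rewrite normrM (ger0_norm (_ : 0 <= (j == i)%:R)) ?ler0n// normrM (ger0_norm r0).
    by case: eqVneq => _; rewrite ?mulr0 ?mulr1// ler_piMl.
  have ne : \forall s \near 0^', limn (series (fun h =>
      s^-1 *: (radial_term Y h (s *: e_ i + x) - radial_term Y h x))) =
      s^-1 *: (radial_sum Y (s *: e_ i + x) - radial_sum Y x).
    near=> s.
    have sd : `|s| < d by near: s; exact: dnbhs0_lt.
    have [Us _] : punct (s *: e_ i + x) /\ inv_norm (s *: e_ i + x) <= K.
      apply: Hd; have := seg s 0%N sd 1; rewrite ler01 lexx mul1r addrC; exact.
    apply: cvg_lim => //.
    rewrite (_ : series _ = fun N => s^-1 *: (series (fun h => radial_term Y h (s *: e_ i + x)) N
        - series (fun h => radial_term Y h x) N)); last first.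
      apply/funext => N; rewrite /series/= -sumrB scaler_sumr.
      by [].
    apply: cvgZr; apply: cvgB; exact: tele_dom_cvg (HC _ _).
  apply: cvg_trans (near_eq_cvg ne) _.
  apply: (@tannery R R (0^') _ _ _ (n.+1%:R * (K * D))).
  - near=> s; move=> h.
    have sd : `|s| < d by near: s; exact: dnbhs0_lt.
    have sn0 : s != 0 by near: s; exact: nbhs_dnbhs_neq.
    have [|r r01 er] := @coord_MVT R n (radial_term Y h) x i s.
      by move=> r r01; case: (dterm h _ (proj1 (Hd _ (seg s h sd r r01)))).
    rewrite [s *: e_ i + x]addrC er.
    have [Ur Kr] := Hd _ (seg s h sd r r01).
    have [_ ->] := dterm h _ Ur.
    rewrite [_ *: _]mulrCA mulVf// mulr1; exact: domd.
  - by apply: domd => //; rewrite /K lerDl.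
  - by move=> h; have [d1 <-] := dterm h x Ux; exact: d1.
by split; [exact: cvgP lim|exact: cvg_lim lim].
Unshelve. all: by end_near. Qed.

(** A partial derivative is built from coordinates, [inv_norm] and the radial
    sums of rotated harmonics, which decrease rapidly again. *)
Lemma smooth_on_radial_sum Y : rapid Y -> smooth_on punct (radial_sum Y).
Proof.
have oU := @open_punctured R n.
move=> + k; elim: k Y => [|k IH] Y rY.
  by split=> // x; exact: continuous_radial_sum.
apply: CkS_intro => [x Ux|i x Ux|i]; first exact: continuous_radial_sum.
  by case: (is_derive_radial_sum i rY Ux).
apply: (@Ck_ext _ _ _ oU _ (fun x => \sum_j x 0 j * (inv_norm x * inv_norm x) *
    radial_sum (fun h => prot j i (Y h)) x)) => [x Ux|].
  have [_ e] := is_derive_radial_sum i rY Ux.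
  by rewrite /pd e; under eq_bigr do rewrite -expr2.
elim: (index_enum _) => [|l r IHr].
  by apply: Ck_ext (Ck_cst oU k 0) => // z _; rewrite big_nil.
apply: (@Ck_ext _ _ _ oU _ (fun x => x 0 l * (inv_norm x * inv_norm x) *
    radial_sum (fun h => prot l i (Y h)) x + \sum_(j <- r) x 0 j * (inv_norm x * inv_norm x) *
    radial_sum (fun h => prot j i (Y h)) x)) => [z _|]; first by rewrite big_cons.
apply: CkD => //; apply: CkM => //; last by apply: IH; exact: (rapid_prot n_gt0).
apply: CkM => //; first exact: Ck_coord.
by apply: CkM => //; exact: smooth_on_inv_norm.
Qed.

End SmoothSum.

(** * Completeness of the spherical harmonics *)

Section Completeness.
Variables (R : realType) (n : nat).
Local Notation P := (mpolyType R n.+1).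
Local Notation Xv i := (@mpolyX n.+1 R (mnm1 i)).
Local Notation I := sphere_integral.
Local Notation vol := (sphere_integral (fun _ : 'rV[R]_n.+1 => 1)).
Implicit Types (F : 'rV[R]_n.+1 -> R) (p q : mpolyType R n.+1) (h : nat) (x a : 'rV[R]_n.+1).

Lemma sphere_chord a x : on_sphere a -> on_sphere x ->
  \sum_i (a 0 i - x 0 i) ^+ 2 = 2 - 2 * \sum_i a 0 i * x 0 i.
Proof.
move=> /eqP a1 /eqP x1.
transitivity (\sum_i a 0 i ^+ 2 + \sum_i x 0 i ^+ 2 - 2 * \sum_i a 0 i * x 0 i).
  by rewrite mulr_sumr -sumrN -!big_split/=; apply: eq_bigr => i _; ring.
by rewrite a1 x1.
Qed.

Lemma sphere_dot_le1 a x : on_sphere a -> on_sphere x -> -1 <= \sum_i a 0 i * x 0 i <= 1.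
Proof.
move=> aS xS; have /eqP a1 := aS; have /eqP x1 := xS.
have hp : 0 <= \sum_i (a 0 i + x 0 i) ^+ 2 by apply: sumr_ge0 => i _; exact: sqr_ge0.
have hm : 0 <= \sum_i (a 0 i - x 0 i) ^+ 2 by apply: sumr_ge0 => i _; exact: sqr_ge0.
have ep : \sum_i (a 0 i + x 0 i) ^+ 2 = 2 + 2 * \sum_i a 0 i * x 0 i.
  transitivity (\sum_i a 0 i ^+ 2 + \sum_i x 0 i ^+ 2 + 2 * \sum_i a 0 i * x 0 i).
    by rewrite mulr_sumr -!big_split/=; apply: eq_bigr => i _; ring.
  by rewrite a1 x1.
rewrite (sphere_chord aS xS) in hm; rewrite ep in hp.
by apply/andP; split; lra.
Qed.

Lemma cap_coord_le a x (d : R) : on_sphere a -> on_sphere x -> 0 <= d ->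
  1 - d ^+ 2 / 2 <= \sum_i a 0 i * x 0 i -> forall i, `|a 0 i - x 0 i| <= d.
Proof.
move=> aS xS d0 H i.
have le : (a 0 i - x 0 i) ^+ 2 <= d ^+ 2.
  apply: (@le_trans _ _ (\sum_i (a 0 i - x 0 i) ^+ 2)); last by rewrite sphere_chord//; lra.
  rewrite (bigD1 i)//= lerDl; apply: sumr_ge0 => j _; exact: sqr_ge0.
by rewrite ler_norml; move: le; move: (a 0 i - x 0 i) => t le; apply/andP; split; nra.
Qed.

Lemma bernoulli_le (s : R) N : 0 <= s -> N%:R * s <= (1 + s) ^+ N.
Proof.
move=> s0; suff : 1 + N%:R * s <= (1 + s) ^+ N by lra.
elim: N => [|N IH]; first by rewrite mul0r addr0 expr0.
rewrite exprS -natr1; have N0 : 0 <= N%:R :> R by [].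
by move: IH; move: (_ ^+ N) (N%:R : R) N0 => A B N0 IH; nra.
Qed.

Lemma cont_sphere_linear a c : cont_sphere (fun x : 'rV[R]_n.+1 => c + \sum_i a 0 i * x 0 i).
Proof.
apply: cont_sphereD; first exact: cont_sphere_cst.
by apply: cont_sphere_sum => i; apply: cont_sphereM; [exact: cont_sphere_cst|exact: cont_sphere_coord].
Qed.

(** If [F a > 0], then [F >= F a / 2] on a cap around [a].  The affine function
    [t x = d / 2 + a . x] has absolute value at most 1 off the cap, whereas
    [t ^+ N >= N (t - 1)] where [t >= 1], so the integral of [F t ^+ N] would grow
    linearly in [N] instead of being 0. *)
Lemma orthogonal_to_polynomials_le0 F : cont_sphere F ->
  (forall p, I (fun x => F x * peval p x) = 0) ->
  forall a, on_sphere a -> F a <= 0.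
Proof.
move=> cF F0 a aS; rewrite leNgt; apply/negP => Fa.
have [M [M0 HM]] := cont_sphere_bounded cF.
have m0 : 0 < F a / 2 by rewrite divr_gt0.
have [d [d0 d1 Hd]] : exists d : R, [/\ 0 < d, d <= 1 &
    forall x, on_sphere x -> 1 - d <= \sum_i a 0 i * x 0 i -> F a / 2 <= F x].
  have /cvgrPdist_le/(_ _ m0) := cF a aS.
  move=> /nbhs_ballP[r /= r0 Hr].
  pose s := Num.min r 1 / 2.
  have mr0 : 0 < Num.min r 1 by rewrite lt_min r0/= ltr01.
  have mr : Num.min r 1 <= r by rewrite ge_min lexx.
  have m1 : Num.min r 1 <= 1 by rewrite ge_min lexx orbT.
  have s0 : 0 < s by rewrite divr_gt0.
  have s1 : s <= 1 by rewrite /s; lra.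
  have sr : s < r by rewrite /s; lra.
  exists (s ^+ 2 / 2); split; [by rewrite divr_gt0// exprn_gt0|by nra|].
  move=> x xS Hx; have := cap_coord_le aS xS (ltW s0) Hx => Hc.
  have bx : ball a r x.
    rewrite -ball_normE/=; apply: le_lt_trans sr; apply: row_norm_le => [|i]; first exact: ltW.
    by rewrite !mxE.
  have := Hr x bx; rewrite ler_norml => /andP[_ h2]; lra.
pose t x : R := d / 2 + \sum_i a 0 i * x 0 i.
have ct : cont_sphere t by exact: cont_sphere_linear.
(* [t ^+ N >= N * phi] wherever [t >= 0], and [phi] vanishes off the cap. *)
pose phi x : R := Num.max 0 (t x - 1).
have cphi : cont_sphere phi.
  move=> x xS; apply: (@continuous_comp _ _ _ (fun x => t x - 1) (fun r : R => Num.max 0 r)).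
    by apply: cont_sphereB => //; exact: cont_sphere_cst.
  by apply: (@continuous_max R _ (fun=> 0) id); [exact: cst_continuous|exact: cvg_id].
have phi0 x : 0 <= phi x by rewrite /phi le_max lexx.
have Iphi : 0 < I phi.
  apply: (@sphere_integral_gt0 _ _ _ a) => //.
  rewrite /phi lt_max /t; apply/orP; right.
  have -> : \sum_i a 0 i * a 0 i = 1.
    by move: aS => /eqP <-; apply: eq_bigr => i _; rewrite expr2.
  lra.
have tN N : exists p, forall x, peval p x = t x ^+ N.
  elim: N => [|N [p Hp]]; first by exists 1 => x; rewrite peval1.
  exists (((d / 2) *: 1 + \sum_i a 0 i *: Xv i) * p) => x.
  rewrite pevalM Hp exprS pevalD pevalZ peval1 mulr1 peval_sum; congr ((_ + _) * _).
  by apply: eq_bigr => i _; rewrite pevalZ pevalX.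
have lb N x : on_sphere x -> N%:R * (F a / 2) * phi x - M <= F x * t x ^+ N.
  move=> xS; have /andP[b1 b2] := sphere_dot_le1 aS xS.
  have FM := HM x xS.
  have [cap|cap] := lerP (1 - d) (\sum_i a 0 i * x 0 i).
    have Fx := Hd x xS cap; have Fx0 : 0 <= F x by apply: le_trans Fx; exact: ltW.
    have t0 : 0 <= t x by rewrite /t; lra.
    have [t1|t1] := lerP 1 (t x).
      rewrite /phi max_r ?subr_ge0//.
      have := @bernoulli_le (t x - 1) N; rewrite subr_ge0 [1 + _]addrC subrK => /(_ t1) B.
      rewrite -mulrA mulrCA; have := ler_pM (ltW m0) (_ : 0 <= N%:R * (t x - 1)) Fx B.
      by rewrite mulr_ge0 ?subr_ge0// => /(_ isT); lra.
    rewrite /phi max_l ?subr_le0 ?(ltW t1)// mulr0 sub0r.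
    by apply: (@le_trans _ _ 0); [rewrite oppr_le0|rewrite mulr_ge0// exprn_ge0].
  have tx : `|t x| <= 1 by rewrite ler_norml /t; apply/andP; split; lra.
  rewrite /phi max_l; last by move: tx; rewrite ler_norml => /andP[_]; lra.
  rewrite mulr0 sub0r.
  have : `|F x * t x ^+ N| <= M.
    rewrite normrM normrX -[M]mulr1; apply: ler_pM => //.
    by rewrite exprn_ile1.
  by rewrite ler_norml => /andP[].
have key N : N%:R * (F a / 2) * I phi - M * vol <= 0.
  have [p Hp] := tN N; rewrite -(F0 p).
  rewrite -!sphere_integralZ//; last exact: cont_sphere_cst.
  rewrite -sphere_integralB; [|exact: cont_sphereZ|by apply: cont_sphereZ; exact: cont_sphere_cst].
  apply: ler_sphere_integral.
  - by apply: cont_sphereB; [exact: cont_sphereZ|apply: cont_sphereZ; exact: cont_sphere_cst].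
  - by apply: cont_sphereM => //; exact: cont_sphere_peval.
  - by move=> x xS; rewrite Hp mulr1; exact: lb.
pose N := (Num.truncn (M * vol / (F a / 2 * I phi))).+1.
have B0 : 0 < F a / 2 * I phi by rewrite mulr_gt0.
have : M * vol / (F a / 2 * I phi) < N%:R by exact: truncnS_gt.
rewrite ltr_pdivrMr// => H; have := key N; lra.
Qed.

Lemma orthogonal_to_harmonics_eq0 F : cont_sphere F ->
  (forall h q, harmonic_homog h q -> I (fun x => F x * peval q x) = 0) ->
  forall x, on_sphere x -> F x = 0.
Proof.
move=> cF F0.
have Fp p : I (fun x => F x * peval p x) = 0.
  have [s [sH sE]] := harmonic_decomposition p.
  transitivity (I (fun x => \sum_(d <- s) F x * peval d.2 x)).
    by apply: eq_sphere_integral => x xS; rewrite sE// mulr_sumr.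
  rewrite sphere_integral_sum; last by move=> d; apply: cont_sphereM => //; exact: cont_sphere_peval.
  by rewrite big_seq big1// => d /sH/F0.
move=> x xS; apply/eqP; rewrite eq_le orthogonal_to_polynomials_le0//=.
rewrite -oppr_le0; apply: (@orthogonal_to_polynomials_le0 (fun x => - F x)) => //; first exact: cont_sphereN.
move=> p; transitivity (I (fun x => - (F x * peval p x))).
  by apply: eq_sphere_integral => y _; rewrite mulNr.
by rewrite sphere_integralN ?Fp ?oppr0//; apply: cont_sphereM => //; exact: cont_sphere_peval.
Qed.

(** Orthogonal projections, specified by testing: this determines [Y] on the
    sphere and does not depend on the choice of representatives. *)
Definition harmonic_coefs F (Y : nat -> P) := (forall h, harmonic_homog h (Y h)) /\
  forall h q, harmonic_homog h q -> I (fun x => F x * peval q x) = pdot (Y h) q.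

Lemma harmonic_coefs_unique F Y Z h x : harmonic_coefs F Y -> harmonic_coefs F Z ->
  on_sphere x -> peval (Y h) x = peval (Z h) x.
Proof.
move=> [HY cY] [HZ cZ] xS; apply/eqP; rewrite -subr_eq0 -pevalB; apply/eqP.
have HB := harmonicB (HY h) (HZ h).
by apply: pdot_eq0 => //; rewrite pdotBl -(cY _ _ HB) -(cZ _ _ HB) subrr.
Qed.

Section Expansion.
Hypothesis n_gt0 : (0 < n)%N.

Lemma radial_sum_sphere (Y : nat -> P) x : on_sphere x ->
  radial_sum Y x = limn (series (fun h => peval (Y h) x)).
Proof.
move=> xS; rewrite /radial_sum; congr (limn (series _)); apply/funext => h.
by rewrite /radial_term inv_norm_sphere// expr1n mulr1.
Qed.

Lemma cont_sphere_radial_sum (Y : nat -> P) : rapid Y -> cont_sphere (radial_sum Y).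
Proof. by move=> rY x xS; apply: continuous_radial_sum => //; exact: sphere_punctured. Qed.

(** Integration term by term, allowed by the uniform bound on the tails; by
    orthogonality a single term remains. *)
Lemma harmonic_coefs_radial_sum Y : rapid Y -> harmonic_coefs (radial_sum Y) Y.
Proof.
move=> rY; have [HY _] := rY; split=> // h q Hq.
have [C HC] := radial_dom n_gt0 rY.
have [M [M0 HM]] := cont_sphere_bounded (@cont_sphere_peval R n q).
have cR := cont_sphere_radial_sum rY.
have V0 := @sphere_volume_gt0 R n.
pose K := C * M * vol.
have C0 : 0 <= C by apply: tele_dom_C_ge0 (HC (delta_mx 0 0) (sphere_punctured (on_sphere_delta _ _))).
have bound N : (h < N)%N -> `|I (fun x => radial_sum Y x * peval q x) - pdot (Y h) q| <= K / N.+1%:R.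
  move=> hN.
  have -> : pdot (Y h) q = I (fun x => (\sum_(k < N) peval (Y k) x) * peval q x).
    transitivity (I (fun x => \sum_(k < N) peval (Y k) x * peval q x)); last first.
      by apply: eq_sphere_integral => x _; rewrite mulr_suml.
    rewrite sphere_integral_sum; last by move=> k; exact: cont_sphere_pevalM.
    rewrite (bigD1 (Ordinal hN))//= big1 ?addr0// => k kh.
    exact: (@harmonic_orthogonal R n k h).
  have cS : cont_sphere (fun x => \sum_(k < N) peval (Y k) x).
    by apply: cont_sphere_sum => k; exact: cont_sphere_peval.
  rewrite -sphere_integralB; [|by apply: cont_sphereM => //; exact: cont_sphere_peval..].
  rewrite /K mulrAC; apply: sphere_integral_bound.
    by apply: cont_sphereB; apply: cont_sphereM => //; exact: cont_sphere_peval.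
  move=> x xS; rewrite -mulrBl normrM mulrAC; apply: ler_pM => //; last exact: HM.
  have := tele_dom_tail N (HC x (sphere_punctured xS)).
  rewrite /series/= big_mkord.
  rewrite (_ : \sum_(k < N) peval (Y k) x = \sum_(k < N) radial_term Y k x)//.
  by apply: eq_bigr => k _; rewrite /radial_term inv_norm_sphere// expr1n mulr1.
apply/eqP; rewrite -subr_eq0 -normr_eq0 eq_le normr_ge0 andbT leNgt; apply/negP => e0.
set e := `|_| in bound e0.
pose N := (h + (Num.truncn (K / e)).+1)%N.
have := bound N; rewrite /N addnS ltnS leq_addr => /(_ isT).
have h1 : K / e < (Num.truncn (K / e)).+1%:R by exact: truncnS_gt.
have h2 : (Num.truncn (K / e)).+1%:R <= (h + (Num.truncn (K / e)).+1).+1%:R :> R by rewrite ler_nat; lia.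
rewrite ler_pdivlMr -?addnS// => h3.
move: h1; rewrite ltr_pdivrMr// => h1.
have := ler_wpM2l (ltW e0) h2; lra.
Qed.

(** The difference of the two sides is continuous without any harmonic
    component. *)
Lemma harmonic_expansion F Y : cont_sphere F -> rapid Y -> harmonic_coefs F Y ->
  forall x, on_sphere x -> F x = radial_sum Y x.
Proof.
move=> cF rY [HY cY] x xS; have cR := cont_sphere_radial_sum rY.
have [_ cR'] := harmonic_coefs_radial_sum rY.
apply/eqP; rewrite -subr_eq0; apply/eqP.
apply: (@orthogonal_to_harmonics_eq0 (fun x => F x - radial_sum Y x)) => //; first exact: cont_sphereB.
move=> h q Hq.
transitivity (I (fun x => F x * peval q x - radial_sum Y x * peval q x)).
  by apply: eq_sphere_integral => y _; rewrite mulrBl.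
rewrite sphere_integralB; [|by apply: cont_sphereM => //; exact: cont_sphere_peval..].
by rewrite (cY h q Hq) (cR' h q Hq) subrr.
Qed.

End Expansion.

End Completeness.

(** * Spectral operators on smooth functions *)

Section CoordinateMultiplication.
Variables (R : realType) (n : nat).
Hypothesis n_gt0 : (0 < n)%N.
Local Notation P := (mpolyType R n.+1).
Local Notation Xv i := (@mpolyX n.+1 R (mnm1 i)).
Local Notation I := sphere_integral.
Implicit Types (F : 'rV[R]_n.+1 -> R) (p q a b : mpolyType R n.+1) (j : 'I_n.+1) (h : nat).
Implicit Types (x : 'rV[R]_n.+1) (Y : nat -> mpolyType R n.+1).

Lemma peval_mulX_sphere j h p x : on_sphere x ->
  x 0 j * peval p x = peval (raise h j p) x + peval (lower h j p) x.
Proof.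
move=> xS; rewrite -pevalX -pevalM (raise_lower h) pevalD pevalM peval_normsq//.
by rewrite mul1r.
Qed.

Lemma pdot_mulX j h p q : pdot (Xv j * p) q = pdot p (raise h j q) + pdot p (lower h j q).
Proof.
rewrite ![pdot p _]pdotC -pdotDl pdotC; apply: eq_sphere_integral => x xS.
rewrite pevalM pevalD -(peval_mulX_sphere _ _ _ xS) pevalX; ring.
Qed.

(** Both sides are equal to [pdot (Xv j * a) b], since orthogonality of different
    degrees leaves one component of [x_j a], and one of [x_j b]. *)
Lemma pdot_lower j h a b : harmonic_homog h.+1 a -> harmonic_homog h b ->
  pdot (lower h.+1 j a) b = pdot a (raise h j b).
Proof.
move=> Ha Hb.
transitivity (pdot (Xv j * a) b).
  rewrite pdotC -[RHS]pdotC.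
  have -> : pdot b (Xv j * a) = pdot b (raise h.+1 j a) + pdot b (lower h.+1 j a).
    rewrite ![pdot b _]pdotC -pdotDl; apply: eq_pdot => x xS.
    by rewrite pevalM pevalX pevalD (peval_mulX_sphere _ h.+1).
  rewrite (harmonic_orthogonal n_gt0 _ Hb (harmonic_raise j Ha)) ?add0r//; lia.
rewrite (pdot_mulX j h).
rewrite (harmonic_orthogonal n_gt0 _ Ha (harmonic_lower j Hb)) ?addr0//; lia.
Qed.

Definition mulX_coefs j Y h : P :=
  lower h.+1 j (Y h.+1) + (if h is h'.+1 then raise h' j (Y h') else 0).

(** Multiplication by [x_j] is moved to the test polynomial [q], and from there
    to [Y] by [pdot_lower]. *)
Lemma harmonic_coefs_mulX j F Y : cont_sphere F -> harmonic_coefs F Y ->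
  harmonic_coefs (fun x => x 0 j * F x) (mulX_coefs j Y).
Proof.
move=> cF [HY cY]; split=> [h|h q Hq].
  apply: harmonicD; first exact: (harmonic_lower j (HY h.+1)).
  by case: h => [|h]; [exact: harmonic0|exact: (harmonic_raise j (HY h))].
have cFp p : cont_sphere (fun x => F x * peval p x) by apply: cont_sphereM => //; exact: cont_sphere_peval.
transitivity (I (fun x => F x * peval (raise h j q) x) + I (fun x => F x * peval (lower h j q) x)).
  rewrite -sphere_integralD//; apply: eq_sphere_integral => x xS.
  by rewrite -mulrDr -(peval_mulX_sphere _ _ _ xS); ring.
rewrite (cY _ _ (harmonic_raise j Hq)) (cY _ _ (harmonic_lower j Hq)) /mulX_coefs pdotDl.
rewrite (pdot_lower j (HY h.+1) Hq); congr (_ + _).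
case: h Hq => [|h] Hq; last by rewrite /= pdotC (pdot_lower j Hq (HY h)) pdotC.
by rewrite lower0// pdotC !pdot0l.
Qed.

(** Euler's identity for the homogeneous polynomial [p]. *)
Lemma sum_coord_lower h p x : harmonic_homog h p -> on_sphere x ->
  \sum_j x 0 j * peval (lower h j p) x = lower_weight R n h * peval p x.
Proof.
move=> [hp _] xS; transitivity ((2 * h%:R + n%:R - 1)^-1 * peval (euler p) x).
  rewrite /euler peval_sum mulr_sumr; apply: eq_bigr => j _.
  by rewrite /lower pevalZ pevalM pevalX mulrCA.
by rewrite (homog_euler hp) pevalZ /lower_weight mulrA [_^-1 * _]mulrC.
Qed.

Lemma sum_coord_raise h p x : harmonic_homog h p -> on_sphere x ->
  \sum_j x 0 j * peval (raise h j p) x = (1 - lower_weight R n h) * peval p x.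
Proof.
move=> Hp xS; rewrite mulrBl mul1r -(sum_coord_lower Hp xS).
transitivity (\sum_j (x 0 j ^+ 2 * peval p x - x 0 j * peval (lower h j p) x)).
  apply: eq_bigr => j _; have := peval_mulX_sphere j h p xS => e.
  by rewrite expr2 -mulrA e mulrDr addrK.
rewrite sumrB -mulr_suml.
by move: (xS) => /eqP ->; rewrite mul1r.
Qed.

End CoordinateMultiplication.

Section PolyGrowth.
Variable R : realType.
Implicit Type m : nat -> R.

Lemma poly_growth_pred m : poly_growth m -> poly_growth (fun h => m h.-1).
Proof.
move=> [C [k [C0 Hm]]]; exists C, k; split=> // h; apply: le_trans (Hm _) _.
by rewrite ler_wpM2l// lerXn2r ?nnegrE// ler_nat; case: h.
Qed.

Lemma poly_growth_succ m : poly_growth m -> poly_growth (fun h => m h.+1).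
Proof.
move=> [C [k [C0 Hm]]]; exists (C * 2 ^+ k), k; split=> [|h]; first by rewrite mulr_ge0 ?exprn_ge0.
apply: le_trans (Hm _) _; rewrite -mulrA -exprMn ler_wpM2l// lerXn2r ?nnegrE ?mulr_ge0//.
by rewrite -natrM ler_nat; lia.
Qed.

Lemma poly_growthM m m' : poly_growth m -> poly_growth m' -> poly_growth (fun h => m h * m' h).
Proof.
move=> [C [k [C0 Hm]]] [D [l [D0 Hm']]]; exists (C * D), (k + l)%N; split=> [|h]; first exact: mulr_ge0.
by rewrite normrM exprD mulrACA; apply: ler_pM.
Qed.

Lemma poly_growth_bounded m : (forall h, `|m h| <= 1) -> poly_growth m.
Proof. by move=> H; exists 1, 0%N; split=> // h; rewrite mul1r expr0. Qed.

Lemma lower_weight_itv n h : (0 < n)%N -> 0 <= lower_weight R n h <= 1.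
Proof.
move=> n0; rewrite /lower_weight.
have n1 : 1 <= n%:R :> R by rewrite ler1n.
have h0 : 0 <= h%:R :> R by [].
have d0 : 0 <= 2 * h%:R + n%:R - 1 :> R by lra.
rewrite divr_ge0//=; have [->|] := eqVneq (2 * h%:R + n%:R - 1 : R) 0; first by rewrite invr0 mulr0.
by move=> dn0; rewrite ler_pdivrMr ?lt0r ?dn0// mul1r; lra.
Qed.

End PolyGrowth.

Section SpectralOperators.
Variables (R : realType) (n : nat).
Hypothesis n_gt0 : (0 < n)%N.
Local Notation P := (mpolyType R n.+1).
Local Notation I := sphere_integral.
Implicit Types (F : 'rV[R]_n.+1 -> R) (u v : sphere R n -> R) (Y : nat -> mpolyType R n.+1).
Implicit Types (m : nat -> R) (q : mpolyType R n.+1) (h : nat) (x : sphere R n) (j : 'I_n.+1).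

Lemma val_on_sphere x : on_sphere (val x).
Proof. exact: (valP x). Qed.

Lemma l2dotE u v (f : 'rV[R]_n.+1 -> R) :
  (forall x, u x * v x = f (val x)) -> l2dot u v = I f.
Proof.
move=> uvf; apply: eq_sphere_integral => y yS.
by rewrite /ext0 (insubT (fun y : 'rV[R]_n.+1 => \sum_i y 0 i ^+ 2 == 1) yS)/= uvf.
Qed.

Lemma harmonic_coefs_proj F u : cont_sphere F -> (forall x, u x = F (val x)) ->
  harmonic_coefs F (fun h => harmonic_proj h u).
Proof.
move=> cF uF.
have dotE p q : l2dot (u \- restr p) (restr q) = I (fun y => F y * peval q y) - pdot p q.
  rewrite (@l2dotE _ _ (fun y => F y * peval q y - peval p y * peval q y)) => [|x].
    rewrite sphere_integralB//; last exact: cont_sphere_pevalM.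
    by apply: cont_sphereM => //; exact: cont_sphere_peval.
  by rewrite /= uF -mulrBl.
have spec h : harmonic_homog h (harmonic_proj h u) /\
    forall q, harmonic_homog h q -> l2dot (u \- restr (harmonic_proj h u)) (restr q) = 0.
  apply: (@xgetPex _ 0 [set p | harmonic_homog h p /\
    forall q, harmonic_homog h q -> l2dot (u \- restr p) (restr q) = 0]).
  have [p Hp Ep] := harmonic_projection_exists h cF.
  by exists p; split=> // q Hq; rewrite dotE Ep// subrr.
split=> [h|h q Hq]; first by have [] := spec h.
by have [_ /(_ q Hq)] := spec h; rewrite dotE => /eqP; rewrite subr_eq0 => /eqP.
Qed.

(** The projections chosen in the definition may be replaced by any others. *)
Lemma spectral_opE m F u Y x : cont_sphere F -> (forall x, u x = F (val x)) -> harmonic_coefs F Y ->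
  spectral_op m u x = limn (series (fun h => m h * peval (Y h) (val x))).
Proof.
move=> cF uF cY; rewrite /spectral_op; congr (limn (series _)); apply/funext => h.
congr (_ * _).
exact: (harmonic_coefs_unique h (harmonic_coefs_proj cF uF) cY (val_on_sphere x)).
Qed.

(** The components of [x_j F] decrease rapidly because [x_j F] is smooth too. *)
Lemma smooth_expansion u : Cinfty n u -> exists F Y,
  [/\ cont_sphere F, (forall x, u x = F (val x)), rapid Y, harmonic_coefs F Y &
      forall j, rapid (mulX_coefs j Y)].
Proof.
move=> [U [F [oU SU' SF uF]]].
have SU (x : 'rV[R]_n.+1) : on_sphere x -> U x by move=> xS; exact: (SU' (exist _ x xS)).
have cF : cont_sphere F by exact: (smooth_on_cont_sphere oU SU).
exists F, (fun h => harmonic_proj h u).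
have cY := harmonic_coefs_proj cF uF.
split=> //; first by apply: (smooth_rapid n_gt0 oU SU SF); case: cY.
move=> j; have [H1 H2] := harmonic_coefs_mulX n_gt0 j cF cY.
apply: (smooth_rapid n_gt0 oU SU _ H1 H2).
by apply: smooth_onM => //; exact: smooth_on_coord.
Qed.

Lemma rapid_cvg Y x : rapid Y -> cvgn (series (fun h => peval (Y h) (val x))).
Proof.
move=> rY; have xS := val_on_sphere x; have [C HC] := radial_dom n_gt0 rY.
rewrite (_ : (fun h => _) = fun h => radial_term Y h (val x)).
  exact: tele_dom_cvg (HC _ (sphere_punctured xS)).
by apply/funext => h; rewrite /radial_term inv_norm_sphere// expr1n mulr1.
Qed.

Lemma spectral_op_radial m u : poly_growth m -> Cinfty n u -> exists Z, [/\ rapid Z,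
  (forall x, u x = radial_sum Z (val x)) &
  forall x, spectral_op m u x = radial_sum (fun h => m h *: Z h) (val x)].
Proof.
move=> mg /smooth_expansion[F [Y [cF uF rY cY _]]]; exists Y; split=> // x.
  by rewrite uF (harmonic_expansion n_gt0 cF rY cY (val_on_sphere x)).
rewrite (spectral_opE m x cF uF cY) radial_sum_sphere ?val_on_sphere//.
by congr (limn (series _)); apply/funext => h; rewrite pevalZ.
Qed.

Lemma spectral_op_smooth m u : poly_growth m -> Cinfty n u -> Cinfty n (spectral_op m u).
Proof.
move=> mg /(spectral_op_radial mg)[Y [rY _ E]].
exists (@punctured R n), (radial_sum (fun h => m h *: Y h)); split=> //.
- exact: open_punctured.
- by move=> x; apply/sphere_punctured/val_on_sphere.
- by apply: smooth_on_radial_sum => //; exact: rapid_mult.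
Qed.

Lemma spectral_op_cancel m m' u : poly_growth m -> (forall h, m' h * m h = 1) ->
  Cinfty n u -> spectral_op m' (spectral_op m u) = u.
Proof.
move=> mg mm /(spectral_op_radial mg)[Y [rY uE E]]; apply/funext => x.
have rmY := rapid_mult mg rY.
rewrite (spectral_opE m' x (cont_sphere_radial_sum n_gt0 rmY) E (harmonic_coefs_radial_sum n_gt0 rmY)).
rewrite uE radial_sum_sphere ?val_on_sphere//.
by congr (limn (series _)); apply/funext => h; rewrite pevalZ mulrA mm mul1r.
Qed.

(** The series on the left pair the multiplier of degree [h] with components of
    degrees [h - 1] and [h + 1], whereas [gamma_ratio_identity] pairs multipliers
    of those degrees with the component of degree [h].  The general terms differ
    by [a h.+1 - a h], where [a] tends to 0 by rapid decay, so the sums agree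
    without rearranging the series. *)
Lemma sum_coord_commutator g u : 0 < g -> g < n%:R / 2 -> Cinfty n u ->
  forall x, \sum_(j < n.+1) xcoord j x * commutator_mul (intertwining n g) (xcoord j) u x =
    g * (n%:R + 2 * g - 2) * intertwining n (g - 1) u x.
Proof.
move=> g0 gn /smooth_expansion[F [Y [cF uF rY cY rZ]]] x.
have n1 : 1 <= n%:R :> R by rewrite ler1n.
have [HY _] := rY.
have m1g : poly_growth (gamma_ratio n (g - 1)).
  have np := half_dim_add_neq1 n_gt0 g0 gn.
  by apply: gamma_ratio_growth; [lra|rewrite addrA subr_eq0|lra|rewrite gt_eqF//; lra].
set c := g * _.
pose m := gamma_ratio n g; pose b := lower_weight R n; pose m1 := gamma_ratio n (g - 1).
have mg : poly_growth m by apply: gamma_ratio_growth; rewrite ?gt_eqF//; lra.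
pose xs := val x; have xS : on_sphere xs := val_on_sphere x.
pose y h := peval (Y h) xs; pose z j h := peval (mulX_coefs j Y h) xs.
pose a h := if h is h'.+1 then m h' * (b h * y h) - m h * ((1 - b h') * y h') else 0.
have term h : \sum_j xs 0 j * (m h * z j h) - m h * y h = c * (m1 h * y h) + (a h.+1 - a h).
  have -> : \sum_j xs 0 j * (m h * z j h) = m h * (b h.+1 * y h.+1 +
      (if h is h'.+1 then (1 - b h') * y h' else 0)).
    transitivity (m h * \sum_j xs 0 j * z j h).
      by rewrite mulr_sumr; apply: eq_bigr => j _; rewrite mulrCA.
    congr (_ * _); rewrite -(sum_coord_lower (HY h.+1) xS).
    case: h => [|h].
      rewrite addr0; apply: eq_bigr => j _.
      by rewrite /z /mulX_coefs addr0.
    rewrite -(sum_coord_raise (HY h) xS) -big_split/=; apply: eq_bigr => j _.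
    by rewrite -mulrDr -pevalD.
  have id : (1 - b h) * m h.+1 + b h * m h.-1 - m h = c * m1 h.
    exact: gamma_ratio_identity.
  rewrite mulrA -id; case: h {id} => [|h] /=; last by ring.
  by rewrite (_ : b 0%N = 0) ?/b/lower_weight ?mul0r//; ring.
have cY_ : cvgn (series (fun h => m h * y h)).
  have := rapid_cvg (x := x) (rapid_mult mg rY).
  by congr (cvgn (series _)); apply/funext => h; rewrite pevalZ.
have cZ j : cvgn (series (fun h => m h * z j h)).
  have := rapid_cvg (x := x) (rapid_mult mg (rZ j)).
  by congr (cvgn (series _)); apply/funext => h; rewrite pevalZ.
have cY1 : cvgn (series (fun h => m1 h * y h)).
  have := rapid_cvg (x := x) (rapid_mult m1g rY).
  by congr (cvgn (series _)); apply/funext => h; rewrite pevalZ.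
have small m' : poly_growth m' -> m' h * y h @[h --> \oo] --> 0.
  move=> mg'; rewrite (_ : (fun h => _) = fun h => peval (m' h *: Y h) xs).
    exact/cvg_series_cvg_0/rapid_cvg/rapid_mult.
  by apply/funext => h; rewrite pevalZ.
have bg : poly_growth b.
  apply: poly_growth_bounded => h; have /andP[b0 b1] := lower_weight_itv R h n_gt0.
  by rewrite ger0_norm.
have b'g : poly_growth (fun h => 1 - b h).
  apply: poly_growth_bounded => h; have /andP[b0 b1] := lower_weight_itv R h n_gt0.
  by rewrite ger0_norm /b; lra.
have a0 : a h @[h --> \oo] --> 0.
  have s1 := small _ (poly_growthM (poly_growth_pred mg) bg).
  have s2 := small _ (poly_growthM (poly_growth_succ mg) b'g).
  rewrite -cvg_shiftS /= in s1; rewrite -cvg_shiftS.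
  rewrite (_ : (fun h => _) =
    fun h => m h * b h.+1 * y h.+1 - m h.+1 * (1 - b h) * y h); last first.
    by apply/funext => h; rewrite /= !mulrA.
  have := cvgB (FF := eventually_filter) s1 s2; rewrite subr0; exact.
have Pu : intertwining n g u x = limn (series (fun h => m h * y h)) by exact: (spectral_opE m x cF uF cY).
have Pxu j : intertwining n g (xcoord j \* u) x = limn (series (fun h => m h * z j h)).
  apply: (@spectral_opE m (fun y => y 0 j * F y)).
  - by apply: cont_sphereM => //; exact: cont_sphere_coord.
  - by move=> y'; rewrite /= uF.
  - exact: harmonic_coefs_mulX.
have Qu : intertwining n (g - 1) u x = limn (series (fun h => m1 h * y h)) by exact: (spectral_opE m1 x cF uF cY).
have L : \sum_(j < n.+1) xcoord j x * commutator_mul (intertwining n g) (xcoord j) u x =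
    \sum_j xs 0 j * limn (series (fun h => m h * z j h)) - limn (series (fun h => m h * y h)).
  transitivity (\sum_j (xs 0 j * limn (series (fun h => m h * z j h)) -
      xs 0 j ^+ 2 * limn (series (fun h => m h * y h)))).
    apply: eq_bigr => j _; rewrite /commutator_mul /= Pxu Pu /xcoord -/xs; ring.
  by rewrite sumrB -mulr_suml (eqP xS) mul1r.
rewrite L Qu.
have cvL : series (fun h => \sum_j xs 0 j * (m h * z j h)) N - series (fun h => m h * y h) N
    @[N --> \oo] --> \sum_j xs 0 j * limn (series (fun h => m h * z j h))
      - limn (series (fun h => m h * y h)).
  have s1 := @cvg_series_sum R 'I_n.+1 (index_enum _) (fun j h => m h * z j h) (fun j => xs 0 j) cZ.
  exact: (cvgB (FF := eventually_filter) s1 cY_).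
have cvR : c * series (fun h => m1 h * y h) N + a N @[N --> \oo] -->
    c * limn (series (fun h => m1 h * y h)) + 0.
  have s1 := cvgMr (a := c) (FF := eventually_filter) cY1.
  exact: (cvgD (FF := eventually_filter) s1 a0).
rewrite -(cvg_lim _ cvL)// -[RHS]addr0 -(cvg_lim _ cvR)//; congr (limn _).
apply/funext => N; rewrite /series/= -sumrB mulr_sumr.
have -> : a N = \sum_(0 <= h < N) (a h.+1 - a h) by rewrite telescope_sumr// subr0.
by rewrite -big_split/=; apply: eq_bigr => h _; exact: term.
Qed.

End SpectralOperators.

Theorem theorem1p6 (R : realType) (n : nat) (gamma : R)
    (n_ge1 : (1 <= n)%N) (gamma_gt0 : 0 < gamma) (gamma_lt : gamma < n%:R / 2) :
  (forall u : sphere R n -> R, Cinfty n u ->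
     (fun x => \sum_(j < n.+1)
        xcoord j x * commutator_mul (intertwining n gamma) (xcoord j) u x) =
     (fun x => gamma * (n%:R + 2 * gamma - 2) *
        intertwining n (gamma - 1) u x)) /\
  (gamma < 1 ->
     inverse_on (Cinfty n)
       (intertwining n (1 - gamma)) (intertwining n (gamma - 1))).
Proof.
split=> [u uC|g1]; first by apply/funext => x; exact: sum_coord_commutator.
have n1 : 1 <= n%:R :> R by rewrite ler1n.
have p1 : -1 < n%:R / 2 + (gamma - 1) by lra.
have p2 : -1 < n%:R / 2 - (gamma - 1) by lra.
have q1 : n%:R / 2 + (gamma - 1) != 0.
  by rewrite addrA subr_eq0 half_dim_add_neq1.
have q2 : n%:R / 2 - (gamma - 1) != 0 by rewrite gt_eqF//; lra.
have eB : gamma - 1 = - (1 - gamma) by ring.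
have gQ := gamma_ratio_growth p1 q1 p2 q2.
have gP : poly_growth (gamma_ratio n (1 - gamma)).
  by apply: gamma_ratio_growth; rewrite -?[1 - gamma]opprB ?opprK.
have inv h : gamma_ratio n (1 - gamma) h * gamma_ratio n (gamma - 1) h = 1.
  have nz : gamma_ratio n (gamma - 1) h != 0 by exact: gamma_ratio_neq0.
  rewrite -[RHS](mulVf nz); congr (_ * _).
  by rewrite /gamma_ratio [RHS]invf_div eB opprK.
split=> u uC.
- exact: spectral_op_smooth.
- exact: spectral_op_smooth.
- by apply: (@spectral_op_cancel R n n_ge1 (gamma_ratio n (1 - gamma))) => // h; rewrite mulrC inv.
- exact: (@spectral_op_cancel R n n_ge1 (gamma_ratio n (gamma - 1))).
Qed.
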